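(* Let $G=\mathrm{Diff}(\mathbb R)$ with Lie algebra $\mathfrak g=\mathfrak X_c(\mathbb R)$, or $G=\mathrm{Diff}(S^1)$ with Lie algebra $\mathfrak g=\mathfrak X(S^1)$, with the right invariant weak Riemannian metric induced by $\langle X,Y\rangle=\int X(x)Y(x)\,dx$. Then, in right trivialization, the Riemannian curvature is given for $X,Y,Z\in\mathfrak g$ by $$\mathcal R(X,Y)Z=-X''YZ+XY''Z-2X'YZ'+2XY'Z'=-2[X,Y]Z'-[X,Y]'Z=-\alpha([X,Y])Z .$$
   Context: Vector fields $X\partial_x$ on $\mathbb R$ (with compact support) or on $S^1$ are identified with functions $X$; the Lie bracket is $[X,Y]=X'Y-XY'$ (the negative of the usual bracket of vector fields, i.e. the Lie algebra bracket of the diffeomorphism group). $\mathrm{ad}(X)Y=[X,Y]$, $\mathrm{ad}(X)^\top$ is its adjoint with respect to $\langle\ ,\ \rangle$, and $\alpha(X)Z:=\mathrm{ad}(Z)^\top X$; explicitly $\mathrm{ad}(X)^\top Z=2X'Z+XZ'$ and $\alpha(X)Z=2Z'X+ZX'$. The group $\mathrm{Diff}(\mathbb R)$ is regarded as an infinite dimensional Lie group modeled on $C_c^\infty(\mathbb R,\mathbb R)$. Right trivialization identifies $T_gG$ with $\mathfrak g$ via $h\mapsto h\circ g^{-1}$; the curvature is that of the Levi-Civita connection, with convention $\mathcal R(X,Y)=[\nabla_X,\nabla_Y]-\nabla_{[X,Y]}$ (the last bracket being that of vector fields on $G$). *)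

(* Defs.v *)
From HB Require Import structures.
From mathcomp Require Import all_boot all_order all_algebra.
From mathcomp Require Import all_classical all_reals all_analysis.

Set Implicit Arguments.
Unset Strict Implicit.
Unset Printing Implicit Defensive.

Import Order.TTheory GRing.Theory Num.Theory numFieldNormedType.Exports.

Local Open Scope classical_set_scope.
Local Open Scope ring_scope.

Section Smooth.
Context {R : realType}.

Definition iterD (V : normedModType R) (vs : seq V) (f : V -> R^o) : V -> R^o :=
  foldr (fun v g => 'D_v g) f vs.

(* For V finite-dimensional and A open, this is C^oo on A. *)
Definition smooth_on (V : normedModType R) (A : set V) (f : V -> R^o) : Prop :=
  forall (vs : seq V) (x : V), A x -> differentiable (iterD vs f) x.

Definition smooth (f : R -> R) : Prop := smooth_on [set: R^o] f.

End Smooth.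

(* The real line, or the circle R / 2 pi Z.  Vector fields and diffeomorphisms
   are written as functions R -> R in the coordinate x; a diffeomorphism of the
   circle is represented by any of its lifts to R. *)
Variant manifold := Line | Circle.

Section DiffGroup.
Context {R : realType} (M : manifold).

Definition period : R := pi *+ 2.

(* The Lie algebra, and also, as a space of functions x |-> h x with
   h x \in T_{g x} M, every tangent space T_g Diff(M). *)
Definition is_vf (X : R -> R) : Prop :=
  smooth X /\
  match M with
  | Line => exists A : R, forall x, A < `|x| -> X x = 0
  | Circle => forall x, X (x + period) = X x
  end.

(* Orientation-reversing diffeomorphisms are included. *)
Definition is_diffeo (g : R -> R) : Prop :=
  [/\ smooth g,
      exists h : R -> R, [/\ smooth h, cancel g h & cancel h g] &
      match M with
      | Line => True
      | Circle => (forall x, g (x + period) = g x + period) \/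
                  (forall x, g (x + period) = g x - period)
      end].

(* F depends on an element of Diff(M) only, not on the lift representing it. *)
Definition lift_invariant (T : Type) (F : (R -> R) -> T) : Prop :=
  match M with
  | Line => True
  | Circle => forall (g : R -> R) (k : int), is_diffeo g ->
                F (fun x => g x + period *~ k) = F g
  end.

Definition ginv (g : R -> R) : R -> R := fun y => [get x | g x = y].

Definition rtriv (g h : R -> R) : R -> R := h \o ginv g.

Definition ip (X Y : R -> R) : R :=
  match M with
  | Line => \int[lebesgue_measure]_(x in [set: R]) (X x * Y x)
  | Circle => \int[lebesgue_measure]_(x in `[0, period]) (X x * Y x)
  end.

(* The opposite of the usual bracket of vector fields. *)
Definition ad (X Y : R -> R) : R -> R :=
  fun x => derive1 X x * Y x - X x * derive1 Y x.

(* The adjoint of ad X, evaluated at Z: the unique W in the Lie algebra with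
   < ad X Y, Z > = < Y, W > for all Y. *)
Definition ad_top (X Z : R -> R) : R -> R :=
  [get W : R -> R | is_vf W /\
     forall Y, is_vf Y -> ip (ad X Y) Z = ip Y W].

Definition alpha (X Z : R -> R) : R -> R := ad_top Z X.

(* Diff(M) is modeled on C_c^oo(R) (resp. C^oo(S^1)) by the affine charts
   h |-> g + h.  A family indexed by an open set U of R^n is smooth, in the
   model space or in Diff(M), if it is jointly smooth and, on the line, locally
   in the parameter it varies only inside a fixed compact set. *)
Definition smooth_family (n : nat) (U : set 'rV[R]_n.+1)
    (c : 'rV[R]_n.+1 -> R -> R) : Prop :=
  smooth_on [set p : 'rV[R]_n.+1 * R^o | U p.1] (fun p => c p.1 p.2) /\
  match M with
  | Line => forall s0, U s0 -> exists A : R,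
      \forall s \near s0, forall x, A < `|x| -> c s x = c s0 x
  | Circle => True
  end.

Definition diffeo_family (n : nat) (U : set 'rV[R]_n.+1)
    (c : 'rV[R]_n.+1 -> R -> R) : Prop :=
  smooth_family U c /\ forall s, U s -> is_diffeo (c s).

(* Smooth maps on Diff(M) are those sending smooth finite-dimensional families
   to smooth families; by Boman's theorem this is smoothness in the sense of
   convenient calculus. *)
Definition smooth_fun (f : (R -> R) -> R) : Prop :=
  lift_invariant f /\
  forall n (U : set 'rV[R]_n.+1) c, open U -> diffeo_family U c ->
    smooth_on U (fun s => f (c s)).

Local Notation field := ((R -> R) -> R -> R).

(* Vector fields on Diff(M), not trivialized: xi g \in T_g Diff(M).  Values
   outside Diff(M) are irrelevant. *)
Definition smooth_field (xi : field) : Prop :=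
  [/\ lift_invariant xi,
      forall g, is_diffeo g -> is_vf (xi g) &
      forall n (U : set 'rV[R]_n.+1) c, open U -> diffeo_family U c ->
        smooth_family U (fun s => xi (c s))].

(* Derivatives at g in the direction h \in T_g Diff(M), in the affine chart at
   g: for small t, g + t h lies in Diff(M). *)
Definition dfun (f : (R -> R) -> R) (g h : R -> R) : R :=
  derive1 (fun t : R => f (fun x => g x + t * h x)) 0.

Definition dfield (xi : field) (g h : R -> R) : R -> R :=
  fun x => dfun (fun g' => xi g' x) g h.

(* The usual Lie bracket of vector fields on the manifold Diff(M). *)
Definition lie_bracket (xi eta : field) : field :=
  fun g x => dfield eta g (xi g) x - dfield xi g (eta g) x.

Definition metric (g h k : R -> R) : R := ip (rtriv g h) (rtriv g k).

Record covariant_derivative (nabla : field -> field -> field) : Prop := {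
  nabla_smooth : forall xi eta, smooth_field xi -> smooth_field eta ->
    smooth_field (nabla xi eta);
  nabla_linearl : forall f xi1 xi2 eta, smooth_fun f ->
    smooth_field xi1 -> smooth_field xi2 -> smooth_field eta ->
    forall g, is_diffeo g -> forall x,
      nabla (fun g x => f g * xi1 g x + xi2 g x) eta g x =
      f g * nabla xi1 eta g x + nabla xi2 eta g x;
  nabla_additiver : forall xi eta1 eta2,
    smooth_field xi -> smooth_field eta1 -> smooth_field eta2 ->
    forall g, is_diffeo g -> forall x,
      nabla xi (fun g x => eta1 g x + eta2 g x) g x =
      nabla xi eta1 g x + nabla xi eta2 g x;
  nabla_leibniz : forall f xi eta, smooth_fun f ->
    smooth_field xi -> smooth_field eta ->
    forall g, is_diffeo g -> forall x,
      nabla xi (fun g x => f g * eta g x) g x =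
      dfun f g (xi g) * eta g x + f g * nabla xi eta g x
}.

Record levi_civita (nabla : field -> field -> field) : Prop := {
  lc_covariant : covariant_derivative nabla;
  lc_torsion_free : forall xi eta, smooth_field xi -> smooth_field eta ->
    forall g, is_diffeo g -> forall x,
      nabla xi eta g x - nabla eta xi g x = lie_bracket xi eta g x;
  lc_metric : forall xi eta zeta,
    smooth_field xi -> smooth_field eta -> smooth_field zeta ->
    forall g, is_diffeo g ->
      dfun (fun g => metric g (eta g) (zeta g)) g (xi g) =
      metric g (nabla xi eta g) (zeta g) + metric g (eta g) (nabla xi zeta g)
}.

Definition curvature (nabla : field -> field -> field) (xi eta zeta : field) :
    field :=
  fun g x => nabla xi (nabla eta zeta) g x - nabla eta (nabla xi zeta) g x
             - nabla (lie_bracket xi eta) zeta g x.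

End DiffGroup.

(* Main.v *)
Require Import Defs.
From HB Require Import structures.
From mathcomp Require Import all_boot all_order all_algebra.
From mathcomp Require Import all_classical all_reals all_analysis.
From mathcomp Require Import ring lra.

Set Implicit Arguments.
Unset Strict Implicit.
Unset Printing Implicit Defensive.

Import Order.TTheory GRing.Theory Num.Theory numFieldNormedType.Exports.

Local Open Scope classical_set_scope.
Local Open Scope ring_scope.

(** In the affine charts the metric at g becomes, by substitution,
    metric g h k = sigma * int h k g' dx, where sigma is the sign of g'
    (metric_eq).  The metric is weak, so that a Levi-Civita connection has to be
    exhibited.  It is lc_connection: the derivative of eta at g along xi g plus
    the Christoffel form christoffel g (xi g) (eta g), where
    christoffel g h k = (h k)' / g'.  This form is symmetric, whence the torsion
    vanishes.  Since g' has derivative h' in the direction h, compatibility with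
    the metric reduces to int (h k l)' = 0 for h = xi g, k = eta g, l = zeta g
    (lc_connection_metric).

    Any other Levi-Civita connection agrees with it (levi_civita_unique).  The
    difference of the two, paired with a third field through the metric, is
    symmetric in the first two fields and skew in the last two; a trilinear
    expression with these symmetries vanishes, and the metric is definite.

    In the curvature, the terms in which zeta is differentiated along both xi
    and eta combine into its derivative along the bracket (dfield_bracket), and
    the Christoffel forms of first derivatives of the fields cancel.  What remains
    are Christoffel forms of the values of the fields at g (lc_curvature).  Right translation by g turns
    christoffel g h k into the expression (Y Z)' for h = Y o g and k = Z o g
    (christoffel_comp), and the curvature becomes
    (X (Y Z)')' - (Y (X Z)')' + (X Z)' Y' - (Y Z)' X', which expands to the
    formula.  The operator alpha comes from an integration by parts (ip_ad).

    The fields are known to be smooth only along finite-dimensional families, so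
    that every derivative is taken in such a family.  A family c s is extended to
    c s + u h s with one more parameter u (extend); this family stays among the
    diffeomorphisms near u = 0 because diffeomorphisms are characterized by the
    sign of their derivative together with cofinality on the line and the shift
    over a period on the circle (oriented, oriented_near).  Linearity of the
    derivative in the direction and the symmetry of second derivatives then come
    from calculus in the plane.  The bracket needs in addition the derivative of a
    field along a curve that is not a line; Hadamard's lemma,
    gamma t = gamma 0 + t r_t with r_t smooth in t, presents such a curve as a
    diagonal of an extended family (chain_rule).
    Smoothness of the functions obtained on the way is proved by coinduction: a
    class of functions is shown to be stable under derivatives
    (smooth_on_coind). *)

Local Notation iterD := Defs.iterD.

(** * Smooth functions on open sets *)

Section SmoothCalculus.
Context {R : realType}.
Implicit Types V W : normedModType R.

Lemma iterD_rcons V (vs : seq V) (v : V) (f : V -> R^o) :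
  iterD (rcons vs v) f = iterD vs ('D_v f).
Proof. by rewrite /iterD foldr_rcons. Qed.

Lemma smooth_on_diff V (A : set V) (f : V -> R^o) x :
  smooth_on A f -> A x -> differentiable f x.
Proof. by move=> sf; apply: (sf [::]). Qed.

Lemma smooth_on_derive V (A : set V) (f : V -> R^o) v :
  smooth_on A f -> smooth_on A ('D_v f).
Proof. by move=> sf vs x Ax; rewrite -iterD_rcons; apply: sf. Qed.

Lemma smooth_on_sub V (A B : set V) (f : V -> R^o) :
  B `<=` A -> smooth_on A f -> smooth_on B f.
Proof. by move=> BA sf vs x /BA; apply: sf. Qed.

Lemma littleo_differentiable V W (f : V -> W) (df : {linear V -> W}) (x : V) :
  continuous df ->
  (forall e, 0 < e ->
     \forall h \near (0 : V), `|f (h + x) - f x - df h| <= e * `|h|) ->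
  differentiable f x.
Proof.
move=> dfc dfo.
have dfE : f \o shift x = cst (f x) + df +o_ (0 : V) id.
  apply/eqaddoP => e e0; near=> h => /=.
  have /= : `|f (h + x) - f x - df h| <= e * `|h| by near: h; apply: dfo.
  by rewrite !fctE /= opprD addrA.
by apply/diff_locallyP; rewrite (diff_unique dfc dfE).
Unshelve. all: by end_near. Qed.

Lemma differentiable_littleo V W (f : V -> W) (x : V) : differentiable f x ->
  forall e, 0 < e ->
    \forall h \near (0 : V), `|f (h + x) - f x - 'd f x h| <= e * `|h|.
Proof.
move=> /diff_locally /eqaddoP dfE e e0; near=> h.
have /= : `|(f \o shift x - (cst (f x) + 'd f x)) h| <= e * `|h|.
  by near: h; apply: dfE.
by rewrite !fctE /= opprD addrA.
Unshelve. all: by end_near. Qed.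

Lemma near_eq_differentiable V W (f g : V -> W) (x : V) :
  (\near x, f x = g x) -> differentiable f x -> differentiable g x.
Proof.
move=> fg df; have fgx : f x = g x by apply: nbhs_singleton fg.
apply: (littleo_differentiable (diff_continuous df)) => e e0.
have fg0 : \forall h \near (0 : V), f (h + x) = g (h + x).
  have : \forall y \near x, f y = g y by [].
  by rewrite (near_shift (0 : V)) /=; apply: filterS => h /=; rewrite subr0.
near=> h; rewrite -fgx -(near fg0 h) //; near: h.
exact: differentiable_littleo.
Unshelve. all: by end_near. Qed.

(** Coinduction, by induction on the number of derivatives.  The class is only
    required to be stable up to equality on A, since derivatives at a point of
    the open set A depend on values on A. *)
Lemma smooth_on_coind V (A : set V) (P : (V -> R^o) -> Prop) : open A ->
  (forall f, P f -> (forall x, A x -> differentiable f x) /\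
     forall v, exists2 f', P f' & forall x, A x -> 'D_v f x = f' x) ->
  forall f, P f -> smooth_on A f.
Proof.
move=> oA HP; suff H vs : forall f f0, P f -> (forall x, A x -> f x = f0 x) ->
    forall x, A x -> differentiable (iterD vs f0) x.
  by move=> f Pf vs; exact: (H vs f f Pf (fun _ _ => erefl)).
elim/last_ind: vs => [|vs v IH] f f0 Pf ff0 x Ax.
  have [df _] := HP _ Pf.
  apply: near_eq_differentiable (df _ Ax).
  by near=> y; apply: ff0; near: y; apply: open_nbhs_nbhs.
have [_ /(_ v) [f' Pf' f'E]] := HP _ Pf.
rewrite iterD_rcons; apply: (IH f') => // y Ay.
rewrite -f'E //; apply: near_eq_derive; near=> z; apply: ff0.
by near: z; apply: open_nbhs_nbhs.
Unshelve. all: by end_near. Qed.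

Section Algebra.
Variables (V : normedModType R) (A : set V) (S : (V -> R^o) -> Prop).
Implicit Types f g : V -> R^o.

(** The sums, products and quotients of functions in S.  If the derivatives of
    the functions in S are of this form, all elements are smooth (alg_smooth),
    which covers the operations on smooth functions as well as composition. *)
Inductive alg : (V -> R^o) -> Prop :=
| alg_base f : S f -> alg f
| alg_cst c : alg (cst c)
| alg_add f g : alg f -> alg g -> alg (fun x => f x + g x)
| alg_mul f g : alg f -> alg g -> alg (fun x => f x * g x)
| alg_inv f : (forall x, A x -> f x != 0) -> alg f -> alg (fun x => (f x)^-1).

Lemma alg_sum n (f : 'I_n -> V -> R^o) : (forall i, alg (f i)) ->
  alg (fun x => \sum_(i < n) f i x).
Proof.
elim: n f => [|n IH] f sf.
  rewrite (_ : (fun _ => _) = cst 0); first exact: alg_cst.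
  by apply/funext => x; rewrite big_ord0.
rewrite (_ : (fun _ => _) =
    fun x => \sum_(i < n) f (widen_ord (leqnSn n) i) x + f ord_max x).
  by apply: alg_add => //; apply: IH.
by apply/funext => x; rewrite big_ord_recr.
Qed.

Definition derivation_closed f : Prop :=
  (forall x, A x -> differentiable f x) /\
  forall v, exists2 f', alg f' & forall x, A x -> 'D_v f x = f' x.

Hypothesis SD : forall f, S f -> derivation_closed f.

Lemma alg_derive f : alg f -> derivation_closed f.
Proof.
elim=> {f} [//|c|f g _ [df Df] _ [dg Dg]|f g af [df Df] ag [dg Dg]
           |f f0 af [df Df]].
- split=> [x _|v]; first exact: differentiable_cst.
  by exists (cst 0); [apply: alg_cst|move=> x _; rewrite derive_cst].
- split=> [x Ax|v]; first exact: differentiableD (df _ Ax) (dg _ Ax).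
  have [f' af' f'E] := Df v; have [g' ag' g'E] := Dg v.
  exists (fun x => f' x + g' x); first exact: alg_add.
  move=> x Ax; rewrite -f'E // -g'E // -deriveD //; apply: diff_derivable; auto.
- split=> [x Ax|v]; first exact: differentiableM (df _ Ax) (dg _ Ax).
  have [f' af' f'E] := Df v; have [g' ag' g'E] := Dg v.
  exists (fun x => f x * g' x + g x * f' x).
    by apply: alg_add; apply: alg_mul.
  by move=> x Ax; rewrite -f'E // -g'E // -deriveM //; apply: diff_derivable; auto.
- split=> [x Ax|v]; first exact: differentiableV (df _ Ax) (f0 _ Ax).
  have [f' af' f'E] := Df v.
  exists (fun x => (- 1) * (((f x)^-1 * (f x)^-1) * f' x)).
    apply: alg_mul (alg_cst _) _; apply: alg_mul => //.
    by apply: alg_mul; apply: alg_inv.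
  move=> x Ax; rewrite deriveV //; [|exact: f0|by apply: diff_derivable; auto].
  by rewrite -f'E // /GRing.scale /= expr2 invfM; ring.
Qed.

Lemma alg_smooth f : open A -> alg f -> smooth_on A f.
Proof. by move=> oA; apply: (smooth_on_coind oA); apply: alg_derive. Qed.

End Algebra.
End SmoothCalculus.

(** * Operations on smooth functions *)

Section SmoothOperations.
Context {R : realType}.
Implicit Types V W : normedModType R.

Lemma smooth_on_ext V (A : set V) (f g : V -> R^o) : open A ->
  (forall x, A x -> f x = g x) -> smooth_on A f -> smooth_on A g.
Proof.
move=> oA fg sf; pose P g := exists2 f : V -> R^o, smooth_on A f & forall x, A x -> f x = g x.
apply: (smooth_on_coind oA (P := P)); last by exists f.
move=> {f g fg sf} g [f sf fg].
have fgn x : A x -> \forall y \near x, f y = g y.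
  by move=> Ax; near=> y; apply: fg; near: y; apply: open_nbhs_nbhs.
split=> [x Ax|v].
  exact: near_eq_differentiable (fgn _ Ax) (smooth_on_diff sf Ax).
exists ('D_v f).
  by exists ('D_v f) => //; apply: smooth_on_derive.
by move=> x Ax; apply/esym/near_eq_derive/fgn.
Unshelve. all: by end_near. Qed.

Section Open.
Variables (V : normedModType R) (A : set V) (oA : open A).
Implicit Types f g : V -> R^o.

Lemma smooth_alg f : alg A (smooth_on A) f -> smooth_on A f.
Proof.
apply: alg_smooth => // {}f sf; split=> [x|v]; first exact: smooth_on_diff.
by exists ('D_v f) => //; apply: alg_base; apply: smooth_on_derive.
Qed.

Lemma smooth_on_cst (c : R) : smooth_on A (fun=> c : R^o).
Proof. exact: (smooth_alg (alg_cst _ _ c)). Qed.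

Lemma smooth_onD f g : smooth_on A f -> smooth_on A g ->
  smooth_on A (fun x => f x + g x).
Proof. by move=> sf sg; apply: smooth_alg; apply: alg_add; apply: alg_base. Qed.

Lemma smooth_onM f g : smooth_on A f -> smooth_on A g ->
  smooth_on A (fun x => f x * g x).
Proof. by move=> sf sg; apply: smooth_alg; apply: alg_mul; apply: alg_base. Qed.

Lemma smooth_onV f : (forall x, A x -> f x != 0) -> smooth_on A f ->
  smooth_on A (fun x => (f x)^-1).
Proof. by move=> f0 sf; apply: smooth_alg; apply: alg_inv => //; apply: alg_base. Qed.

Lemma smooth_onZ (c : R) f : smooth_on A f -> smooth_on A (fun x => c * f x).
Proof. by move=> sf; apply: smooth_onM => //; apply: smooth_on_cst. Qed.

Lemma smooth_onN f : smooth_on A f -> smooth_on A (fun x => - f x).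
Proof.
move=> sf; apply: (smooth_on_ext oA _ (smooth_onZ (-1) sf)) => x _.
by rewrite mulN1r.
Qed.

End Open.

(** By the chain rule the derivatives of f o G are sums of products of a
    derivative of some G i and of a function h o G with h smooth, so that these
    functions generate an algebra stable under derivatives.  The inner map is
    given by coordinates because smooth_on is about scalar functions. *)
Lemma smooth_on_comp V W n (A : set V) (B : set W) (G : 'I_n -> V -> R^o)
    (e : 'I_n -> W) (f : W -> R^o) : open A ->
  (forall i, smooth_on A (G i)) -> smooth_on B f ->
  (forall x, A x -> B (\sum_(i < n) G i x *: e i)) ->
  smooth_on A (fun x => f (\sum_(i < n) G i x *: e i)).
Proof.
move=> oA sG sf AB; pose g x := \sum_(i < n) G i x *: e i.
have gE : g = \sum_(i < n) (fun x => G i x *: e i).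
  by apply/funext => x; rewrite fct_sumE.
have dg x : A x -> differentiable g x.
  move=> Ax; rewrite gE; apply: differentiable_sum => i.
  by apply: differentiableZl; apply: smooth_on_diff (sG i) Ax.
have Dg x v : A x -> 'D_v g x = \sum_(i < n) 'D_v (G i) x *: e i.
  move=> Ax; rewrite gE derive_sum.
    apply: eq_bigr => i _; rewrite deriveE.
      by rewrite diffZl ?deriveE //; apply: smooth_on_diff (sG i) Ax.
    by apply: differentiableZl; apply: smooth_on_diff (sG i) Ax.
  by move=> i; apply/diff_derivable/differentiableZl; apply: smooth_on_diff (sG i) Ax.
have Dfg h x v : smooth_on B h -> A x ->
    differentiable (h \o g) x /\
    'D_v (h \o g) x = \sum_(i < n) 'D_v (G i) x * 'D_(e i) h (g x).
  move=> sh Ax; have dh := smooth_on_diff sh (AB _ Ax).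
  split; first exact: differentiable_comp (dg _ Ax) dh.
  rewrite deriveE; last exact: differentiable_comp (dg _ Ax) dh.
  rewrite diff_comp //; last exact: dg.
  rewrite /= -[X in 'd h _ X]deriveE; last exact: dg.
  rewrite Dg // linear_sum; apply: eq_bigr => i _.
  by rewrite linearZ /= -deriveE.
pose S k := smooth_on A k \/ exists2 h, smooth_on B h & k = h \o g.
have SD k : S k -> derivation_closed A S k.
  case=> [sk|[h sh ->]].
    split=> [x|v]; first exact: smooth_on_diff.
    exists ('D_v k) => //; apply: alg_base; left; exact: smooth_on_derive.
  split=> [x Ax|v]; first by have [] := Dfg h x 0 sh Ax.
  exists (fun x => \sum_(i < n) 'D_v (G i) x * ('D_(e i) h \o g) x).
    apply: alg_sum => i; apply: alg_mul; apply: alg_base.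
      by left; apply: smooth_on_derive.
    by right; exists ('D_(e i) h) => //; apply: smooth_on_derive.
  by move=> x Ax; have [] := Dfg h x v sh Ax.
by apply: (alg_smooth SD) => //; apply: alg_base; right; exists f.
Qed.

Lemma derive_line V W (f : V -> W) (p v : V) (t : R) :
  'D_1 (fun t : R => f (t *: v + p)) t = 'D_v f (t *: v + p).
Proof.
rewrite /derive; set g1 := fun h => h^-1 *: _; set g2 := fun h => h^-1 *: _.
suff -> : g1 = g2 by []; apply/funext => h; rewrite /g1 /g2 /=.
by rewrite scalerDl [_%:A]mulr1 -addrA.
Qed.

Lemma derivable_line V W (f : V -> W) (p v : V) (t : R) :
  derivable (fun t : R => f (t *: v + p)) t 1 = derivable f (t *: v + p) v.
Proof.
rewrite /derivable; set g1 := fun h => h^-1 *: _; set g2 := fun h => h^-1 *: _.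
suff -> : g1 = g2 by []; apply/funext => h; rewrite /g1 /g2 /=.
by rewrite scalerDl [_%:A]mulr1 -addrA.
Qed.

Lemma derive_affine V W (L l : V -> W) (f : W -> R^o) v p :
  (forall t v p, L (t *: v + p) = t *: l v + L p) ->
  'D_v (f \o L) p = 'D_(l v) f (L p).
Proof.
move=> Ll; rewrite /derive /=; set g1 := fun h => h^-1 *: _.
by set g2 := fun h => h^-1 *: _; suff -> : g1 = g2 by []; apply/funext => h; rewrite /g1 /g2 /= Ll.
Qed.

Lemma smooth_on_affine V W (B : set W) (L l : V -> W) (f : W -> R^o) :
  (forall t v p, L (t *: v + p) = t *: l v + L p) ->
  (forall p, differentiable L p) ->
  smooth_on B f -> smooth_on (L @^-1` B) (f \o L).
Proof.
move=> Ll dL sf vs.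
have -> : iterD vs (f \o L) = iterD (map l vs) f \o L.
  by elim: vs => //= v vs ->; apply/funext => p; apply: derive_affine.
by move=> x Bx; apply: differentiable_comp => //; apply: sf.
Qed.

(** Every linear map out of V is continuous; this holds for the finite
    dimensional spaces used below. *)
Definition lin_continuous V :=
  forall W (f : {linear V -> W}), continuous f.

Lemma lin_continuous_rV n : lin_continuous 'rV[R]_n.
Proof.
move=> W f; rewrite (_ : (f : _ -> _) = \sum_(j < n) (fun u : 'rV_n => u ord0 j *: f (delta_mx 0 j))).
  move=> u; apply: differentiable_continuous.
  apply: (@differentiable_sum _ _ _ _ (fun j (u : 'rV_n) => u ord0 j *: f (delta_mx 0 j))).
  by move=> j; apply: differentiableZl; apply: differentiable_coord.
apply/funext => u; rewrite fct_sumE {1}[u]row_sum_delta linear_sum.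
by apply: eq_bigr => j _; rewrite linearZ.
Qed.

Lemma lin_continuous_R : lin_continuous R^o.
Proof.
move=> W f; rewrite (_ : (f : _ -> _) = fun u : R^o => u *: f 1).
  exact: scalel_continuous.
by apply/funext => u; rewrite -linearZ /= /GRing.scale /= mulr1.
Qed.

Lemma lin_continuous_prod V V' :
  lin_continuous V -> lin_continuous V' -> lin_continuous (V * V')%type.
Proof.
move=> cV cV' W f.
have l1 : linear (fun u : V => f (u, 0)).
  by move=> a u v; rewrite -linearP; congr (f (_, _)); rewrite /= scaler0 addr0.
have l2 : linear (fun u : V' => f (0, u)).
  by move=> a u v; rewrite -linearP; congr (f (_, _)); rewrite /= scaler0 addr0.
pose f1 : {linear V -> W} := HB.pack (fun u : V => f (u, 0)) (GRing.isLinear.Build _ _ _ _ _ l1).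
pose f2 : {linear V' -> W} := HB.pack (fun u : V' => f (0, u)) (GRing.isLinear.Build _ _ _ _ _ l2).
rewrite (_ : (f : _ -> _) = fun u => f1 u.1 + f2 u.2).
  move=> u; apply: (@continuousD _ _ _ (fun u => f1 u.1) (fun u => f2 u.2)).
    by apply: (@continuous_comp _ _ _ fst f1 u); [exact: cvg_fst|exact: cV].
  by apply: (@continuous_comp _ _ _ snd f2 u); [exact: cvg_snd|exact: cV'].
apply/funext => -[u v] /=; rewrite -linearD; congr (f _).
by congr pair; rewrite /= ?addr0 ?add0r.
Qed.

Lemma affine_differentiable V W (L l : V -> W) : lin_continuous V ->
  (forall t v p, L (t *: v + p) = t *: l v + L p) ->
  forall p, differentiable L p.
Proof.
move=> cV Ll.
have ll : linear l.
  move=> a u v; have := Ll 1 (a *: u + v) 0.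
  have := Ll a u v; have := Ll 1 v 0.
  rewrite !scale1r !addr0 => -> -> /eqP; rewrite addrA => /eqP /addIr; exact.
pose l' : {linear V -> W} := HB.pack l (GRing.isLinear.Build _ _ _ _ _ ll).
move=> p; apply: (@littleo_differentiable _ _ _ _ l'); first exact: cV.
move=> e e0; near=> h; have := Ll 1 h p; rewrite !scale1r => ->.
by rewrite addrK /= subrr normr0 mulr_ge0 // ltW.
Unshelve. all: by end_near. Qed.

End SmoothOperations.

(** * Integrals over segments *)

Section Integral.
Context {R : realType}.
Notation mu := (@lebesgue_measure R).
Implicit Types (a b : R) (f g F : R -> R).

Definition cont_on a b f := forall x, a <= x <= b -> {for x, continuous f}.

Lemma cont_on_within a b f : cont_on a b f -> {within `[a, b], continuous f}.
Proof.
move=> cf; apply: continuous_in_subspaceT => x; rewrite inE /= in_itv /=.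
exact: cf.
Qed.

Lemma cont_on_integrable a b f : cont_on a b f ->
  mu.-integrable `[a, b] (EFin \o f).
Proof.
move=> cf; apply: continuous_compact_integrable; first exact: segment_compact.
exact: cont_on_within.
Qed.

Lemma cont_on_int_norm a b f (c : R) : a <= b -> cont_on a b f ->
  (forall x, a <= x <= b -> `|f x| <= c) ->
  `|\int[mu]_(x in `[a, b]) f x| <= c * (b - a).
Proof.
move=> ab cf fc; have mab : measurable (`[a, b]%classic : set R) by exact: measurable_itv.
have muab : mu `[a, b] = (b - a)%:E.
  by rewrite lebesgue_measure_itv /= lte_fin; case: ltgtP ab => // ->; rewrite subrr.
apply: (le_trans (@le_normr_Rintegral _ _ _ mu _ f mab (cont_on_integrable cf))).
have -> : c * (b - a) = \int[mu]_(x in `[a, b]) c.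
  rewrite Rintegral_cst // /lebesgue_measure; congr (_ * _).
  by rewrite -[b - a]/(fine (b - a)%:E) -muab.
apply: le_Rintegral => //.
- by apply: cont_on_integrable => x xab; apply: continuous_comp; [exact: cf|exact: norm_continuous].
- by apply: cont_on_integrable => x xab; apply: cst_continuous.
Qed.

Lemma cont_onB a b f g : cont_on a b f -> cont_on a b g ->
  cont_on a b (fun x => f x - g x).
Proof. by move=> cf cg x xab; apply: continuousB; [apply: cf|apply: cg]. Qed.

Lemma cont_onM a b f g : cont_on a b f -> cont_on a b g ->
  cont_on a b (fun x => f x * g x).
Proof. by move=> cf cg x xab; apply: continuousM; [apply: cf|apply: cg]. Qed.

Lemma cont_on_intD a b f g : cont_on a b f -> cont_on a b g ->
  \int[mu]_(x in `[a, b]) (f x + g x) =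
  \int[mu]_(x in `[a, b]) f x + \int[mu]_(x in `[a, b]) g x.
Proof.
by move=> cf cg; rewrite RintegralD //; apply: cont_on_integrable.
Qed.

Lemma cont_on_intB a b f g : cont_on a b f -> cont_on a b g ->
  \int[mu]_(x in `[a, b]) (f x - g x) =
  \int[mu]_(x in `[a, b]) f x - \int[mu]_(x in `[a, b]) g x.
Proof.
by move=> cf cg; rewrite RintegralB //; apply: cont_on_integrable.
Qed.

Lemma cont_on_intZ a b (c : R) f : cont_on a b f ->
  \int[mu]_(x in `[a, b]) (c * f x) = c * \int[mu]_(x in `[a, b]) f x.
Proof.
by move=> cf; rewrite RintegralZl //; apply: cont_on_integrable.
Qed.

Lemma cont_on_FTC a b f F : a <= b -> cont_on a b f ->
  (forall x, a <= x <= b -> is_derive x 1 F (f x)) ->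
  \int[mu]_(x in `[a, b]) f x = F b - F a.
Proof.
rewrite le_eqVlt => /orP[/eqP <- _ _|ab cf dF].
  by rewrite set_itv1 Rintegral_set1 subrr.
have cF x : a <= x <= b -> {for x, continuous F}.
  by move=> /dF [dF1 _]; apply/differentiable_continuous/derivable1_diffP.
rewrite /Rintegral (continuous_FTC2 (F := F)) //.
- exact: cont_on_within.
- split.
  + by move=> x; rewrite in_itv /= => /andP[ax xb]; have [] := dF x; rewrite // !ltW.
  + by apply: cvg_at_right_filter; apply: cF; rewrite lexx ltW.
  + by apply: cvg_at_left_filter; apply: cF; rewrite lexx ltW.
- move=> x; rewrite in_itv /= => /andP[ax xb]; rewrite derive1E.
  by have [] := dF x; rewrite // !ltW.
Qed.

(** The primitive of f vanishing at a is nonnegative and, as the integral over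
    the rest of the segment is nonnegative too, at most 0; hence its derivative f
    vanishes. *)
Lemma cont_on_int_eq0 a b f : a < b -> cont_on a b f ->
  (forall x, a <= x <= b -> 0 <= f x) ->
  \int[mu]_(x in `[a, b]) f x = 0 -> forall x, a < x < b -> f x = 0.
Proof.
move=> ab cf f0 If x /andP[ax xb].
pose F y := \int[mu]_(x in `[a, y]) f x.
have FE y : a < y < b -> derivable F y 1 /\ derive1 F y = f y.
  move=> /andP[ay yb]; apply: (@continuous_FTC1_closed _ f a y b) => //.
    exact: cont_on_integrable.
  by apply: cf; rewrite !ltW.
have F0 y : a <= y <= b -> F y = 0.
  move=> /andP[ay yb]; apply/eqP; rewrite eq_le; apply/andP; split; last first.
    apply: Rintegral_ge0 => z /=; rewrite in_itv /= => /andP[az zy].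
    by apply: f0; rewrite az (le_trans zy).
  have [yb'|] := ltP y b; last first.
    by move=> bY; rewrite -If (_ : y = b) //; apply/eqP; rewrite eq_le yb.
  have := @Rintegral_itvB R f (BLeft a) (BRight b) y (cont_on_integrable cf).
  rewrite If => /(_ _ _)/wrap[]; rewrite ?bnd_simp // => /eqP.
  rewrite sub0r eqr_oppLR => /eqP; rewrite /F => ->; rewrite oppr_le0.
  apply: Rintegral_ge0 => z /=; rewrite in_itv /= => /andP[az zy]; apply: f0.
  by rewrite zy (le_trans ay) // ltW.
have [|_ <-] := FE x; first by rewrite ax.
rewrite derive1E -[RHS](derive_cst (0 : R^o) (x : R^o) 1).
apply: near_eq_derive; near=> y; apply: F0.
by apply/andP; split; apply: ltW; near: y; [apply: lt_nbhsr|apply: lt_nbhsl].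
Unshelve. all: by end_near. Qed.

End Integral.

(** * Smooth functions of one variable *)

Section OneVariable.
Context {R : realType}.
Implicit Types f g : R -> R.

Lemma smooth_derive1 f : smooth f -> smooth (derive1 f).
Proof.
move=> sf; rewrite (_ : derive1 f = 'D_1 (f : R^o -> R^o)).
  exact: smooth_on_derive.
by apply/funext => x; rewrite derive1E.
Qed.

Lemma smooth_derivable f (x : R) : smooth f -> derivable f x 1.
Proof. by move=> sf; apply/derivable1_diffP; apply: smooth_on_diff sf _. Qed.

Lemma smooth_is_derive f (x : R) : smooth f -> is_derive x 1 f (derive1 f x).
Proof. by move=> sf; rewrite derive1E; apply/derivableP/smooth_derivable. Qed.

Lemma smooth_continuous f : smooth f -> continuous f.
Proof. by move=> sf x; apply: differentiable_continuous; apply: smooth_on_diff sf _. Qed.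

Lemma smoothD f g : smooth f -> smooth g -> smooth (fun x => f x + g x).
Proof. by move=> sf sg; apply: smooth_onD => //; apply: openT. Qed.

Lemma smoothM f g : smooth f -> smooth g -> smooth (fun x => f x * g x).
Proof. by move=> sf sg; apply: smooth_onM => //; apply: openT. Qed.

Lemma smoothZ (c : R) f : smooth f -> smooth (fun x => c * f x).
Proof. by move=> sf; apply: smooth_onZ => //; apply: openT. Qed.

Lemma smoothV f : (forall x, f x != 0) -> smooth f -> smooth (fun x => (f x)^-1).
Proof. by move=> f0 sf; apply: smooth_onV => //; apply: openT. Qed.

Lemma smooth_id : smooth (id : R -> R).
Proof.
apply: (smooth_on_coind openT (P := fun f => f = id \/ exists c, f = cst c)).
  move=> f [->|[c ->]]; split=> [x _|v].
  - by apply: ex_diff.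
  - by exists (cst v); [right; exists v|move=> x _; rewrite derive_id].
  - exact: differentiable_cst.
  - by exists (cst 0); [right; exists 0|move=> x _; rewrite derive_cst].
by left.
Qed.

(** The functions u o h with u smooth are stable under derivatives, since
    (u o h)' = (u' phi) o h. *)
Lemma smooth_ode (phi h : R -> R) : smooth phi ->
  (forall x : R, is_derive x 1 h (phi (h x))) -> smooth h.
Proof.
move=> sphi dh; pose P k := exists2 u : R -> R, smooth u & k = u \o h.
apply: (smooth_on_coind openT (P := P)); last first.
  by exists id => //; exact: smooth_id.
move=> _ [u su ->].
have du x : derivable (u \o h) x 1.
  apply/derivable1_diffP; apply: differentiable_comp; apply/derivable1_diffP.
    by case: (dh x).
  exact: smooth_derivable.
split=> [x _|v]; first exact/derivable1_diffP.
exists ((fun y => v * (derive1 u y * phi y)) \o h).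
  exists (fun y => v * (derive1 u y * phi y)) => //.
  by apply: smoothZ; apply: smoothM => //; apply: smooth_derive1.
move=> x _; rewrite deriveE; last exact/derivable1_diffP.
rewrite -[v]mulr1 linearZ /= -derive1E'; last exact/derivable1_diffP.
rewrite derive1_comp; [|by case: (dh x)|exact: smooth_derivable].
by rewrite [derive1 h x]derive1E (@derive_val _ _ _ _ _ _ _ (dh x)) mulr1.
Qed.

End OneVariable.

(** * Symmetry of second derivatives *)

Lemma dist_triangle_half (R : realType) (x y z e : R) :
  `|x - z| < e / 2 -> `|y - z| < e / 2 -> `|y - x| <= e.
Proof.
by rewrite !ltr_distl ler_distl => /andP[? ?] /andP[? ?]; apply/andP; split; lra.
Qed.

Section Schwarz.
Context {R : realType} (V : normedModType R).
Implicit Types (A : set V) (f : V -> R^o) (p v w : V).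

Lemma nbhs_box p v w (U : set V) : nbhs p U ->
  exists2 h : R, 0 < h & forall s t : R, 0 <= s <= h -> 0 <= t <= h ->
    U (s *: v + (t *: w + p)).
Proof.
move=> /nbhs_ballP [e /= e0 eU]; pose c := `|v| + `|w| + 1.
have c0 : 0 < c by rewrite ltr_wpDl // addr_ge0.
exists (e / c) => [|s t /andP[s0 sh] /andP[t0 th]]; first exact: divr_gt0.
apply: eU; rewrite -ball_normE /= distrC !addrA addrK.
apply: le_lt_trans (ler_normD _ _) _; rewrite !normrZ !ger0_norm //.
rewrite -[ltRHS](divfK (lt0r_neq0 c0)).
apply: le_lt_trans (_ : e / c * (`|v| + `|w|) < _).
  by rewrite mulrDr lerD // ler_wpM2r.
by rewrite ltr_pM2l ?divr_gt0 // /c ltrDl.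
Qed.

Lemma line_mvt f p v (h : R) : 0 <= h ->
  (forall s : R, 0 <= s <= h -> differentiable f (s *: v + p)) ->
  exists2 s : R, 0 <= s <= h & f (h *: v + p) - f p = h * 'D_v f (s *: v + p).
Proof.
move=> h0 df; have [] := @MVT_segment R (fun s => f (s *: v + p))
    (fun s => 'D_v f (s *: v + p)) 0 h h0.
- move=> x; rewrite in_itv /= => /andP[x0 xh]; rewrite -derive_line.
  by apply/derivableP; rewrite derivable_line; apply/diff_derivable/df; rewrite !ltW.
- apply: cont_on_within => x xh; apply/differentiable_continuous/derivable1_diffP.
  by rewrite derivable_line; apply/diff_derivable/df.
- by move=> s; rewrite in_itv /= scale0r add0r subr0 mulrC => sh fE; exists s.
Qed.

(** Two applications of the mean value theorem, in the directions v and w.  The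
    left-hand side is symmetric in v and w, which gives derive_comm. *)
Lemma mixed_difference f p v w (h : R) : 0 <= h ->
  (forall s t : R, 0 <= s <= h -> 0 <= t <= h ->
     differentiable f (s *: v + (t *: w + p)) /\
     differentiable ('D_v f) (s *: v + (t *: w + p))) ->
  exists s t, [/\ 0 <= s <= h, 0 <= t <= h &
    f (h *: v + (h *: w + p)) - f (h *: v + p) - f (h *: w + p) + f p =
    h * h * 'D_w ('D_v f) (s *: v + (t *: w + p))].
Proof.
move=> h0 df; have hh : 0 <= h <= h by rewrite h0 lexx.
have oo : 0 <= (0 : R) <= h by apply/andP; split.
pose phi x := f (h *: w + x) - f x.
have df1 s : 0 <= s <= h -> differentiable f (h *: w + (s *: v + p)).
  by move=> sh; rewrite addrCA; apply: (df _ _ _ _).1.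
have df0 s : 0 <= s <= h -> differentiable f (s *: v + p).
  by move=> sh; have [] := df s 0 sh oo; rewrite scale0r add0r.
have dsh s : 0 <= s <= h -> differentiable (fun x => f (h *: w + x)) (s *: v + p).
  move=> sh; apply: differentiable_comp; last exact: df1.
  by apply: differentiableD => //; apply: differentiable_cst.
have [|s sh sE] := @line_mvt phi p v h h0.
  by move=> s sh; apply: differentiableB; [apply: dsh|apply: df0].
have phiE : 'D_v phi (s *: v + p) =
    'D_v f (h *: w + (s *: v + p)) - 'D_v f (s *: v + p).
  rewrite deriveB; [|exact/diff_derivable/dsh|exact/diff_derivable/df0].
  congr (_ - _); apply: (derive_affine (l := id)) => t u x.
  by rewrite addrCA.
have [|t th tE] := @line_mvt ('D_v f) (s *: v + p) w h h0.
  by move=> t th; rewrite addrCA; apply: (df _ _ _ _).2.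
exists s, t; split; [exact: sh|exact: th|].
rewrite [s *: v + _]addrCA -mulrA -tE -phiE -sE /phi.
rewrite [h *: w + (_ + _)]addrCA; ring.
Qed.

Lemma derive_comm A f p v w : open A -> smooth_on A f -> A p ->
  'D_v ('D_w f) p = 'D_w ('D_v f) p.
Proof.
move=> oA sf Ap; apply/eqP; rewrite -subr_eq0 -normr_le0.
apply/ler_addgt0Pl => e e0; rewrite addr0.
have close u u' : \forall q \near p, `|'D_u ('D_u' f) p - 'D_u ('D_u' f) q| < e / 2.
  have : {for p, continuous ('D_u ('D_u' f))}.
    apply: differentiable_continuous; apply: smooth_on_diff Ap.
    by do 2 apply: smooth_on_derive.
  by move/cvgrPdist_lt; apply; rewrite divr_gt0.
pose U := [set q | [/\ A q, `|'D_w ('D_v f) p - 'D_w ('D_v f) q| < e / 2 &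
  `|'D_v ('D_w f) p - 'D_v ('D_w f) q| < e / 2]].
have nU : nbhs p U.
  have nA : \forall q \near p, A q by apply: open_nbhs_nbhs; split.
  by apply: filterS3 (close w v) (close v w) nA => q cwv cvw Aq; split.
have [h h0 hU] := nbhs_box v w nU.
have sfv := smooth_on_derive v sf; have sfw := smooth_on_derive w sf.
have [|s [t [sh th stE]]] := @mixed_difference f p v w h (ltW h0).
  move=> s t sh th; have [Aq _ _] := hU s t sh th.
  by split; [exact: smooth_on_diff sf Aq|exact: smooth_on_diff sfv Aq].
have [|s' [t' [sh' th' stE']]] := @mixed_difference f p w v h (ltW h0).
  move=> s' t' sh' th'; have [] := hU t' s' th' sh'; rewrite addrCA => Aq _ _.
  by split; [exact: smooth_on_diff sf Aq|exact: smooth_on_diff sfw Aq].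
have [_ d1 _] := hU s t sh th.
have [_ _] := hU t' s' th' sh'; rewrite addrCA => d2.
have hh0 : h * h != 0 by rewrite mulf_neq0 // gt_eqF.
have LE : f (h *: v + (h *: w + p)) - f (h *: v + p) - f (h *: w + p) + f p =
    f (h *: w + (h *: v + p)) - f (h *: w + p) - f (h *: v + p) + f p.
  by rewrite [h *: v + (_ + p)]addrCA; congr (_ + _); apply: addrAC.
have E := mulfI hh0 (etrans (esym stE) (etrans LE stE')).
move: d1 d2; rewrite E; move: ('D_w _ p) ('D_v _ p) ('D_v _ _) => x y z.
exact: dist_triangle_half.
Qed.

End Schwarz.

(** * Differentiation under the integral sign *)

Section ParametricIntegral.
Context {R : realType} (n : nat).
Notation mu := (@lebesgue_measure R).
Notation V := ('rV[R]_n * R^o)%type.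
Variables (a b : R) (ab : a <= b) (W : set V) (oW : open W).
Implicit Types F : V -> R^o.

Lemma slice_cont F s : smooth_on W F -> (forall x, a <= x <= b -> W (s, x)) ->
  cont_on a b (fun x => F (s, x)).
Proof.
move=> sF sW x xab; have := differentiable_continuous (smooth_on_diff sF (sW x xab)).
move=> cF; apply: (@continuous_comp _ _ _ (fun x : R => (s, x)) F) => //.
apply: differentiable_continuous.
apply: (affine_differentiable (@lin_continuous_R R) (l := fun x : R^o => (0, x))).
by move=> t u p; congr pair => /=; rewrite scaler0 add0r.
Qed.

Lemma derive_coord F (h : 'rV[R]_n) q : differentiable F q ->
  'D_(h, 0) F q = \sum_(i < n) h ord0 i * 'D_(delta_mx 0 i, 0) F q.
Proof.
move=> dF; rewrite deriveE // (_ : (h, 0) = \sum_(i < n) h ord0 i *: (delta_mx 0 i, 0) :> V).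
  by rewrite linear_sum; apply: eq_bigr => i _; rewrite linearZ /= -deriveE.
rewrite {1}[h]row_sum_delta; apply/esym.
elim/big_rec2: _ => // i y1 y2 _ ->; congr pair => /=.
by rewrite scaler0 add0r.
Qed.

(** Uniform continuity in the parameter, by compactness of the segment. *)
Lemma uniform_close F s (e : R) : 0 < e -> smooth_on W F ->
  (forall x, a <= x <= b -> W (s, x)) ->
  \forall p \near s, forall x, a <= x <= b ->
    W (p, x) /\ `|F (p, x) - F (s, x)| <= e.
Proof.
move=> e0 sF sW.
have cov := (compact_near_coveringP _).1 (@segment_compact R a b).
suff : \forall p \near s, `[a, b]%classic `<=` (fun x => W (p, x) /\ `|F (p, x) - F (s, x)| <= e).
  by apply: filterS => p sub x xab; apply: sub; rewrite /= in_itv.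
apply: (cov _ (nbhs s)) => x /=; rewrite in_itv /= => xab.
have /cvgrPdist_lt/(_ (e / 2)) : {for (s, x), continuous F}.
  exact: differentiable_continuous (smooth_on_diff sF (sW x xab)).
rewrite divr_gt0 // => /(_ isT) cF.
have : \forall q \near (s, x), W q /\ `|F (s, x) - F q| < e / 2.
  by near=> q; split; near: q => //; apply: open_nbhs_nbhs; split => //; exact: sW.
move=> [[B C] [/= Bs Cx] BC]; exists (C, B) => //= -[y p] /= [Cy Bp].
have [Wp dp] : W (p, y) /\ `|F (s, x) - F (p, y)| < e / 2 by apply: BC.
have [_ ds] : W (s, y) /\ `|F (s, x) - F (s, y)| < e / 2.
  by apply: BC; split => //=; apply: nbhs_singleton.
split => //; rewrite (_ : _ - _ = (F (s, x) - F (s, y)) - (F (s, x) - F (p, y))); last by ring.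
by rewrite (le_trans (ler_normB _ _)) //; lra.
Unshelve. all: by end_near. Qed.

(** By the mean value theorem the error in the first-order expansion of the
    integrand at (s, x) is a difference of two values of its derivative, which is
    small uniformly in x by uniform_close; the increment h is decomposed along
    the coordinates to have finitely many derivatives to control. *)
Lemma integral_differentiable F s : smooth_on W F ->
  (forall x, a <= x <= b -> W (s, x)) ->
  let P p := \int[mu]_(x in `[a, b]) F (p, x) in
  differentiable (P : 'rV[R]_n -> R^o) s /\
  forall v, 'D_v (P : 'rV[R]_n -> R^o) s = \int[mu]_(x in `[a, b]) 'D_(v, 0) F (s, x).
Proof.
move=> sF sW P.
pose dP (h : 'rV[R]_n) : R^o := \int[mu]_(x in `[a, b]) 'D_(h, 0) F (s, x).
have cD h : cont_on a b (fun x => 'D_(h, 0) F (s, x)).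
  by apply: (slice_cont (F := 'D_(h, 0) F)) => //; apply: smooth_on_derive.
have lP : linear dP.
  move=> c u v; rewrite /dP /GRing.scale /= -cont_on_intZ // -cont_on_intD //; last first.
    by apply: cont_onM => // x _; apply: cst_continuous.
  apply: eq_Rintegral => x; rewrite inE /= in_itv /= => xab.
  have dF := smooth_on_diff sF (sW x xab).
  rewrite !deriveE //; have -> : (scalemx c u + v, 0) = c *: (u, 0) + (v, 0) :> V.
    by congr pair; rewrite /= scaler0 addr0.
  by rewrite linearP.
pose L : {linear 'rV[R]_n -> R^o} := HB.pack dP (GRing.isLinear.Build _ _ _ _ _ lP).
have Lc : continuous L by apply: lin_continuous_rV.
have small e : 0 < e -> \forall h \near (0 : 'rV[R]_n), `|P (h + s) - P s - L h| <= e * `|h|.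
  move=> e0; pose C := n%:R * (b - a) + 1.
  have C0 : 0 < C by rewrite ltr_wpDl // mulr_ge0 // subr_ge0.
  have e'0 : 0 < e / C by rewrite divr_gt0.
  have near_s : \forall p \near s, forall x, a <= x <= b -> W (p, x) /\
      forall i : 'I_n, `|'D_(delta_mx 0 i, 0) F (p, x) - 'D_(delta_mx 0 i, 0) F (s, x)| <= e / C.
    have : \forall p \near s, forall i : 'I_n, forall x, a <= x <= b -> 
      `|'D_(delta_mx 0 i, 0) F (p, x) - 'D_(delta_mx 0 i, 0) F (s, x)| <= e / C.
      apply: (@filter_forall _ 'I_n _ (nbhs s) (nbhs_filter s)) => i.
      have := uniform_close e'0 (smooth_on_derive (delta_mx 0 i, 0) sF) sW.
      by apply: filterS => p H x /H[].
    have := uniform_close e'0 sF sW.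
    apply: filterS2 => p H1 H2 x xab; split; first by have [] := H1 x xab.
    by move=> i; apply: H2.
  have [d /= d0 dU] := (nbhs_ballP _ _).1 near_s.
  near=> h.
  have hd : `|h| < d.
    have : ball (0 : 'rV[R]_n) d h by near: h; apply: nbhsx_ballx.
    by rewrite -ball_normE /= sub0r normrN.
  have inU t : 0 <= t <= 1 -> ball s d (t *: h + s).
    move=> /andP[t0 t1]; rewrite -ball_normE /= distrC addrK normrZ ger0_norm //.
    by apply: le_lt_trans hd; rewrite ler_piMl.
  have i1 : 0 <= (1 : R) <= 1 by rewrite ler01 lexx.
  have hsW x : a <= x <= b -> W (h + s, x).
    by move=> xab; have := inU 1 i1; rewrite scale1r => /dU/(_ x xab) [].
  have cF := slice_cont sF sW; have cF' := slice_cont sF hsW.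
  rewrite /P -cont_on_intB // -cont_on_intB //; last exact: cont_onB.
  apply: (@le_trans _ _ (n%:R * `|h| * (e / C) * (b - a))); last first.
    have -> : n%:R * `|h| * (e / C) * (b - a) = e * `|h| * (n%:R * (b - a) / C).
      by ring.
    rewrite -[leRHS]mulr1 ler_wpM2l ?mulr_ge0 ?(ltW e0) //.
    by rewrite ler_pdivrMr // mul1r /C lerDl.
  apply: cont_on_int_norm => //; first by apply: cont_onB => //; apply: cont_onB.
  move=> x xab.
  have [|t t01 tE] := @line_mvt R V F (s, x) (h, 0) 1 ler01.
    move=> t t01; rewrite (_ : _ + _ = (t *: h + s, x)); last first.
      by congr pair => /=; rewrite scaler0 add0r.
    by apply: smooth_on_diff sF _; have [] := dU _ (inU t t01) x xab.
  have hE (u : R) : u *: ((h, 0) : V) + (s, x) = (u *: h + s, x).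
    by congr pair => /=; rewrite scaler0 add0r.
  move: tE; rewrite !hE scale1r mul1r => ->.
  have [Wt Dt] := dU _ (inU t t01) x xab.
  rewrite !derive_coord; [|exact: smooth_on_diff sF Wt|exact: smooth_on_diff sF (sW x xab)].
  rewrite -sumrB; apply: le_trans (ler_norm_sum _ _ _) _.
  rewrite -mulrA mulr_natl -[X in _ *+ X](card_ord n) -sumr_const.
  apply: ler_sum => i _; rewrite -mulrBr normrM ler_pM //.
  rewrite [leRHS](mx_normrE h).
  exact: (le_bigmax 0 (fun ij : 'I_1 * 'I_n => `|h ij.1 ij.2|) (ord0, i)).
have dPs : differentiable (P : 'rV[R]_n -> R^o) s by apply: (littleo_differentiable Lc).
split=> // v; rewrite deriveE //.
rewrite (diff_unique Lc) //; apply/eqaddoP => e e0; near=> h => /=.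
have /= : `|P (h + s) - P s - L h| <= e * `|h| by near: h; apply: small.
by rewrite !fctE /= opprD addrA.
Unshelve. all: by end_near. Qed.

(** The integrals of smooth functions are stable under derivatives. *)
Lemma smooth_on_integral (A : set 'rV[R]_n) F : open A -> smooth_on W F ->
  (forall s x, A s -> a <= x <= b -> W (s, x)) ->
  smooth_on A (fun s => (\int[mu]_(x in `[a, b]) F (s, x)) : R^o).
Proof.
move=> oA sF AW.
apply: (smooth_on_coind oA (P := fun f => exists2 F, smooth_on W F &
  f = fun s => \int[mu]_(x in `[a, b]) F (s, x))); last by exists F.
move=> _ [{}F {}sF ->]; split=> [s As|v].
  by have [] := integral_differentiable sF (AW s ^~ As).
exists (fun s => \int[mu]_(x in `[a, b]) 'D_(v, 0) F (s, x)).
  by exists ('D_(v, 0) F) => //; apply: smooth_on_derive.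
by move=> s As; have [_ ->] := integral_differentiable sF (AW s ^~ As).
Qed.

End ParametricIntegral.

(** * Diffeomorphisms and the sign of their derivative *)

Section Diffeo.
Context {R : realType} (M : manifold).
Notation P := (@period R).
Implicit Types (g h : R -> R) (sigma : R).

Lemma period_gt0 : 0 < P.
Proof. by rewrite /period mulr2n addr_gt0 ?pi_gt0. Qed.

Lemma periodic_all (Q : R -> Prop) : (forall x, Q (x + P) <-> Q x) ->
  (forall x, 0 <= x <= P -> Q x) -> forall x, Q x.
Proof.
move=> QP Q0 x; have P0 := period_gt0.
have QN n y : Q (y + P *+ n) <-> Q y.
  by elim: n => [|n IH]; rewrite ?mulr0n ?addr0 // mulrS addrCA addrC QP.
have [m [y yP xE]] : exists m : int, exists2 y, 0 <= y <= P & x = y + P *~ m.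
  exists (Num.floor (x / P)), (x - P *~ Num.floor (x / P)); last by rewrite subrK.
  rewrite -mulrzr subr_ge0 lerBlDl.
  have := floor_le (x / P); have := ltW (lt_succ_floor (x / P)).
  rewrite ler_pdivrMr // ler_pdivlMr // intrD mulrDl mul1r.
  by rewrite ![P * _]mulrC => -> ->.
rewrite xE; case: m {xE} => n; first by apply/QN/Q0.
by apply/(QN n.+1); rewrite NegzE mulrNz subrK; apply: Q0.
Qed.

Definition sign sigma := (sigma = 1 \/ sigma = -1).

Lemma smooth_mvt g x y : smooth g -> x <= y ->
  exists c, g y - g x = (y - x) * derive1 g c.
Proof.
move=> sg xy; have [] := @line_mvt R R^o g x (1 : R) (y - x).
- by rewrite subr_ge0.
- by move=> s _; apply: smooth_on_diff sg _.
move=> s _; rewrite [_%:A]mulr1 subrK => ->; eexists; rewrite derive1E; reflexivity.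
Qed.

Definition cofinal g := forall y, (exists x, y <= g x) /\ (exists x, g x <= y).

(** Diffeomorphisms with derivative of sign sigma, described without the inverse;
    in this form the condition is open along families (oriented_near). *)
Definition oriented sigma g : Prop :=
  [/\ sign sigma, smooth g, (forall x, 0 < sigma * derive1 g x) &
      match M with
      | Line => cofinal g
      | Circle => forall x, g (x + P) = g x + sigma * P
      end].

Lemma oriented_lt sigma g x y : smooth g -> (forall x, 0 < sigma * derive1 g x) ->
  x < y -> sigma * g x < sigma * g y.
Proof.
move=> sg g0 xy; have [c cE] := smooth_mvt sg (ltW xy).
by rewrite -subr_gt0 -mulrBr cE mulrCA mulr_gt0 // subr_gt0.
Qed.

Lemma oriented_inj sigma g : oriented sigma g -> injective g.
Proof.
move=> [_ sg g0 _] x y gxy; case: (ltgtP x y) => // /(oriented_lt sg g0).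
  by rewrite gxy ltxx.
by rewrite gxy ltxx.
Qed.

Lemma quasi_periodic_cofinal sigma g : sign sigma ->
  (forall x, g (x + P) = g x + sigma * P) -> cofinal g.
Proof.
move=> ss gP y; have P0 := period_gt0.
have gN n x : g (x + P *+ n) = g x + sigma * P *+ n.
  elim: n => [|n IH]; first by rewrite !mulr0n !addr0.
  by rewrite mulrSr addrA gP IH mulrSr addrA.
pose n := (Num.truncn (`|y - g 0| / P)).+1.
have nP : `|y - g 0| <= P *+ n.
  rewrite -mulr_natr mulrC -ler_pdivrMr //; apply/ltW.
  by apply: truncnS_gt.
have g1 := gN n 0; have := gN n (- (P *+ n)).
rewrite addNr; rewrite add0r in g1; move=> g2.
have e : sigma * P *+ n = sigma * (P *+ n) by rewrite [RHS]mulrnAr.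
rewrite e in g1; rewrite e in g2; move: nP; rewrite ler_norml => /andP[l1 l2].
case: ss => sE; rewrite sE ?mul1r ?mulN1r in g1 g2.
  by split; [exists (P *+ n)|exists (- (P *+ n))]; lra.
by split; [exists (- (P *+ n))|exists (P *+ n)]; lra.
Qed.

Lemma oriented_cofinal sigma g : oriented sigma g -> cofinal g.
Proof. by rewrite /oriented; case: M => -[ss _ _ //]; apply: quasi_periodic_cofinal. Qed.

Lemma cofinal_surj g : continuous g -> cofinal g -> forall y, exists x, g x = y.
Proof.
move=> cg gy y; have [[x1 x1y] [x2 x2y]] := gy y.
have H a b : a <= b -> (g a <= y <= g b) || (g b <= y <= g a) -> exists x, g x = y.
  move=> ab gab; have [] := @IVT R g a b y ab.
  - exact: continuous_subspaceT.
  - case/orP: gab => /andP[l r]; have lr := le_trans l r.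
      by rewrite min_l // max_r // l r.
    by rewrite min_r // max_l // l r.
  - by move=> c _ <-; exists c.
case: (leP x1 x2) => [|/ltW] /H; apply; rewrite x1y x2y ?orbT //.
Qed.

(** The inverse h satisfies h' = 1 / g' (h), and smooth_ode applies. *)
Lemma oriented_diffeo sigma g : oriented sigma g -> is_diffeo M g.
Proof.
move=> og; have ginj := oriented_inj og; have cg := oriented_cofinal og.
case: (og) => ss sg g0 gP.
have gsurj := cofinal_surj (smooth_continuous sg) cg.
have g'0 x : derive1 g x != 0.
  by apply: contraTneq (g0 x) => ->; rewrite mulr0 ltxx.
split=> //; last first.
  move: gP; case: M => // gP; case: ss => sE; [left|right] => x; rewrite gP sE ?mul1r ?mulN1r //.
have [h hK] := choice gsurj.
have Kh x : h (g x) = x by apply: ginj; rewrite hK.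
exists h; split=> //.
apply: (@smooth_ode _ (fun x => (derive1 g x)^-1)).
  by apply: smoothV => //; apply: smooth_derive1.
move=> y; rewrite -{1}[y]hK; apply: is_derive_inverse => //.
- by near=> z.
- by near=> z; apply: smooth_continuous.
- exact: smooth_is_derive.
Unshelve. all: by end_near. Qed.

(** The derivative has no zero, as the inverse is differentiable, so its sign is
    constant. *)
Lemma diffeo_oriented g : is_diffeo M g -> exists sigma, oriented sigma g.
Proof.
move=> [sg [h [sh gK hK]] gP].
have g'0 x : derive1 g x != 0.
  have : derive1 (h \o g) x = 1.
    by rewrite (_ : h \o g = id) ?derive1_id //; apply/funext => y /=; rewrite gK.
  rewrite derive1_comp; [|exact: smooth_derivable|exact: smooth_derivable].
  by move=> E; apply/eqP => g'x; move: E; rewrite g'x mulr0 => /esym/eqP; rewrite oner_eq0.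
have cg' := smooth_continuous (smooth_derive1 sg).
have same x y : 0 < derive1 g x -> 0 < derive1 g y.
  move=> gx; rewrite lt_neqAle eq_sym g'0 /= leNgt; apply/negP => gy.
  have [] : exists c, derive1 g c = 0.
    case: (leP x y) => [|/ltW] xy.
      have [] := @IVT R (derive1 g) x y 0 xy; last by move=> c _ cE; exists c.
        exact: continuous_subspaceT.
      by rewrite min_r ?max_l ?(ltW gx) ?(ltW gy) //; lra.
    have [] := @IVT R (derive1 g) y x 0 xy; last by move=> c _ cE; exists c.
      exact: continuous_subspaceT.
    by rewrite min_l ?max_r ?(ltW gx) ?(ltW gy) //; lra.
  by move=> c /eqP; rewrite (negbTE (g'0 c)).
have gc : cofinal g by move=> y; split; exists (h y); rewrite hK.
have P0 := period_gt0.
have [g00|g00] := ltP 0 (derive1 g 0).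
  have gpos x : 0 < 1 * derive1 g x by rewrite mul1r; apply: same g00.
  exists 1; split=> //; first by left.
  case: M gP => // -[gP|gP] x; rewrite gP mul1r //.
  by have := oriented_lt sg gpos (_ : x < x + P); rewrite gP !mul1r ltrDl P0 => /(_ isT); lra.
have gneg x : 0 < -1 * derive1 g x.
  rewrite mulN1r oppr_gt0 ltNge; apply/negP; rewrite le_eqVlt eq_sym (negbTE (g'0 x)) /=.
  by move=> gx; have := same x 0 gx; lra.
exists (-1); split=> //; first by right.
case: M gP => // -[gP|gP] x; rewrite gP mulN1r //.
by have := oriented_lt sg gneg (_ : x < x + P); rewrite gP !mulN1r ltrDl P0 => /(_ isT); lra.
Qed.

Lemma ginvK g : is_diffeo M g -> cancel g (ginv g).
Proof.
move=> /diffeo_oriented[s og] x; rewrite /ginv; apply: (oriented_inj og).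
exact: (@getPex _ (fun z => g z = g x) (ex_intro _ x erefl)).
Qed.

Lemma ginvKV g : is_diffeo M g -> cancel (ginv g) g.
Proof. by move=> dg; have [_ [h [_ gK hK]] _] := dg; move=> y; rewrite -[y]hK ginvK. Qed.

Lemma ginv_smooth g : is_diffeo M g -> smooth (ginv g).
Proof.
move=> dg; have [_ [h [sh gK hK]] _] := dg.
by rewrite (_ : ginv g = h) //; apply/funext => y; rewrite -{1}[y]hK ginvK.
Qed.

End Diffeo.

(** * The metric as an integral over a fixed segment *)

Section Metric.
Context {R : realType} (M : manifold).
Notation P := (@period R).
Notation mu := (@lebesgue_measure R).
Implicit Types (f g h k X Y : R -> R) (sigma B : R).

Lemma cont_on_cont a b f : continuous f -> cont_on a b f.
Proof. by move=> cf x _; apply: cf. Qed.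

Lemma continuous_mul f g : continuous f -> continuous g ->
  continuous (fun x => f x * g x).
Proof. by move=> cf cg x; apply: continuousM; [apply: cf|apply: cg]. Qed.

Lemma primitive (a : R) f : continuous f ->
  exists F, forall x : R, a < x -> is_derive x 1 F (f x).
Proof.
move=> cf; exists (fun x => \int[mu]_(t in `[a, x]) f t) => x ax.
have := @continuous_FTC1_closed R f a x (x + 1) _ _ ax (cf x).
rewrite ltrDl ltr01 => /(_ isT (cont_on_integrable (cont_on_cont cf))) [d dE].
by rewrite -dE derive1E; apply: derivableP.
Qed.

(** Both sides are computed with a primitive F of f g' and the primitive
    F o ginv g of f o ginv g. *)
Lemma substitution sigma g f (a b : R) : oriented M sigma g -> continuous f -> a <= b ->
  \int[mu]_(y in `[Num.min (g a) (g b), Num.max (g a) (g b)]) f (ginv g y) =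
  sigma * \int[mu]_(x in `[a, b]) (f x * derive1 g x).
Proof.
move=> og cf ab; have dg := oriented_diffeo og.
have [ss sg g0 _] := og; have gK := ginvK dg; have hK := ginvKV dg.
have sh := ginv_smooth dg; have g'0 x : derive1 g x != 0.
  by apply: contraTneq (g0 x) => ->; rewrite mulr0 ltxx.
have cfg : continuous (fun x => f x * derive1 g x).
  by move=> x; apply: continuousM; [exact: cf|apply: smooth_continuous (smooth_derive1 sg) _].
have [F dF] := primitive (a - 1) cfg.
have lth x y : sigma * g x <= sigma * g y -> x <= y.
  by rewrite leNgt => H; rewrite leNgt; apply: contra H; apply: oriented_lt.
have dFh y : a <= ginv g y -> is_derive y 1 (F \o ginv g) (f (ginv g y)).
  move=> ay; have lt : a - 1 < ginv g y by apply: lt_le_trans ay; rewrite ltrBlDr ltrDl.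
  have [dF1 dF2] := dF _ lt.
  split; first by apply/derivable1_diffP/differentiable_comp; apply/derivable1_diffP => //; exact: smooth_derivable.
  rewrite -derive1E derive1_comp //; last exact: smooth_derivable.
  rewrite [derive1 F _]derive1E dF2.
  have : derive1 (g \o ginv g) y = 1.
    by rewrite (_ : g \o ginv g = id) ?derive1_id //; apply/funext => z /=; rewrite hK.
  rewrite derive1_comp; [|exact: smooth_derivable|exact: smooth_derivable].
  by rewrite -mulrA => ->; rewrite mulr1.
have cfh : continuous (f \o ginv g).
  by move=> y; apply: continuous_comp; [exact: smooth_continuous|exact: cf].
have -> : \int[mu]_(x in `[a, b]) (f x * derive1 g x) = F b - F a.
  apply: cont_on_FTC => //; first exact: cont_on_cont.
  by move=> x /andP[ax _]; apply: dF; apply: lt_le_trans ax; rewrite ltrBlDr ltrDl.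
have gab : sigma * g a <= sigma * g b.
  by move: ab; rewrite le_eqVlt => /orP[/eqP -> //|ab]; apply/ltW/oriented_lt.
case: ss => sE; rewrite sE ?mul1r ?mulN1r ?lerN2 in gab lth *.
  rewrite min_l // max_r //.
  rewrite (_ : F b - F a = (F \o ginv g) (g b) - (F \o ginv g) (g a)); last by rewrite /= !gK.
  apply: (@cont_on_FTC R (g a) (g b) (f \o ginv g)) => //; first exact: (cont_on_cont cfh).
  by move=> y /andP[y1 _]; apply: dFh; apply: lth; rewrite !mul1r hK.
rewrite min_r // max_l //.
rewrite (_ : - (F b - F a) = (F \o ginv g) (g a) - (F \o ginv g) (g b)); last by rewrite /= !gK opprB.
apply: (@cont_on_FTC R (g b) (g a) (f \o ginv g)) => //; first exact: (cont_on_cont cfh).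
by move=> y /andP[_ y1]; apply: dFh; apply: lth; rewrite !mulN1r hK lerN2.
Qed.

(** For functions satisfying within_bound B, integrals over the manifold are
    integrals over [lo B, hi B], so that the line and the circle can be treated
    together. *)
Definition lo B := match M with Line => - B | Circle => 0 end.
Definition hi B := match M with Line => B | Circle => P end.

Definition within_bound B h := 0 < B /\
  match M with
  | Line => forall x, B <= `|x| -> h x = 0
  | Circle => forall x, h (x + P) = h x
  end.

Lemma lo_lt_hi B : 0 < B -> lo B < hi B.
Proof. by rewrite /lo /hi; case: M => B0; [lra|apply: period_gt0]. Qed.

Lemma within_bound_le B C h : B <= C -> within_bound B h -> within_bound C h.
Proof.
move=> BC [B0 hB]; split; first exact: lt_le_trans BC.
by case: M hB => // hB x Cx; apply: hB; apply: le_trans Cx.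
Qed.

Lemma vf_within_bound h : is_vf M h -> exists B, within_bound B h.
Proof.
rewrite /is_vf /within_bound => -[_]; case: M => [[A hA]|hP]; last by exists 1.
exists (`|A| + 1); split=> [|x Ax]; first by rewrite ltr_wpDl.
by apply: hA; apply: lt_le_trans Ax; have := ler_norm A; lra.
Qed.

Lemma near_vf_bound h : is_vf M h -> \forall B \near +oo, within_bound B h.
Proof.
move=> /vf_within_bound [B hB]; near=> C; apply: within_bound_le hB.
by near: C; apply: nbhs_pinfty_ge; apply: num_real.
Unshelve. all: by end_near. Qed.

Lemma within_bound_mul B h k : within_bound B h -> within_bound B k ->
  within_bound B (fun x => h x * k x).
Proof.
rewrite /within_bound => -[B0 hB] [_ kB]; split=> //.
case: M hB kB => hB kB x; last by rewrite hB kB.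
by move=> Bx; rewrite hB // mul0r.
Qed.

Lemma shift_line f (c : R) :
  (fun y => f (y + c)) = (fun t : R => f (t *: (1 : R^o) + c)).
Proof. by apply/funext => t; rewrite [_%:A]mulr1. Qed.

Lemma derive1_shift f (c x : R) : derive1 (fun y => f (y + c)) x = derive1 f (x + c).
Proof.
by rewrite !derive1E shift_line (derive_line f c 1 x) [_%:A]mulr1.
Qed.

Lemma is_derive1_shift f (c x l : R) : is_derive (x + c) 1 f l ->
  is_derive x 1 (fun y => f (y + c)) l.
Proof.
move=> [d dE]; split; last by rewrite -derive1E derive1_shift derive1E.
by rewrite shift_line derivable_line [_%:A]mulr1.
Qed.

Lemma periodic_derive1 f (c x : R) : (forall x, f (x + c) = f x) ->
  derive1 f (x + c) = derive1 f x.
Proof.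
by move=> fc; rewrite -derive1_shift; congr (derive1 _ x); apply/funext.
Qed.

Lemma quasi_periodic_derive1 f (c m x : R) : smooth f ->
  (forall x, f (x + c) = f x + m) -> derive1 f (x + c) = derive1 f x.
Proof.
move=> sf fc; rewrite -derive1_shift (_ : (fun y => f (y + c)) = f + cst m); last exact/funext.
by rewrite derive1E deriveD ?derive_cst ?addr0 -?derive1E //; exact: smooth_derivable.
Qed.

Lemma is_derive0_eq f (a b : R) : a <= b ->
  (forall x : R, a <= x <= b -> is_derive x 1 f 0) -> f a = f b.
Proof.
move=> ab df; have := @cont_on_FTC R a b (cst 0) f ab.
rewrite Rintegral_cst // mul0r => H; apply/esym/eqP; rewrite -subr_eq0 -H //.
by apply: cont_on_cont => x; apply: cst_continuous.
Qed.

(** For F a primitive of f, the function F (c + P) - F c of c has derivative 0. *)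
Lemma int_shift_period f : continuous f -> (forall x, f (x + P) = f x) -> forall c,
  \int[mu]_(x in `[c, c + P]) f x = \int[mu]_(x in `[0, P]) f x.
Proof.
move=> cf fP c; have P0 := @period_gt0 R.
pose m := Num.min c 0; have mc : m <= c by rewrite ge_min lexx.
have m0 : m <= 0 by rewrite ge_min lexx orbT.
have [F dF] := primitive (m - 1) cf.
have int_eq y : m <= y -> \int[mu]_(x in `[y, y + P]) f x = F (y + P) - F y.
  move=> cy; apply: cont_on_FTC; [by rewrite lerDl ltW|exact: cont_on_cont|].
  by move=> x /andP[yx _]; apply: dF; lra.
rewrite -{2}[P]add0r !int_eq //.
have dE y : m <= y -> is_derive y 1 (fun y => F (y + P) - F y) 0.
  move=> cy; have d1 : is_derive y 1 (fun y => F (y + P)) (f y).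
    by apply: is_derive1_shift; rewrite -fP; apply: dF; lra.
  have d2 : is_derive y 1 F (f y) by apply: dF; lra.
  by rewrite -(subrr (f y)); apply: is_deriveB.
have [c0|/ltW c0] := leP c 0.
  apply: (is_derive0_eq (f := fun y => F (y + P) - F y)) => // x /andP[cx _].
  by apply: dE; apply: le_trans cx.
apply/esym; apply: (is_derive0_eq (f := fun y => F (y + P) - F y)) => // x /andP[cx _].
by apply: dE; apply: le_trans cx.
Qed.

Lemma int_line B f : within_bound B f -> M = Line -> continuous f ->
  \int[mu]_(x in [set: R]) f x = \int[mu]_(x in `[lo B, hi B]) f x.
Proof.
rewrite /within_bound /lo /hi => -[B0 fB] ME cf; rewrite ME in fB *.
rewrite [RHS]Rintegral_mkcond; apply: eq_Rintegral => x _.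
rewrite patchE; case: ifPn => // xB; apply: fB; move: xB; rewrite notin_setE /= in_itv /=.
by move/negP; rewrite -ler_norml -ltNge => /ltW.
Qed.

Lemma ip_eq B X Y : continuous X -> continuous Y -> within_bound B X -> within_bound B Y ->
  ip M X Y = \int[mu]_(x in `[lo B, hi B]) (X x * Y x).
Proof.
move=> cX cY XB YB; have XYB := within_bound_mul XB YB.
have cXY : continuous (fun x => X x * Y x).
  by move=> x; apply: continuousM; [apply: cX|apply: cY].
rewrite /ip; case ME: M; first exact: int_line.
by rewrite /lo /hi ME.
Qed.

(** On the line, the image under g of the segment contains the support of the
    integrand.  On the circle, any period may be used for the integral; the one
    starting at a is chosen so that g maps it onto [0, P], and a depends on the
    orientation. *)
Lemma metric_eq sigma g h k B : oriented M sigma g -> continuous h -> continuous k ->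
  within_bound B h -> within_bound B k ->
  metric M g h k = sigma * \int[mu]_(x in `[lo B, hi B]) (h x * k x * derive1 g x).
Proof.
move=> og ch ck hB kB; have hkB := within_bound_mul hB kB.
have [B0 _] := hB; have lh := lo_lt_hi B0.
have dg := oriented_diffeo og; have [ss sg g0 gM] := og.
pose f x := h x * k x.
have cf : continuous f by move=> x; apply: continuousM; [apply: ch|apply: ck].
have cfg : continuous (f \o ginv g).
  move=> x; apply: continuous_comp; last exact: cf.
  exact: smooth_continuous (ginv_smooth dg) _.
rewrite /metric /ip /rtriv /=.
have lth x y : x <= y -> sigma * g x <= sigma * g y.
  by rewrite le_eqVlt => /orP[/eqP -> //|xy]; apply/ltW/(oriented_lt sg g0).
have [gK hK] := (ginvK dg, ginvKV dg).
case ME : M gM => gM.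
  rewrite -(substitution og cf (ltW lh)) -[LHS]/(\int[mu]_(y in [set: R]) f (ginv g y)).
  rewrite [RHS]Rintegral_mkcond; apply: eq_Rintegral => y _.
  rewrite patchE; case: ifPn => // yB.
  have hk0 x : B <= `|x| -> f x = 0 by move: hkB.2; rewrite ME; apply.
  apply: hk0.
  apply: contraNT yB; rewrite -ltNge inE /= in_itv /= ltr_norml => /andP[l r].
  move: (lth _ _ (ltW l)) (lth _ _ (ltW r)); rewrite /lo /hi ME !hK.
  by rewrite ge_min le_max; case: ss => ->; rewrite ?mul1r ?mulN1r ?lerN2 => -> ->; rewrite ?orbT.
rewrite /lo /hi ME.
have fP x : f (x + P) = f x by move: hkB.2; rewrite ME; apply.
have g'P x : derive1 g (x + P) = derive1 g x.
  exact: quasi_periodic_derive1 sg gM.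
have cfg' : continuous (fun x => f x * derive1 g x).
  by move=> x; apply: continuousM; [exact: cf|apply: smooth_continuous (smooth_derive1 sg) _].
have fgP x : f (x + P) * derive1 g (x + P) = f x * derive1 g x by rewrite fP g'P.
have P0 := @period_gt0 R.
pose a := if sigma == 1 then ginv g 0 else ginv g P.
have gaP : Num.min (g a) (g (a + P)) = 0 /\ Num.max (g a) (g (a + P)) = P.
  rewrite gM /a; case: ss => ->; first by rewrite eqxx hK add0r mul1r min_l ?max_r // ltW.
  rewrite -subr_eq0 ifF; last by apply/negbTE; rewrite -opprD oppr_eq0 (_ : 1 + 1 = 2%:R).
  by rewrite hK mulN1r subrr min_r ?max_l // ltW.
rewrite -(int_shift_period cfg' fgP a) -(substitution og cf); last by rewrite lerDl ltW.
by rewrite gaP.1 gaP.2.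
Qed.

Lemma int_derive1_eq0 B f : smooth f -> within_bound B f ->
  \int[mu]_(x in `[lo B, hi B]) derive1 f x = 0.
Proof.
move=> sf [B0 fB].
have -> : \int[mu]_(x in `[lo B, hi B]) derive1 f x = f (hi B) - f (lo B).
  apply: cont_on_FTC.
  - exact/ltW/lo_lt_hi.
  - exact/cont_on_cont/smooth_continuous/smooth_derive1.
  - by move=> x _; apply: smooth_is_derive.
move: fB; rewrite /lo /hi; case: M => fB.
  by rewrite !fB ?subrr ?normrN // ger0_norm // ltW.
by rewrite -[P]add0r fB subrr.
Qed.

(** The integral of the nonnegative function sigma h^2 g' vanishes, hence h
    vanishes inside the segment, and at its ends by continuity. *)
Lemma metric_definite g h : is_diffeo M g -> is_vf M h -> metric M g h h = 0 -> h = cst 0.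
Proof.
move=> /diffeo_oriented [sigma og] vh; have [B hB] := vf_within_bound vh.
have ch := smooth_continuous vh.1; have [ss sg g0 _] := og; have [B0 _] := hB.
have cg' := smooth_continuous (smooth_derive1 sg).
have chg := continuous_mul (continuous_mul ch ch) cg'.
rewrite (metric_eq og ch ch hB hB) -cont_on_intZ; last exact: (cont_on_cont chg).
move=> I0; have E : forall x, lo B < x < hi B -> h x = 0.
  move=> x xB; have := cont_on_int_eq0 (lo_lt_hi B0) _ _ I0 xB.
  have cc := continuous_mul (fun x => @cst_continuous _ _ sigma x) chg.
  have pos y : 0 <= sigma * (h y * h y * derive1 g y).
    by rewrite mulrCA mulr_ge0 // -?expr2 ?sqr_ge0 // ltW.
  move=> /(_ (cont_on_cont cc) (fun x _ => pos x)) /eqP.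
  by rewrite mulrCA mulf_eq0 (gt_eqF (g0 x)) orbF mulf_eq0 orbb => /eqP.
have hlo : h (lo B) = 0.
  have l1 : h x @[x --> (lo B)^'+] --> h (lo B) by apply: cvg_at_right_filter; apply: ch.
  have l2 : h x @[x --> (lo B)^'+] --> (0 : R).
    apply: cvg_near_cst; near=> x; apply: E; apply/andP; split.
      by near: x; exact: nbhs_right_gt.
    by near: x; apply: nbhs_right_lt; apply: lo_lt_hi.
  exact: (cvg_unique _ l1 l2).
apply/funext => x; move: hB => [_]; move: E hlo; rewrite /lo /hi; case: M => E hlo hB.
  have [xB|xB] := leP B `|x|; first exact: hB.
  by apply: E; rewrite -ltr_norml.
apply: (@periodic_all R (fun x => h x = 0)) => [y|y]; first by rewrite hB.
rewrite le_eqVlt => /andP[/orP[/eqP <- //|y0]]; rewrite le_eqVlt => /orP[/eqP ->|yP].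
  by rewrite -[P]add0r hB.
by apply: E; rewrite y0.
Unshelve. all: by end_near. Qed.

End Metric.

(** * Extension of families of diffeomorphisms *)

Section Families.
Context {R : realType} (M : manifold).
Notation P := (@period R).

Section Slices.
Variable n : nat.
Notation V := 'rV[R]_n.+1.
Implicit Types (U : set V) (c h : V -> R -> R) (s : V).

Definition joint c : V * R^o -> R^o := fun p => c p.1 p.2.

Lemma open_cylinder U : open U -> open [set p : V * R^o | U p.1].
Proof.
by move=> oU; apply: (open_comp (f := fst)) => // p _; apply: cvg_fst.
Qed.

Lemma lin_continuous_joint : lin_continuous (V * R^o)%type.
Proof. by apply: lin_continuous_prod; [apply: lin_continuous_rV|apply: lin_continuous_R]. Qed.

Lemma slice_smooth U c s : smooth_on [set p : V * R^o | U p.1] (joint c) -> U s ->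
  smooth (c s).
Proof.
move=> sc Us; have L : forall t v p, ((s, t *: v + p) : V * R^o) = t *: (0, v) + (s, p).
  by move=> t v p; congr pair => /=; rewrite scaler0 add0r.
have := smooth_on_affine L (affine_differentiable (@lin_continuous_R R) L) sc.
by apply: smooth_on_sub => x _.
Qed.

Lemma slice_derive1 c s x : derive1 (c s) x = 'D_(0, 1) (joint c) (s, x).
Proof.
rewrite derive1E -(derive_affine (joint c) (L := fun x : R^o => (s, x)) (l := fun x => (0, x)) 1 x) //.
by move=> t v p; congr pair => /=; rewrite scaler0 add0r.
Qed.

Lemma positive_near (F : V * R^o -> R) s (a b : R) :
  (forall x, a <= x <= b -> {for (s, x), continuous F}) ->
  (forall x, a <= x <= b -> 0 < F (s, x)) ->
  \forall p \near s, forall x, a <= x <= b -> 0 < F (p, x).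
Proof.
move=> cF F0; have cov := (compact_near_coveringP _).1 (@segment_compact R a b).
suff : \forall p \near s, `[a, b]%classic `<=` (fun x => 0 < F (p, x)).
  by apply: filterS => p sub x xab; apply: sub; rewrite /= in_itv.
apply: (cov _ (nbhs s)) => x /=; rewrite in_itv /= => xab.
have /cvgr_gt/(_ _ (F0 x xab)) := cF x xab.
move=> [[B C] [/= Bs Cx] BC]; exists (C, B) => //= -[y p] /= [Cy Bp].
exact: (BC (p, y)).
Qed.

(** The sign of the derivative needs to be controlled only on a segment, where
    positive_near applies: one period on the circle, and on the line a segment
    outside which c s equals c s0.  Cofinality is tested at points outside that
    segment, where c s0 exceeds its extrema on the segment.  On the circle, the
    shift of c s by a period is assumed, as c s is not yet a diffeomorphism. *)
Lemma oriented_near U c s0 sigma : open U -> U s0 -> smooth_family M U c ->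
  oriented M sigma (c s0) ->
  (M = Circle -> \forall s \near s0, forall x, c s (x + P) = c s x + sigma * P) ->
  \forall s \near s0, oriented M sigma (c s).
Proof.
move=> oU Us0 [sc scM] [ss sc0 c0 cM] cP.
have oC := open_cylinder oU.
have nU : \forall s \near s0, U s by apply: open_nbhs_nbhs.
have pos a b : \forall s \near s0, forall x, a <= x <= b -> 0 < sigma * derive1 (c s) x.
  have := @positive_near (fun q => sigma * 'D_(0, 1) (joint c) q) s0 a b.
  have cF x : {for (s0, x), continuous (fun q => sigma * 'D_(0, 1) (joint c) q)}.
    apply: differentiable_continuous; apply: differentiableM; first exact: differentiable_cst.
    by apply: smooth_on_diff (_ : [set p : V * R^o | U p.1] (s0, x)) => //; apply: smooth_on_derive.
  move=> /(_ (fun x _ => cF x)) H; suff : \forall p \near s0, forall x, a <= x <= b ->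
      0 < sigma * 'D_(0, 1) (joint c) (p, x).
    by apply: filterS => p Hp x xab; rewrite slice_derive1; apply: Hp.
  by apply: H => x _; rewrite -slice_derive1.
case ME : M scM cM cP => scM cM cP; last first.
  have {}cP := cP erefl.
  have P0 := @period_gt0 R.
  near=> s; have Us : U s by near: s.
  have cPs : forall x, c s (x + P) = c s x + sigma * P by near: s.
  split=> //; first exact: (slice_smooth sc Us).
  apply: periodic_all => [x|]; last by near: s; apply: pos.
  suff -> : derive1 (c s) (x + P) = derive1 (c s) x by [].
  exact: quasi_periodic_derive1 (slice_smooth sc Us) cPs.
have [A nA] := scM _ Us0; pose B : R := `|A|.
have B0 : 0 <= B by apply: normr_ge0.
have BB : - B <= B by lra.
have cc0 : {within `[- B, B], continuous (c s0)} by apply/continuous_subspaceT/smooth_continuous.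
have [m1 _ m1P] := EVT_max BB cc0; have [m2 _ m2P] := EVT_min BB cc0.
near=> s; have Us : U s by near: s.
have scs := slice_smooth sc Us.
have cE x : B < `|x| -> c s x = c s0 x.
  move=> Bx; suff : forall x, A < `|x| -> c s x = c s0 x by apply; apply: le_lt_trans Bx; apply: ler_norm.
  by near: s.
split=> //.
  move=> x; have [xB|xB] := leP `|x| B.
    have : forall x, - B <= x <= B -> 0 < sigma * derive1 (c s) x by near: s; apply: pos.
    by apply; rewrite -ler_norml.
  rewrite (_ : derive1 (c s) x = derive1 (c s0) x) // !derive1E.
  apply: near_eq_derive; near=> y; apply: cE; near: y.
  have : {for x, continuous (fun y : R => `|y|)} by apply: norm_continuous.
  by move/cvgr_gt; apply.
move=> y; split.
  have [[x xy] _] := cM (Num.max y (c s0 m1) + 1).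
  have m1x : y <= Num.max y (c s0 m1) /\ c s0 m1 <= Num.max y (c s0 m1) by rewrite !le_max !lexx orbT.
  have [xB|xB] := leP `|x| B; last by exists x; rewrite cE //; lra.
  by have := m1P x; rewrite in_itv /= -ler_norml xB => /(_ isT); lra.
have [_ [x xy]] := cM (Num.min y (c s0 m2) - 1).
have m2x : Num.min y (c s0 m2) <= y /\ Num.min y (c s0 m2) <= c s0 m2 by rewrite !ge_min !lexx orbT.
have [xB|xB] := leP `|x| B; last by exists x; rewrite cE //; lra.
by have := m2P x; rewrite in_itv /= -ler_norml xB => /(_ isT); lra.
Unshelve. all: by end_near. Qed.

(** The sign of a nowhere vanishing derivative is its sign at 0. *)
Lemma diffeo_family_oriented U c s0 sigma : open U -> U s0 -> diffeo_family M U c ->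
  oriented M sigma (c s0) -> \forall s \near s0, oriented M sigma (c s).
Proof.
move=> oU Us0 [fc dc] oc.
have nU : \forall s \near s0, U s by apply: open_nbhs_nbhs.
have [ss _ c0 _] := oc.
have pos : \forall s \near s0, 0 < sigma * derive1 (c s) 0.
  have /cvgr_gt : {for s0, continuous (fun s => sigma * 'D_(0, 1) (joint c) (s, 0))}.
    apply: differentiable_continuous; apply: differentiableM; first exact: differentiable_cst.
    apply: (@differentiable_comp _ _ _ _ (fun s : V => (s, 0) : V * R^o) ('D_(0, 1) (joint c)) s0).
      apply: (affine_differentiable (@lin_continuous_rV R _) (l := fun s => (s, 0))).
      by move=> t v p; congr pair => /=; rewrite scaler0 addr0.
    by apply: smooth_on_diff (_ : [set p : V * R^o | U p.1] (s0, 0)) => //; apply: smooth_on_derive fc.1.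
  move=> /(_ 0); rewrite -slice_derive1 c0 => /(_ isT).
  by apply: filterS => s; rewrite slice_derive1.
near=> s; have /diffeo_oriented[tau otau] : is_diffeo M (c s) by apply: dc; near: s.
suff <- : tau = sigma by [].
have [st _ t0 _] := otau; have := t0 0.
have : 0 < sigma * derive1 (c s) 0 by near: s.
by case: ss => ->; case: st => ->; rewrite ?mul1r ?mulN1r // => ? ?; lra.
Unshelve. all: by end_near. Qed.

Definition vf_family U h := smooth_family M U h /\ forall s, U s -> is_vf M (h s).

End Slices.

Lemma smooth_pullback (V W : normedModType R) (A : set V) (B : set W) (L l : V -> W) (f : W -> R^o) :
  lin_continuous V -> (forall t v p, L (t *: v + p) = t *: l v + L p) ->
  (forall x, A x -> B (L x)) -> smooth_on B f -> smooth_on A (f \o L).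
Proof.
move=> cV Ll AB sf; apply: (smooth_on_sub (A := L @^-1` B)) => //.
exact: (smooth_on_affine Ll (affine_differentiable cV Ll) sf).
Qed.

Section Extension.
Variable n : nat.
Notation V := 'rV[R]_n.+1.
Notation V' := 'rV[R]_n.+2.
Implicit Types (U : set V) (c h : V -> R -> R) (s : V).

Definition rhead (p : V') : R := p ord0 ord0.
Definition rtail (p : V') : V := \row_j p ord0 (lift ord0 j).
Definition rcons0 (u : R) s : V' := \row_j oapp (s ord0) u (unlift ord0 j).

Lemma rhead_cons u s : rhead (rcons0 u s) = u.
Proof. by rewrite /rhead mxE unlift_none. Qed.

Lemma rtail_cons u s : rtail (rcons0 u s) = s.
Proof. by apply/rowP => j; rewrite !mxE liftK. Qed.

Lemma rcons0_affine t u s u' s' :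
  rcons0 (t * u + u') (t *: s + s') = t *: rcons0 u s + rcons0 u' s'.
Proof. by apply/rowP => j; rewrite !mxE; case: unliftP => [k|] _ /=; rewrite ?mxE. Qed.

Lemma rtail_affine t v p : rtail (t *: v + p) = t *: rtail v + rtail p.
Proof. by apply/rowP => j; rewrite !mxE. Qed.

Lemma rhead_affine t v p : rhead (t *: v + p) = t * rhead v + rhead p.
Proof. by rewrite /rhead !mxE. Qed.

(** One more parameter u in front, so that the derivative of a field at c s in
    the direction h s becomes a directional derivative on a finite-dimensional
    space (dfun_extend). *)
Definition extend c h : V' -> R -> R :=
  fun p x => c (rtail p) x + rhead p * h (rtail p) x.

Lemma extend_cons c h u s x : extend c h (rcons0 u s) x = c s x + u * h s x.
Proof. by rewrite /extend rtail_cons rhead_cons. Qed.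

Lemma open_rtail U : open U -> open (rtail @^-1` U).
Proof.
move=> oU; apply: (open_comp (f := rtail)) => // p _; apply: differentiable_continuous.
by apply: affine_differentiable (@lin_continuous_rV R _) rtail_affine _.
Qed.

Lemma rtail_continuous : continuous rtail.
Proof.
move=> p; apply: differentiable_continuous.
by apply: affine_differentiable (@lin_continuous_rV R _) rtail_affine _.
Qed.

Lemma rcons0_continuous : continuous (rcons0 0).
Proof.
move=> p; apply: differentiable_continuous.
apply: (affine_differentiable (@lin_continuous_rV R _) (l := rcons0 0)) => t u v.
by rewrite -rcons0_affine mulr0 addr0.
Qed.

Lemma extend_smooth U c h : open U -> smooth_family M U c -> vf_family U h ->
  smooth_family M (rtail @^-1` U) (extend c h).
Proof.
move=> oU [sc cM] [[sh hM] vh]; have oC := open_cylinder (open_rtail oU).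
have lc := @lin_continuous_joint n.+1.
have L : forall t v p, ((rtail (t *: v + p).1, (t *: v + p).2) : V * R^o) =
    t *: (rtail v.1, v.2) + (rtail p.1, p.2) by move=> t v p; congr pair; rewrite rtail_affine.
split.
  apply: (smooth_onD oC).
    exact: (smooth_pullback lc L _ sc).
  apply: (smooth_onM oC); last exact: (smooth_pullback lc L _ sh).
  apply: (smooth_pullback (L := fun p : V' * R^o => rhead p.1 : R^o)
    (l := fun p => rhead p.1 : R^o) (B := setT) (f := id) lc)
    => //.
    by move=> t v p; rewrite rhead_affine.
  exact: smooth_id.
case ME : M cM hM => // cM hM p Up; have [A nA] := cM _ Up; have [B nB] := hM _ Up.
have [_] := vh _ Up; rewrite ME => -[C hC].
exists (`|A| + `|B| + `|C|); near=> q => x xABC.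
have lA := ler_norm A; have lB := ler_norm B; have lC := ler_norm C.
have lA' := normr_ge0 A; have lB' := normr_ge0 B; have lC' := normr_ge0 C.
have cE : forall x, A < `|x| -> c (rtail q) x = c (rtail p) x.
  by near: q; apply: (rtail_continuous nA).
have hE : forall x, B < `|x| -> h (rtail q) x = h (rtail p) x.
  by near: q; apply: (rtail_continuous nB).
by rewrite /extend cE ?hE ?hC ?mulr0 //; lra.
Unshelve. all: by end_near. Qed.

(** The interior makes this set open; that it contains all (0, s) with s in U is
    extend_domain0. *)
Definition extend_domain U c h : set V' :=
  (rtail @^-1` U) `&` interior [set p | is_diffeo M (extend c h p)].

Lemma open_extend_domain U c h : open U -> open (extend_domain U c h).
Proof. by move=> oU; apply: openI; [apply: open_rtail|apply: open_interior]. Qed.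

Lemma extend_diffeo U c h : open U -> smooth_family M U c -> vf_family U h ->
  diffeo_family M (extend_domain U c h) (extend c h).
Proof.
move=> oU sc vh; split; last by move=> p [_ /interior_subset].
have [sE EM] := extend_smooth oU sc vh; split.
  by apply: smooth_on_sub sE => p [].
by case: M EM => // EM p [Up _]; apply: EM.
Qed.

(** At u = 0 the extended family is c s, a diffeomorphism, and oriented_near
    applies.  On the circle, its assumption on the shift by a period holds because
    h is periodic and the orientation of c s is locally constant. *)
Lemma extend_domain0 U c h s : open U -> diffeo_family M U c -> vf_family U h -> U s ->
  extend_domain U c h (rcons0 0 s).
Proof.
move=> oU dc vh Us; have oU' := open_rtail oU; have [sc _] := dc.
have U's : (rtail @^-1` U) (rcons0 0 s) by rewrite /= rtail_cons.
split=> //; have [sigma oc] := diffeo_oriented (dc.2 _ Us).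
have E0 : extend c h (rcons0 0 s) = c s.
  by apply/funext => x; rewrite extend_cons mul0r addr0.
have nE : \forall p \near rcons0 0 s, oriented M sigma (extend c h p).
  apply: (oriented_near oU' U's (extend_smooth oU sc vh)); rewrite ?E0 // => ME.
  have noc : \forall p \near rcons0 0 s, oriented M sigma (c (rtail p)).
    have : \forall s \near rtail (rcons0 0 s), oriented M sigma (c s).
      by rewrite rtail_cons; apply: (diffeo_family_oriented oU Us dc oc).
    exact: rtail_continuous.
  have nU' : \forall p \near rcons0 0 s, (rtail @^-1` U) p by apply: open_nbhs_nbhs.
  near=> p => x.
  have [_ _ _] : oriented M sigma (c (rtail p)) by near: p.
  have Up : U (rtail p) by near: p.
  have [_] := vh.2 _ Up; rewrite ME => hP cP.
  by rewrite /extend cP hP // addrAC.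
by apply: filterS nE => p; apply: oriented_diffeo.
Unshelve. all: by end_near. Qed.

End Extension.

End Families.

(** * Derivatives of fields *)

Section FieldsOnFamilies.
Context {R : realType} (M : manifold).
Notation P := (@period R).
Implicit Types (xi eta zeta : (R -> R) -> R -> R) (g h k a b : R -> R).

Lemma on_line (A B : Prop) : M = Line ->
  match M with Line => A | Circle => B end -> A.
Proof. by move=> ->. Qed.

Lemma on_circle (A B : Prop) : M = Circle ->
  match M with Line => A | Circle => B end -> B.
Proof. by move=> ->. Qed.

Lemma on_both (A B : Prop) : (M = Line -> A) -> (M = Circle -> B) ->
  match M with Line => A | Circle => B end.
Proof. by case: M => HA HB; [apply: HA|apply: HB]. Qed.

Lemma const_smooth_family n (U : set 'rV[R]_n.+1) g : smooth g ->
  smooth_family M U (fun=> g).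
Proof.
move=> sg; split; last by case: M => // s _; exists 0; near=> q.
apply: (smooth_pullback (L := fun p : 'rV[R]_n.+1 * R^o => p.2) (l := snd) (@lin_continuous_joint R n) _ _ sg) => //.
Unshelve. all: by end_near. Qed.

Lemma const_diffeo_family n (U : set 'rV[R]_n.+1) g : is_diffeo M g ->
  diffeo_family M U (fun=> g).
Proof. by move=> dg; split=> //; apply: const_smooth_family; case: dg. Qed.

Lemma const_vf_family n (U : set 'rV[R]_n.+1) h : is_vf M h ->
  vf_family M U (fun=> h).
Proof. by move=> vh; split=> //; apply: const_smooth_family; case: vh. Qed.

Lemma field_vf_family xi n (U : set 'rV[R]_n.+1) c : smooth_field M xi ->
  open U -> diffeo_family M U c -> vf_family M U (fun s => xi (c s)).
Proof.
by move=> [_ vxi sxi] oU dc; split=> [|s Us]; [apply: sxi|apply/vxi/dc.2].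
Qed.

Lemma smooth_field_value n (U : set 'rV[R]_n.+1) c zeta x : open U ->
  diffeo_family M U c -> smooth_field M zeta ->
  smooth_on U (fun p => zeta (c p) x : R^o).
Proof.
move=> oU dc [_ _ /(_ _ _ _ oU dc) [sZ _]].
apply: (smooth_pullback (L := fun p : 'rV[R]_n.+1 => (p, x) : 'rV[R]_n.+1 * R^o)
  (l := fun p => (p, 0)) (@lin_continuous_rV R _) _ _ sZ) => //.
by move=> t v p; congr pair => /=; rewrite scaler0 add0r.
Qed.

Lemma rcons0_line n (t u : R) (s : 'rV[R]_n.+1) :
  t *: rcons0 1 0 + rcons0 u s = rcons0 (t + u) s.
Proof. by rewrite -rcons0_affine mulr1 scaler0 add0r. Qed.

Lemma near_line (V : normedModType R) (v p : V) (N : set V) : nbhs p N ->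
  \forall t \near (0 : R), N (t *: v + p).
Proof.
move=> nN; have : {for (0 : R), continuous (fun t : R => t *: v + p)}.
  apply: (@differentiable_continuous _ R^o).
  apply: (affine_differentiable (@lin_continuous_R R) (l := fun t : R^o => t *: v)) => t u q.
  by rewrite scalerDl -scalerA addrA.
by move=> cL; apply: cL; rewrite scale0r add0r.
Qed.

Section Extend.
Variables (n : nat) (U : set 'rV[R]_n.+1) (c h : 'rV[R]_n.+1 -> R -> R).
Hypotheses (oU : open U) (dc : diffeo_family M U c) (vh : vf_family M U h).
Notation Om := (extend_domain M U c h).

Let oOm : open Om. Proof. exact: open_extend_domain. Qed.
Let dE : diffeo_family M Om (extend c h). Proof. by apply: extend_diffeo => //; case: dc. Qed.

Lemma near_extend_domain s : U s -> \forall t \near (0 : R), Om (rcons0 t s).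
Proof.
move=> Us; have : nbhs (rcons0 0 s) Om by apply: open_nbhs_nbhs; split=> //; apply: extend_domain0.
by move/(near_line (rcons0 1 0)); apply: filterS => t; rewrite rcons0_line addr0.
Qed.

Lemma near_extend_diffeo s : U s ->
  \forall t \near (0 : R), is_diffeo M (fun x => c s x + t * h s x).
Proof.
move=> Us; apply: filterS (near_extend_domain Us) => t /dE.2.
by rewrite (_ : extend _ _ _ = fun x => c s x + t * h s x) //; apply/funext => x; rewrite extend_cons.
Qed.

Lemma dfun_extend (f : (R -> R) -> R) s :
  dfun f (c s) (h s) = 'D_(rcons0 1 0) (f \o extend c h) (rcons0 0 s).
Proof.
rewrite /dfun derive1E.
have -> : (fun t => f (fun x => c s x + t * h s x)) =
    (fun t => (f \o extend c h) (t *: rcons0 1 0 + rcons0 0 s)).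
  apply/funext => t /=; rewrite rcons0_line addr0; congr f.
  by apply/funext => x; rewrite extend_cons.
by rewrite (derive_line (f \o extend c h : _ -> R^o)) scale0r add0r.
Qed.

Lemma dfield_extend zeta s x : dfield zeta (c s) (h s) x =
  'D_(rcons0 1 0, 0) (joint (fun p => zeta (extend c h p))) (rcons0 0 s, x).
Proof.
rewrite /dfield dfun_extend.
rewrite -(derive_affine (joint (fun p => zeta (extend c h p)))
   (L := fun p : 'rV_n.+2 => (p, x)) (l := fun p => (p, 0))) //.
by move=> t v p; congr pair => /=; rewrite scaler0 add0r.
Qed.

Lemma smooth_dfield zeta : smooth_field M zeta ->
  smooth_on [set p : 'rV[R]_n.+1 * R^o | U p.1]
    (joint (fun s => dfield zeta (c s) (h s))).
Proof.
move=> [_ _ sz]; have [sZ _] := sz _ _ _ oOm dE.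
have L : forall t v p, ((rcons0 0 (t *: v + p).1, (t *: v + p).2) : 'rV[R]_n.+2 * R^o) =
    t *: (rcons0 0 v.1, v.2) + (rcons0 0 p.1, p.2).
  by move=> t v p; congr pair; rewrite -rcons0_affine mulr0 addr0.
have := smooth_pullback (@lin_continuous_joint R n) L _ (smooth_on_derive (rcons0 1 0, 0) sZ).
move=> /(_ [set p | U p.1]) H.
rewrite (_ : joint _ =
    'D_(rcons0 1 0, 0) (joint (fun p => zeta (extend c h p))) \o (fun p => (rcons0 0 p.1, p.2))).
  by apply: H => -[s x] Us /=; apply: extend_domain0.
by apply/funext => -[s x] /=; rewrite -dfield_extend.
Qed.

(** Near s0 and for small u, the values of zeta along the extended family agree
    outside a compact set independent of u. *)
Lemma dfield_line zeta s0 : smooth_field M zeta -> M = Line -> U s0 ->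
  exists A : R, \forall s \near s0, forall x, A < `|x| -> dfield zeta (c s) (h s) x = 0.
Proof.
move=> [_ _ sz] ME Us0; have [_ /(on_line ME)] := sz _ _ _ oOm dE.
move=> /(_ _ (extend_domain0 oU dc vh Us0)) [A nA]; exists A.
have nI : \forall s \near s0, nbhs (rcons0 0 s) (fun p => forall x, A < `|x| ->
    zeta (extend c h p) x = zeta (extend c h (rcons0 0 s0)) x).
  by apply: (rcons0_continuous (nbhs_interior nA)).
apply: filterS nI => s ns x Ax.
rewrite /dfield /dfun derive1E -[RHS](derive_cst (zeta (extend c h (rcons0 0 s0)) x : R^o) (0 : R^o) 1).
apply: near_eq_derive.
have := near_line (rcons0 1 0) ns; apply: filterS => t /(_ x Ax) <-.
by rewrite rcons0_line addr0; congr (zeta _ x); apply/funext => y; rewrite extend_cons.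
Qed.

Lemma dfield_vf_family zeta : smooth_field M zeta ->
  vf_family M U (fun s => dfield zeta (c s) (h s)).
Proof.
move=> sz; have sD := smooth_dfield sz; split.
  split; first exact: sD.
  apply: on_both => // ME s0 Us0.
  have [A nA] := dfield_line sz ME Us0; exists A; apply: filterS (nA) => s ns x Ax.
  by rewrite ns // (nbhs_singleton nA).
move=> s Us; split; first exact: (slice_smooth sD Us).
apply: on_both => ME.
  have [A nA] := dfield_line sz ME Us; exists A => x Ax.
  exact: (nbhs_singleton nA).
move=> x; rewrite /dfield /dfun !derive1E; apply: near_eq_derive.
apply: filterS (near_extend_diffeo Us) => t dt.
by have [_ vz _] := sz; have [_ /(on_circle ME)] := vz _ dt; apply.
Qed.

Lemma near_extend_smooth_fun (f : (R -> R) -> R) s : smooth_fun M f -> U s ->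
  derivable (fun t : R => f (fun x => c s x + t * h s x)) 0 1.
Proof.
move=> [_ sf] Us.
have -> : (fun t => f (fun x => c s x + t * h s x)) =
    (fun t => (f \o extend c h) (t *: rcons0 1 0 + rcons0 0 s)).
  apply/funext => t /=; rewrite rcons0_line addr0; congr f.
  by apply/funext => x; rewrite extend_cons.
rewrite derivable_line scale0r add0r; apply: diff_derivable.
apply: (smooth_on_diff (sf _ _ _ oOm dE)); exact: extend_domain0.
Qed.

End Extend.

(** The families g + t a + u h, where h may depend on t: for h the constant b
    they give the linearity and the symmetry of derivatives, for h the value of a
    field at g + t a they give the derivative along a field. *)
Section Plane.
Variables (g a b : R -> R).
Hypotheses (dg : is_diffeo M g) (va : is_vf M a) (vb : is_vf M b).
Notation c := (extend (fun=> g) (fun=> a)).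
Let U0 : set 'rV[R]_1 := setT.
Notation U := (extend_domain M U0 (fun=> g) (fun=> a)).

Definition pt (u t : R) : 'rV[R]_3 := rcons0 u (rcons0 t 0).

Lemma pt_affine (r u t u' t' : R) :
  r *: pt u t + pt u' t' = pt (r * u + u') (r * t + t').
Proof. by rewrite /pt -!rcons0_affine scaler0 addr0. Qed.

Let oU : open U. Proof. by apply: open_extend_domain; apply: openT. Qed.
Let dcst : diffeo_family M U0 (fun=> g). Proof. exact: const_diffeo_family. Qed.
Let vcst : vf_family M U0 (fun=> a). Proof. exact: const_vf_family. Qed.
Let dc : diffeo_family M U c.
Proof. by apply: extend_diffeo => //; [apply: openT|case: dcst]. Qed.

Lemma line_domain0 : U (rcons0 0 0).
Proof. by apply: extend_domain0 => //; apply: openT. Qed.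

Section PlaneField.
Variables (h : 'rV[R]_2 -> R -> R) (vh : vf_family M U h).
Notation Om := (extend_domain M U c h).
Variables (zeta : (R -> R) -> R -> R) (sz : smooth_field M zeta) (x : R).

Definition plane_value : 'rV[R]_3 -> R^o := fun p => zeta (extend c h p) x.

Lemma open_plane : open Om. Proof. exact: open_extend_domain. Qed.

Lemma plane0 : Om (pt 0 0).
Proof. by apply: extend_domain0 => //; apply: line_domain0. Qed.

Lemma plane_diffeo : diffeo_family M Om (extend c h).
Proof. by apply: extend_diffeo => //; case: dc. Qed.

Lemma smooth_plane_value : smooth_on Om plane_value.
Proof.
exact: smooth_field_value open_plane plane_diffeo sz.
Qed.

Lemma plane_valueE u t : plane_value (pt u t) =
  zeta (fun y => g y + t * a y + u * h (rcons0 t 0) y) x.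
Proof.
rewrite /plane_value; congr (zeta _ x); apply/funext => y.
by rewrite !extend_cons.
Qed.

End PlaneField.

Let vb' : vf_family M U (fun=> b). Proof. exact: const_vf_family. Qed.

(** Derivatives of zeta along a and b, at all points of the plane, are directional
    derivatives of one smooth function on a three-dimensional space, whose third
    coordinate is a dummy. *)
Lemma plane_dfield zeta x (alpha beta u t : R) :
  dfield zeta (fun y => g y + t * a y + u * b y) (fun y => alpha * a y + beta * b y) x =
  'D_(pt beta alpha) (plane_value (fun=> b) zeta x) (pt u t).
Proof.
rewrite /dfield /dfun derive1E.
have := derive_line (plane_value (fun=> b) zeta x) (pt u t) (pt beta alpha) 0.
rewrite scale0r add0r => <-.
have -> : (fun r => plane_value (fun=> b) zeta x (r *: pt beta alpha + pt u t)) =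
  (fun r => zeta (fun y => g y + t * a y + u * b y + r * (alpha * a y + beta * b y)) x) => //.
apply/funext => r; rewrite pt_affine plane_valueE; congr (zeta _ x).
by apply/funext => y; ring.
Qed.

Lemma dfield_linear zeta x (alpha beta : R) : smooth_field M zeta ->
  dfield zeta g (fun y => alpha * a y + beta * b y) x =
  alpha * dfield zeta g a x + beta * dfield zeta g b x.
Proof.
move=> sz; have d0 := smooth_on_diff (smooth_plane_value vb' sz x) (plane0 vb').
have E := @plane_dfield zeta x _ _ 0 0.
have g0 : (fun y => g y + 0 * a y + 0 * b y) = g by apply/funext => y; ring.
have aE : (fun y => 1 * a y + 0 * b y) = a by apply/funext => y; ring.
have bE : (fun y => 0 * a y + 1 * b y) = b by apply/funext => y; ring.
have := E alpha beta; have := E 0 1; have := E 1 0; rewrite g0 aE bE => -> -> ->.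
have -> : pt beta alpha = alpha *: pt 0 1 + beta *: pt 1 0.
  have pt0 : pt 0 0 = 0.
    rewrite -[pt 0 0]addr0 -(subrr (pt 0 0)) addrA -{1}[pt 0 0]scale1r pt_affine.
    by rewrite !mulr0 addr0 subrr.
  by rewrite -[beta *: _]addr0 -pt0 !pt_affine; congr pt; ring.
rewrite !(deriveE _ d0) linearD; congr (_ + _); apply: linearZ.
Qed.

(** Both sides are second derivatives at 0 of the value of zeta on the plane
    g + t a + u b. *)
Lemma dfield_comm zeta x : smooth_field M zeta ->
  derive1 (fun u => dfield zeta (fun y => g y + u * b y) a x) 0 =
  derive1 (fun t => dfield zeta (fun y => g y + t * a y) b x) 0.
Proof.
move=> sz; pose Phi := plane_value (fun=> b) zeta x.
have E := @plane_dfield zeta x.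
have aE : (fun y => 1 * a y + 0 * b y) = a by apply/funext => y; ring.
have bE : (fun y => 0 * a y + 1 * b y) = b by apply/funext => y; ring.
have L (v w : R) (D : 'rV[R]_3 -> R^o) :
    'D_(pt v w) D (pt 0 0) = derive1 (fun t => D (pt (t * v) (t * w))) 0.
  have -> : (fun t => D (pt (t * v) (t * w))) = (fun t => D (t *: pt v w + pt 0 0)).
    by apply/funext => t; rewrite pt_affine !addr0.
  by rewrite derive1E derive_line scale0r add0r.
have -> : (fun u => dfield zeta (fun y => g y + u * b y) a x) =
    (fun u => 'D_(pt 0 1) Phi (pt (u * 1) (u * 0))).
  apply/funext => u; rewrite mulr1 mulr0 -E aE.
  by congr (dfield _ _ _ _); apply/funext => y; ring.
have -> : (fun t => dfield zeta (fun y => g y + t * a y) b x) =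
    (fun t => 'D_(pt 1 0) Phi (pt (t * 0) (t * 1))).
  apply/funext => u; rewrite mulr1 mulr0 -E bE.
  by congr (dfield _ _ _ _); apply/funext => y; ring.
rewrite -(L 1 0 ('D_(pt 0 1) Phi)) -(L 0 1 ('D_(pt 1 0) Phi)).
have H := derive_comm (pt 1 0) (pt 0 1) (@open_plane (fun=> b)) (smooth_plane_value vb' sz x) (plane0 vb').
exact: H.
Qed.

Lemma derivable_dfield zeta x : smooth_field M zeta ->
  derivable (fun u : R => dfield zeta (fun y => g y + u * b y) a x) 0 1.
Proof.
move=> sz.
have aE : (fun y => 1 * a y + 0 * b y) = a by apply/funext => y; ring.
have -> : (fun u : R => dfield zeta (fun y => g y + u * b y) a x) =
    fun u => 'D_(pt 0 1) (plane_value (fun=> b) zeta x) (u *: pt 1 0 + pt 0 0).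
  apply/funext => u; rewrite pt_affine mulr1 mulr0 !addr0 -plane_dfield aE.
  by congr (dfield _ _ _ _); apply/funext => y; ring.
rewrite (derivable_line ('D_(pt 0 1) (plane_value (fun=> b) zeta x)) (pt 0 0) (pt 1 0) 0).
rewrite scale0r add0r; apply: diff_derivable.
apply: smooth_on_diff (plane0 vb'); apply: smooth_on_derive.
exact: smooth_plane_value.
Qed.

End Plane.

End FieldsOnFamilies.

(** * Derivatives of fields along curves *)

Section ChainRule.
Context {R : realType} (M : manifold).
Notation P := (@period R).
Notation mu := (@lebesgue_measure R).
Implicit Types (xi eta zeta : (R -> R) -> R -> R) (g h k a b : R -> R).

Lemma near_norm_lt (t d : R) : `|t| < d -> \forall u \near t, `|u| < d.
Proof.
move=> td; have : {for t, continuous (fun y : R => `|y|)} by apply: norm_continuous.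
by move/cvgr_lt; apply.
Qed.

Lemma near_norm_gt (t d : R) : d < `|t| -> \forall u \near t, d < `|u|.
Proof.
move=> td; have : {for t, continuous (fun y : R => `|y|)} by apply: norm_continuous.
by move/cvgr_gt; apply.
Qed.

Lemma open_coord_ball n (i : 'I_n) (d : R) : open [set p : 'rV[R]_n | `|p ord0 i| < d].
Proof.
apply: (open_comp (f := fun q : 'rV[R]_n => `|q ord0 i|) (D := [set t : R | t < d])) => [q _|].
  apply: (@continuous_comp _ _ _ (fun q : 'rV[R]_n => q ord0 i) (fun t : R => `|t|)).
    exact: coord_continuous.
  exact: norm_continuous.
exact: open_lt.
Qed.

Definition one : 'rV[R]_1 := const_mx 1.

Lemma one_ord0 (t : R) : (t *: one) ord0 ord0 = t.
Proof. by rewrite !mxE mulr1. Qed.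

Lemma rcons0_first n (u : R) (s : 'rV[R]_n.+1) : rcons0 u s ord0 ord0 = u.
Proof. by rewrite mxE unlift_none. Qed.

Lemma rcons0_last (u y : R) : rcons0 u (y *: one) ord0 ord_max = y.
Proof.
rewrite (_ : ord_max = lift ord0 ord0); last exact/val_inj.
by rewrite mxE liftK; apply: one_ord0.
Qed.

Lemma near0_row1 (A : set 'rV[R]_1) : nbhs (0 : 'rV[R]_1) A ->
  \forall t \near (0 : R), A (t *: one).
Proof. by move/(near_line one); apply: filterS => t; rewrite addr0. Qed.

Section Curve.
Variables (gamma : R -> R -> R) (U : set 'rV[R]_1).
Hypothesis (dgamma : diffeo_family M U (fun s => gamma (s ord0 ord0))).

Definition speed t y : R := derive1 (gamma^~ y) t.

Notation jgamma := (joint (fun s => gamma (s ord0 ord0)) : 'rV[R]_1 * R^o -> R^o).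

Lemma curve_line y : gamma^~ y = fun t : R => jgamma (t *: (one, 0) + (0, y)).
Proof.
apply/funext => t; rewrite /joint /= addr0 one_ord0.
by congr (gamma t _); rewrite scaler0 add0r.
Qed.

Lemma line_ptE (t y : R) : t *: (one, 0) + (0, y) = (t *: one, y) :> 'rV[R]_1 * R^o.
Proof. by congr pair; rewrite /= ?addr0 // scaler0 add0r. Qed.

Lemma speedE t y : speed t y = 'D_(one, 0) jgamma (t *: one, y).
Proof. by rewrite /speed derive1E curve_line derive_line line_ptE. Qed.

Lemma speed_is_derive (t y : R) : U (t *: one) -> is_derive t 1 (gamma^~ y) (speed t y).
Proof.
move=> Ut; rewrite /speed derive1E; apply: derivableP.
rewrite curve_line derivable_line line_ptE; apply: diff_derivable.
exact: smooth_on_diff dgamma.1.1 _.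
Qed.

Variables (d A sigma : R).
Hypothesis Ud : forall t : R, `|t| < d -> U (t *: one).
Hypothesis od : forall t : R, `|t| < d -> oriented M sigma (gamma t).
Hypothesis Ad : M = Line -> forall t : R, `|t| < d ->
  forall x, A < `|x| -> gamma t x = gamma 0 x.

Lemma speed_line (t y : R) : M = Line -> `|t| < d -> A < `|y| -> speed t y = 0.
Proof.
move=> ME td Ay; rewrite /speed derive1E -[RHS](derive_cst (gamma 0 y : R^o) (t : R^o) 1).
by apply: near_eq_derive; apply: filterS (near_norm_lt td) => u ud; apply: (Ad ME).
Qed.

Lemma speed_circle (t y : R) : M = Circle -> `|t| < d -> speed t (y + P) = speed t y.
Proof.
move=> ME td; have [dy _] := speed_is_derive y (Ud td).
have E : \forall u \near t, gamma u y + sigma * P = gamma u (y + P).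
  by apply: filterS (near_norm_lt td) => u ud; have [_ _ _ /(on_circle ME) ->] := od ud.
rewrite /speed !derive1E -(near_eq_derive (1 : R^o) E) deriveD ?derive_cst ?addr0 //.
Qed.

(** The r_t of Hadamard's lemma: it equals (gamma t - gamma 0) / t for t <> 0
    (mean_speedP), but is visibly smooth at t = 0. *)
Definition mean_speed t y : R := \int[mu]_(tau in `[0, 1]) speed (tau * t) y.

(** The domain of the integrand of mean_speed, as a function of the parameters
    q.1 = (t, y) and of the variable of integration q.2 = tau. *)
Definition slab : set ('rV[R]_2 * R^o) :=
  [set q : 'rV[R]_2 * R^o | `|q.2 * q.1 ord0 ord0| < d].

Definition time_comp (q : 'rV[R]_2 * R^o) : R^o := q.2 * q.1 ord0 ord0.
Definition space_comp (q : 'rV[R]_2 * R^o) : R^o := q.1 ord0 ord_max.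
Definition slab_speed (q : 'rV[R]_2 * R^o) : R^o := speed (time_comp q) (space_comp q).

Lemma smooth_entry (i : 'I_2) : smooth_on setT (fun q : 'rV[R]_2 * R^o => q.1 ord0 i : R^o).
Proof.
apply: (smooth_pullback (L := fun q : 'rV[R]_2 * R^o => q.1 ord0 i : R^o)
  (l := fun q => q.1 ord0 i : R^o) (B := setT) (f := id) (@lin_continuous_joint R 1)) => //.
  by move=> t v p; rewrite !mxE.
exact: smooth_id.
Qed.

Lemma smooth_snd : smooth_on setT (fun q : 'rV[R]_2 * R^o => q.2).
Proof.
apply: (smooth_pullback (L := fun q : 'rV[R]_2 * R^o => q.2)
  (l := snd) (B := setT) (f := id) (@lin_continuous_joint R 1)) => //.
exact: smooth_id.
Qed.

Lemma smooth_time_comp : smooth_on setT time_comp.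
Proof. by apply: (smooth_onM openT smooth_snd (smooth_entry _)). Qed.

Lemma open_slab : open slab.
Proof.
apply: (open_comp (f := time_comp : _ -> R) (D := [set t : R | `|t| < d])).
  by move=> q _; apply: differentiable_continuous; apply: smooth_on_diff smooth_time_comp _.
apply: (open_comp (f := fun t : R => `|t|) (D := [set t : R | t < d])) => [t _|].
  exact: norm_continuous.
exact: open_lt.
Qed.

Lemma smooth_slab_speed : smooth_on slab slab_speed.
Proof.
pose G (i : 'I_2) := if i == ord0 then time_comp else space_comp.
pose e (i : 'I_2) : 'rV[R]_1 * R^o := if i == ord0 then (one, 0) else (0, 1).
have GE q : \sum_(i < 2) G i q *: e i = (time_comp q *: one, space_comp q).
  rewrite big_ord_recl big_ord1 /G /e /=.
  by congr pair; rewrite /= ?scaler0 ?addr0 ?add0r //; apply: mulr1.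
apply: (smooth_on_ext open_slab (f := fun q => 'D_(one, 0) jgamma (\sum_(i < 2) G i q *: e i))).
  by move=> q _; rewrite GE /slab_speed speedE.
apply: (@smooth_on_comp R _ _ 2 slab [set p : 'rV[R]_1 * R^o | U p.1] G e ('D_(one, 0) jgamma)).
- exact: open_slab.
- rewrite /G => i; case: ifP => _; first exact: smooth_on_sub smooth_time_comp.
  exact: smooth_on_sub (smooth_entry _).
- exact: smooth_on_derive dgamma.1.1.
- by move=> q Wq; rewrite GE; apply: Ud.
Qed.

Lemma slab_bound (t tau : R) : `|t| < d -> 0 <= tau <= 1 -> `|tau * t| < d.
Proof.
move=> td /andP[t0 t1]; apply: le_lt_trans td; rewrite normrM ger0_norm //.
by rewrite ler_piMl.
Qed.

Lemma slab_speedE (t y tau : R) : slab_speed (rcons0 t (y *: one), tau) = speed (tau * t) y.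
Proof. by rewrite /slab_speed /time_comp /space_comp rcons0_first rcons0_last. Qed.

Lemma mean_speedE t y :
  mean_speed t y = \int[mu]_(tau in `[0, 1]) slab_speed (rcons0 t (y *: one), tau).
Proof. by apply: eq_Rintegral => tau _; rewrite slab_speedE. Qed.

Lemma smooth_mean_speed :
  smooth_on [set p : 'rV[R]_1 * R^o | `|p.1 ord0 ord0| < d]
    (joint (fun s => mean_speed (s ord0 ord0))).
Proof.
pose I (p : 'rV[R]_2) : R^o := \int[mu]_(tau in `[0, 1]) slab_speed (p, tau).
have sI : smooth_on [set p : 'rV[R]_2 | `|p ord0 ord0| < d] I.
  apply: (smooth_on_integral ler01 open_slab (@open_coord_ball _ _ _) smooth_slab_speed).
  by move=> s x sd x01; apply: slab_bound.
rewrite (_ : joint _ = I \o (fun p : 'rV[R]_1 * R^o => rcons0 (p.1 ord0 ord0) (p.2 *: one))); last first.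
  by apply/funext => p; rewrite /joint mean_speedE.
apply: (smooth_pullback (l := fun p : 'rV[R]_1 * R^o => rcons0 (p.1 ord0 ord0) (p.2 *: one))
  (@lin_continuous_joint R 0) _ _ sI).
  by move=> t v p; rewrite -rcons0_affine !mxE scalerDl -scalerA.
by move=> p /=; rewrite rcons0_first.
Qed.

Lemma speed_cont t y : `|t| < d -> cont_on 0 1 (fun tau => speed (tau * t) y).
Proof.
move=> td; have -> : (fun tau => speed (tau * t) y) =
    (fun tau => slab_speed (rcons0 t (y *: one), tau)).
  by apply/funext => tau; rewrite slab_speedE.
apply: (slice_cont smooth_slab_speed) => x x01; rewrite /slab /= rcons0_first.
exact: slab_bound.
Qed.

Lemma mean_speedP t y : `|t| < d -> gamma t y = gamma 0 y + t * mean_speed t y.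
Proof.
move=> td; rewrite /mean_speed -cont_on_intZ; last exact: speed_cont.
suff -> : \int[mu]_(tau in `[0, 1]) (t * speed (tau * t) y) = gamma (1 * t) y - gamma (0 * t) y.
  by rewrite mul0r mul1r addrC subrK.
apply: (@cont_on_FTC _ 0 1 _ (fun tau => gamma (tau * t) y)) => //.
  have ct : cont_on 0 1 (cst t : R -> R) by move=> x _; apply: cst_continuous.
  by have cs := @speed_cont t y td; move=> z z01; apply: continuousM; [apply: ct|apply: cs].
move=> x x01.
have -> : (fun tau => gamma (tau * t) y) = fun tau : R => jgamma (tau *: (t *: one, 0) + (0, y)).
  apply/funext => tau; have /(congr1 (@^~ (tau * t))) := curve_line y => /= ->.
  by congr (jgamma (_ + _)); congr pair => /=; rewrite ?scaler0 ?scalerA.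
have Ux : U (x *: (t *: one)) by rewrite scalerA; apply: Ud; apply: slab_bound.
have E : x *: (t *: one, 0) + (0, y) = (x *: (t *: one), y) :> 'rV[R]_1 * R^o.
  by congr pair; rewrite /= ?addr0 // scaler0 add0r.
have dJ : differentiable jgamma (x *: (t *: one, 0) + (0, y)).
  by rewrite E; apply: smooth_on_diff dgamma.1.1 _.
split; first by rewrite derivable_line; apply: diff_derivable.
rewrite derive_line; move: dJ; rewrite E => dJ; set q := (_, y) in dJ *.
have -> : (t *: one, 0) = t *: (one, 0) :> 'rV[R]_1 * R^o by congr pair; rewrite /= scaler0.
rewrite (deriveE _ dJ) linearZ -(deriveE _ dJ); congr (t * _).
by rewrite speedE /q scalerA.
Qed.

Lemma mean_speed0 y : mean_speed 0 y = speed 0 y.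
Proof.
rewrite /mean_speed; under eq_Rintegral do rewrite mulr0.
have mu1 : mu `[0, 1] = 1%:E.
  by rewrite lebesgue_measure_itv /= lte_fin ltr01 -EFinB subr0.
by rewrite Rintegral_cst // [X in fine X]mu1 mulr1.
Qed.

Lemma mean_speed_vf_family : vf_family M [set s : 'rV[R]_1 | `|s ord0 ord0| < d]
  (fun s => mean_speed (s ord0 ord0)).
Proof.
have line t y : M = Line -> `|t| < d -> A < `|y| -> mean_speed t y = 0.
  move=> ME td Ay; rewrite /mean_speed.
  rewrite (_ : \int[mu]_(tau in `[0, 1]) _ = \int[mu]_(tau in `[0, 1]) 0).
    by rewrite Rintegral_cst // mul0r.
  apply: eq_Rintegral => tau; rewrite inE /= in_itv /= => t01.
  exact: (speed_line ME (slab_bound td t01) Ay).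
split; first split; first exact: smooth_mean_speed.
  apply: on_both => // ME s0 sd0; exists A.
  have : \forall s \near s0, `|(s : 'rV[R]_1) ord0 ord0| < d.
    by apply: open_nbhs_nbhs; split => //; apply: open_coord_ball.
  by apply: filterS => s sd x Ax; rewrite !line.
move=> s sd; split; first exact: (slice_smooth smooth_mean_speed sd).
apply: on_both => ME; first by exists A => y; apply: line.
move=> y; apply: eq_Rintegral => tau; rewrite inE /= in_itv /= => t01.
by rewrite speed_circle // slab_bound.
Qed.

End Curve.

(** The derivative of a field along a curve of diffeomorphisms depends on the
    velocity of the curve only.  Writing gamma t = gamma 0 + t r_t, the curve is
    the diagonal of the two-parameter family gamma 0 + u r_t, whose derivative
    in t vanishes at u = 0. *)
Lemma chain_rule (gamma : R -> R -> R) (U : set 'rV[R]_1) zeta x :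
  open U -> U 0 -> diffeo_family M U (fun s => gamma (s ord0 ord0)) ->
  smooth_field M zeta ->
  derive1 (fun t => zeta (gamma t) x) 0 =
  dfield zeta (gamma 0) (fun y => derive1 (gamma^~ y) 0) x.
Proof.
move=> oU U0 dgamma sz.
have g00 : (0 : 'rV[R]_1) ord0 ord0 = 0 by rewrite mxE.
have dg0 : is_diffeo M (gamma 0) by have := dgamma.2 _ U0; rewrite g00.
have [sigma og] := diffeo_oriented dg0.
have nU := near0_row1 (open_nbhs_nbhs (conj oU U0)).
have no : \forall t \near (0 : R), oriented M sigma (gamma t).
  have := @diffeo_family_oriented _ _ _ _ _ _ sigma oU U0 dgamma.
  rewrite g00 => /(_ og) /near0_row1; apply: filterS => t.
  by rewrite one_ord0.
have [A nA] : exists A : R, M = Line -> \forall t \near (0 : R), forall x, A < `|x| -> gamma t x = gamma 0 x.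
  have [ME|ME] : M = Line \/ M <> Line by case: (M); [left|right].
    have [A nA] := on_line ME dgamma.1.2 _ U0; exists A => _.
    by have := near0_row1 nA; apply: filterS => t; rewrite one_ord0 g00.
  by exists 0.
have [d d0 Pd] : exists2 d : R, 0 < d & forall t, `|t| < d ->
    [/\ U (t *: one), oriented M sigma (gamma t) &
        M = Line -> forall x, A < `|x| -> gamma t x = gamma 0 x].
  have nA' : \forall t \near (0 : R), M = Line -> forall x, A < `|x| -> gamma t x = gamma 0 x.
    have [ME|ME] : M = Line \/ M <> Line by case: (M); [left|right].
      by apply: filterS (nA ME) => t H _.
    by near=> t => /ME.
  have n3 : \forall t \near (0 : R), [/\ U (t *: one), oriented M sigma (gamma t) &
      M = Line -> forall x, A < `|x| -> gamma t x = gamma 0 x].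
    by apply: filterS3 nU no nA' => t Ut ot At; split.
  have [d /= d0 dP] := (nbhs_ballP _ _).1 n3.
  by exists d => // t td; apply: dP; rewrite -ball_normE /= sub0r normrN.
have Ud t td := (let: And3 H _ _ := Pd t td in H).
have od t td := (let: And3 _ H _ := Pd t td in H).
have Ad ME t td := (let: And3 _ _ H := Pd t td in H ME).
have vr := mean_speed_vf_family dgamma Ud od Ad.
set U' := [set s : 'rV[R]_1 | _] in vr.
have oU' : open U' by apply: open_coord_ball.
have U'0 : U' 0 by rewrite /U' /= g00 normr0.
set r := (fun s : 'rV[R]_1 => _) in vr.
have dc := const_diffeo_family (n := 0) U' dg0.
set c := (fun=> gamma 0) in dc.
have oOm : open (extend_domain M U' c r) by apply: open_extend_domain.
have dE : diffeo_family M (extend_domain M U' c r) (extend c r).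
  by apply: extend_diffeo => //; case: dc.
pose Phi p : R^o := zeta (extend c r p) x.
have dPhi : differentiable Phi (rcons0 0 0).
  apply: smooth_on_diff (smooth_field_value x oOm dE sz) _.
  exact: extend_domain0.
pose w := rcons0 1 one; pose w0 := rcons0 0 one.
have rE t : t *: w + rcons0 0 0 = rcons0 t (t *: one).
  by rewrite -rcons0_affine mulr1 !addr0.
have r0E t : t *: w0 + rcons0 0 0 = rcons0 0 (t *: one).
  by rewrite -rcons0_affine mulr0 !addr0.
have lineE v : derive1 (fun t : R => Phi (t *: v + rcons0 0 0)) 0 = 'D_v Phi (rcons0 0 0).
  by rewrite derive1E derive_line scale0r add0r.
transitivity ('D_w Phi (rcons0 0 0)).
  rewrite -lineE !derive1E; apply: near_eq_derive.
  have : \forall t \near (0 : R), `|t| < d by apply: near_norm_lt; rewrite normr0.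
  apply: filterS => t td; rewrite rE /Phi; congr (zeta _ x); apply/funext => y.
  by rewrite extend_cons /c /r one_ord0; apply: (mean_speedP dgamma Ud).
have wE : w = rcons0 1 0 + w0.
  by have := rcons0_affine 1 1 0 0 one; rewrite !scale1r mul1r addr0 add0r.
have D0 : 'D_w0 Phi (rcons0 0 0) = 0.
  rewrite -lineE (_ : (fun t : R => _) = cst (zeta (gamma 0) x)) ?derive1_cst //.
  apply/funext => t; rewrite r0E /Phi; congr (zeta _ x); apply/funext => y.
  by rewrite extend_cons mul0r addr0.
rewrite deriveE // wE linearD /= -!deriveE // D0 addr0.
have := @dfun_extend R _ c r (fun g' => zeta g' x) 0.
rewrite /dfield => <-; congr (dfun _ _ _); apply/funext => y.
by rewrite /r g00 mean_speed0.
Unshelve. all: by end_near. Qed.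

End ChainRule.

(** * Rules of differentiation on the line *)

Section DerivativeRules.
Context {R : realType}.
Implicit Types (f k : R -> R) (x u : R).

Lemma derivable_add f k x : derivable f x 1 -> derivable k x 1 ->
  derivable (fun t => f t + k t) x 1.
Proof. exact: derivableD. Qed.

Lemma derivable_mul f k x : derivable f x 1 -> derivable k x 1 ->
  derivable (fun t => f t * k t) x 1.
Proof. exact: derivableM. Qed.

Lemma derivable_inv f x : f x != 0 -> derivable f x 1 ->
  derivable (fun t => (f t)^-1) x 1.
Proof. exact: derivableV. Qed.

Lemma derive1_add f k x : derivable f x 1 -> derivable k x 1 ->
  derive1 (fun t => f t + k t) x = derive1 f x + derive1 k x.
Proof. by move=> df dk; rewrite !derive1E; apply: deriveD. Qed.

Lemma derive1_mul f k x : derivable f x 1 -> derivable k x 1 ->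
  derive1 (fun t => f t * k t) x = derive1 f x * k x + f x * derive1 k x.
Proof.
move=> df dk; rewrite !derive1E.
have -> : 'D_1 (fun t => f t * k t) x = f x *: 'D_1 k x + k x *: 'D_1 f x by apply: deriveM.
by rewrite addrC /GRing.scale /= mulrC.
Qed.

Lemma derive1_inv f x : f x != 0 -> derivable f x 1 ->
  derive1 (fun t => (f t)^-1) x = - derive1 f x / (f x * f x).
Proof.
move=> f0 df; rewrite !derive1E.
have -> : 'D_1 (fun t => (f t)^-1) x = - (f x) ^- 2 *: 'D_1 f x by apply: deriveV.
by rewrite /GRing.scale /= expr2 mulNr mulrC mulNr.
Qed.

Lemma derivable_const (c x : R) : derivable (fun _ : R => c) x 1.
Proof. exact: derivable_cst. Qed.

Lemma derive1_const (c x : R) : derive1 (fun _ : R => c) x = 0.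
Proof. exact: derive1_cst. Qed.

Lemma derivable_line1 (c m x : R) : derivable (fun t : R => c + t * m) x 1.
Proof.
apply: derivable_add; first exact: derivable_const.
by apply: derivable_mul; [apply: derivable_id|apply: derivable_const].
Qed.

Lemma derive1_line1 (c m x : R) : derive1 (fun t : R => c + t * m) x = m.
Proof.
have di : derivable (fun t : R => t) x 1 by apply: derivable_id.
have dc := @derivable_const c x; have dm := @derivable_const m x.
rewrite (derive1_add dc (derivable_mul di dm)) (derive1_mul di dm).
by rewrite !derive1_const derive1_id mulr0 add0r addr0 mul1r.
Qed.

End DerivativeRules.

(** * Derivatives along the bracket of two fields *)

Section Bracket.
Context {R : realType} (M : manifold).
Implicit Types (xi eta zeta : (R -> R) -> R -> R) (g h k a b : R -> R).

Lemma family_pullback m n (U : set 'rV[R]_n.+1) c (L l : 'rV[R]_m.+1 -> 'rV[R]_n.+1) :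
  (forall t v p, L (t *: v + p) = t *: l v + L p) ->
  diffeo_family M U c -> diffeo_family M (L @^-1` U) (c \o L).
Proof.
move=> Ll [[sc cM] dc]; split=> [|s Us]; last exact: dc.
split.
  apply: (smooth_pullback (L := fun p : 'rV[R]_m.+1 * R^o => (L p.1, p.2))
    (l := fun p => (l p.1, p.2)) (@lin_continuous_joint R m) _ _ sc) => //.
  by move=> t v p; congr pair; rewrite Ll.
move: cM; case: M => // cM s Us; have [A nA] := cM _ Us; exists A.
have cL : continuous L.
  by move=> p; apply/differentiable_continuous/(affine_differentiable (@lin_continuous_rV R _) Ll).
exact: (cL s _ nA).
Qed.

Lemma field_line_derivable eta g a (y : R) : smooth_field M eta -> is_diffeo M g ->
  is_vf M a -> derivable (fun t : R => eta (fun x => g x + t * a x) y) 0 1.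
Proof.
move=> sE dg va; pose U : set 'rV[R]_1 := setT.
have dc := const_diffeo_family U dg; have vc := const_vf_family U va.
have oU : open U by apply: openT.
have oOm : open (extend_domain M U (fun=> g) (fun=> a)) by apply: open_extend_domain.
have dE : diffeo_family M (extend_domain M U (fun=> g) (fun=> a)) (extend (fun=> g) (fun=> a)).
  by apply: extend_diffeo => //; case: dc.
have -> : (fun t : R => eta (fun x => g x + t * a x) y) =
    fun t => eta (extend (fun=> g) (fun=> a) (t *: rcons0 1 0 + rcons0 0 (0 : 'rV[R]_1))) y.
  apply/funext => t; congr (eta _ y); apply/funext => x.
  by rewrite rcons0_line addr0 extend_cons.
rewrite (derivable_line (fun p => eta (extend (fun=> g) (fun=> a) p) y : R^o)) scale0r add0r.
apply: diff_derivable; apply: smooth_on_diff (smooth_field_value y oOm dE sE) _.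
exact: extend_domain0.
Qed.

Lemma near_line_diffeo g a : is_diffeo M g -> is_vf M a ->
  \forall t \near (0 : R), is_diffeo M (fun x => g x + t * a x).
Proof.
move=> dg va; apply: (@near_extend_diffeo R M 0 setT (fun=> g) (fun=> a) openT _ _ 0 I).
  exact: const_diffeo_family.
exact: const_vf_family.
Qed.

Lemma dfield_vf zeta g a : smooth_field M zeta -> is_diffeo M g -> is_vf M a ->
  is_vf M (dfield zeta g a).
Proof.
move=> sz dg va; have [_ H] := @dfield_vf_family R M 0 setT (fun=> g) (fun=> a) openT
  (const_diffeo_family setT dg) (const_vf_family setT va) zeta sz.
exact: (H 0 I).
Qed.

Lemma add0_line g a : (fun x => g x + 0 * a x) = g.
Proof. by apply/funext => x; rewrite mul0r addr0. Qed.

Lemma rcons00 n : rcons0 0 0 = 0 :> 'rV[R]_n.+2.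
Proof. by apply/rowP => j; rewrite !mxE; case: unliftP => [k|] _ //=; rewrite mxE. Qed.

(** Both sides are second derivatives of zeta along the two-parameter family
    g + t a + u eta (g + t a).  Differentiating first in u and then in t gives the
    left-hand side.  In the other order, the derivative in t at fixed u is taken
    along a curve with velocity a + u D eta (a), to which chain_rule applies; its
    derivative in u at u = 0 is the right-hand side. *)
Lemma derive_dfield zeta eta g a x : smooth_field M zeta -> smooth_field M eta ->
  is_diffeo M g -> is_vf M a ->
  dfun (fun g' => dfield zeta g' (eta g') x) g a =
  derive1 (fun u => dfield zeta (fun y => g y + u * eta g y) a x) 0 +
  dfield zeta g (dfield eta g a) x.
Proof.
move=> sz se dg va; pose U0 : set 'rV[R]_1 := setT.
have oU0 : open U0 by apply: openT.
pose c := extend (fun=> g) (fun=> a) : 'rV[R]_2 -> R -> R.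
pose U := extend_domain M U0 (fun=> g) (fun=> a).
have oU : open U by apply: open_extend_domain.
have dc : diffeo_family M U c.
  apply: extend_diffeo => //; first by case: (const_diffeo_family U0 dg).
  exact: const_vf_family.
have vb : is_vf M (eta g) by have [_ ve _] := se; apply: ve.
have vk := dfield_vf se dg va.
pose h p := eta (c p); have vh : vf_family M U h by apply: field_vf_family.
pose A := plane_value g a h zeta x.
have sA := smooth_plane_value dg va vh sz x.
have oOm := @open_plane R M g a h; have A0 := plane0 dg va vh.
have dE := plane_diffeo dg va vh.
have cE t : c (rcons0 t 0) = fun y => g y + t * a y.
  by apply/funext => y; rewrite /c extend_cons.
have step1 t : dfield zeta (fun y => g y + t * a y) (eta (fun y => g y + t * a y)) x =
    'D_(pt 1 0) A (pt 0 t).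
  by rewrite -cE /dfield (@dfun_extend R _ c h) /A /pt rcons00.
have line v w (D : 'rV[R]_3 -> R^o) u0 t0 :
    'D_(pt v w) D (pt u0 t0) = derive1 (fun r => D (pt (r * v + u0) (r * w + t0))) 0.
  have -> : (fun r => D (pt (r * v + u0) (r * w + t0))) = (fun r => D (r *: pt v w + pt u0 t0)).
    by apply/funext => r; rewrite pt_affine.
  by rewrite derive1E derive_line scale0r add0r.
have -> : dfun (fun g' => dfield zeta g' (eta g') x) g a = 'D_(pt 0 1) ('D_(pt 1 0) A) (pt 0 0).
  rewrite line /dfun; congr (derive1 _ 0); apply/funext => t.
  by rewrite mulr0 mulr1 !addr0 step1.
rewrite (derive_comm (pt 0 1) (pt 1 0) oOm sA A0) line.
pose F u := dfield zeta (fun y => g y + u * eta g y) a x.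
pose K u := dfield zeta (fun y => g y + u * eta g y) (dfield eta g a) x.
have dF : derivable F 0 1 := derivable_dfield dg va vb sz.
have dK : derivable K 0 1 := derivable_dfield dg vk vb sz.
have -> : derive1 (fun r => 'D_(pt 0 1) A (pt (r * 1 + 0) (r * 0 + 0))) 0 =
    derive1 (fun u => F u + u * K u) 0.
  rewrite !derive1E; apply: near_eq_derive.
  have nOm : \forall u \near (0 : R), extend_domain M U c h (pt u 0).
    have := near_line (pt 1 0) (open_nbhs_nbhs (conj oOm A0)).
    by apply: filterS => u; rewrite pt_affine mulr1 mulr0 !addr0.
  apply: filterS2 nOm (near_line_diffeo dg vb) => u uOm du.
  rewrite mulr1 mulr0 !addr0 line.
  pose gam t : R -> R := fun y => g y + t * a y + u * eta (fun y => g y + t * a y) y.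
  have L (t : R) (v p : 'rV[R]_1) : pt u ((t *: v + p) ord0 ord0) =
      t *: pt 0 (v ord0 ord0) + pt u (p ord0 ord0).
    by rewrite pt_affine mulr0 add0r !mxE.
  have gamE (s : 'rV[R]_1) : extend c h (pt u (s ord0 ord0)) = gam (s ord0 ord0).
    by apply/funext => y; rewrite /pt extend_cons /h cE.
  have dgam : diffeo_family M
      [set s : 'rV[R]_1 | extend_domain M U c h (pt u (s ord0 ord0))] (fun s => gam (s ord0 ord0)).
    have <- : extend c h \o (fun s : 'rV[R]_1 => pt u (s ord0 ord0)) =
        (fun s : 'rV[R]_1 => gam (s ord0 ord0)).
      by apply/funext => s; rewrite -gamE.
    exact: (family_pullback L dE).
  have ogam : open [set s : 'rV[R]_1 | extend_domain M U c h (pt u (s ord0 ord0))].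
    apply: (open_comp (f := fun s : 'rV[R]_1 => pt u (s ord0 ord0))) oOm => s _.
    exact/differentiable_continuous/(affine_differentiable (@lin_continuous_rV R _) L).
  have g0 : [set s : 'rV[R]_1 | extend_domain M U c h (pt u (s ord0 ord0))] 0.
    by rewrite /= mxE.
  transitivity (derive1 (fun t => zeta (gam t) x) 0).
    congr (derive1 _ 0); apply/funext => t; rewrite mulr0 mulr1 add0r addr0.
    by rewrite /A plane_valueE /gam /h cE.
  rewrite (chain_rule x ogam g0 dgam sz).
  have -> : gam 0 = fun y => g y + u * eta g y.
    by apply/funext => y; rewrite /gam add0_line mul0r addr0.
  have -> : (fun y => derive1 (gam^~ y) 0) = fun y => 1 * a y + u * dfield eta g a y.
    apply/funext => y.
    have d1 := @derivable_line1 R (g y) (a y) 0.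
    have d2 := @field_line_derivable eta g a y se dg va.
    rewrite (derive1_add d1 (derivable_mul (@derivable_const R u 0) d2)).
    by rewrite derive1_line1 (derive1_mul (@derivable_const R u 0) d2) derive1_const mul0r add0r mul1r.
  by rewrite (dfield_linear du va vk _ _ _ sz) mul1r.
have di : derivable (fun t : R => t) 0 1 by apply: derivable_id.
rewrite (derive1_add dF (derivable_mul di dK)) (derive1_mul di dK) mul0r addr0.
by rewrite derive1_id mul1r /K add0_line.
Qed.

(** In the difference of the two instances of derive_dfield the second
    derivatives of zeta cancel by symmetry. *)
Lemma dfield_bracket zeta xi eta g x : smooth_field M zeta -> smooth_field M xi ->
  smooth_field M eta -> is_diffeo M g ->
  dfun (fun g' => dfield zeta g' (eta g') x) g (xi g) -
  dfun (fun g' => dfield zeta g' (xi g') x) g (eta g) =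
  dfield zeta g (lie_bracket xi eta g) x.
Proof.
move=> sz sx se dg; have [_ vx _] := sx; have [_ ve _] := se.
have vxg := vx _ dg; have veg := ve _ dg.
rewrite (derive_dfield x sz se dg vxg) (derive_dfield x sz sx dg veg).
rewrite (dfield_comm dg vxg veg x sz).
have -> : lie_bracket xi eta g = fun y => 1 * dfield eta g (xi g) y + -1 * dfield xi g (eta g) y.
  by apply/funext => y; rewrite /lie_bracket mul1r mulN1r.
have v1 := dfield_vf se dg vxg; have v2 := dfield_vf sx dg veg.
rewrite (dfield_linear dg v1 v2 _ _ _ sz) mul1r mulN1r opprD addrACA.
by rewrite subrr add0r.
Qed.

End Bracket.

(** * The Levi-Civita connection *)

Section Connection.
Context {R : realType} (M : manifold).
Notation P := (@period R).
Notation mu := (@lebesgue_measure R).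
Implicit Types (xi eta zeta : (R -> R) -> R -> R) (g h k a b : R -> R).

(** For fields constant in the chart, the Koszul formula and an integration by
    parts give int (christoffel g h k) l g' dx = int (h k)' l dx for all l. *)
Definition christoffel g h k : R -> R :=
  fun x => derive1 (fun y => h y * k y) x / derive1 g x.

Definition lc_connection xi eta : (R -> R) -> R -> R :=
  fun g x => dfield eta g (xi g) x + christoffel g (xi g) (eta g) x.

Lemma diffeo_derive1_neq0 g x : is_diffeo M g -> derive1 g x != 0.
Proof.
move=> /diffeo_oriented [s [_ _ g0 _]].
by apply: contraTneq (g0 x) => ->; rewrite mulr0 ltxx.
Qed.

Lemma diffeo_derive1_periodic g x : M = Circle -> is_diffeo M g ->
  derive1 g (x + P) = derive1 g x.
Proof.
move=> ME /diffeo_oriented [s [_ sg _ /(on_circle ME) gP]].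
exact: quasi_periodic_derive1 sg gP.
Qed.

Lemma near_gt_eq_derive1 h k (A x : R) : (forall y, A < `|y| -> h y = k y) ->
  A < `|x| -> derive1 h x = derive1 k x.
Proof.
move=> hk Ax; rewrite !derive1E; apply: near_eq_derive.
by apply: filterS (near_norm_gt Ax) => y; apply: hk.
Qed.

Lemma vf_bound h : M = Line -> is_vf M h -> exists A : R, forall x, A < `|x| -> h x = 0.
Proof. by move=> ME [_ /(on_line ME)]. Qed.

Lemma vf_periodic h x : M = Circle -> is_vf M h -> h (x + P) = h x.
Proof. by move=> ME [_ /(on_circle ME)]. Qed.

Section ConnectionFamilies.
Variables (n : nat) (U : set 'rV[R]_n.+1).
Hypothesis oU : open U.
Implicit Types c f : 'rV[R]_n.+1 -> R -> R.

Let oC : open [set p : 'rV[R]_n.+1 * R^o | U p.1] := open_cylinder oU.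

Lemma vf_family_add f1 f2 : vf_family M U f1 -> vf_family M U f2 ->
  vf_family M U (fun s x => f1 s x + f2 s x).
Proof.
move=> [[s1 m1] v1] [[s2 m2] v2]; split; first split.
- exact: (smooth_onD oC s1 s2).
- apply: on_both => // ME s0 Us0.
  have [A1 n1] := on_line ME m1 _ Us0; have [A2 n2] := on_line ME m2 _ Us0.
  exists (`|A1| + `|A2|); apply: filterS2 n1 n2 => s h1 h2 x Ax.
  have := ler_norm A1; have := ler_norm A2; have := normr_ge0 A1; have := normr_ge0 A2.
  by move=> ? ? ? ?; rewrite h1 ?h2 //; lra.
- move=> s Us; have [t1 w1] := v1 _ Us; have [t2 w2] := v2 _ Us.
  split; first exact: smoothD.
  apply: on_both => ME; last by move=> x; rewrite (on_circle ME w1) (on_circle ME w2).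
  have [A1 h1] := on_line ME w1; have [A2 h2] := on_line ME w2.
  exists (`|A1| + `|A2|) => x Ax.
  have := ler_norm A1; have := ler_norm A2; have := normr_ge0 A1; have := normr_ge0 A2.
  by move=> ? ? ? ?; rewrite h1 ?h2 ?addr0 //; lra.
Qed.

Lemma christoffel_family c f1 f2 : diffeo_family M U c ->
  vf_family M U f1 -> vf_family M U f2 ->
  vf_family M U (fun s => christoffel (c s) (f1 s) (f2 s)).
Proof.
move=> [[sc mc] dc] [[s1 m1] v1] [[s2 m2] v2].
have s12 := smooth_onM oC s1 s2.
pose f12 s x := f1 s x * f2 s x.
have sJ : smooth_on [set p : 'rV[R]_n.+1 * R^o | U p.1]
    (joint (fun s => christoffel (c s) (f1 s) (f2 s))).
  rewrite (_ : joint _ = fun p => 'D_(0, 1) (joint f12) p * ('D_(0, 1) (joint c) p)^-1).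
    apply: (smooth_onM oC); first exact: smooth_on_derive.
    apply: (smooth_onV oC); last exact: smooth_on_derive.
    by move=> -[s x] Us; rewrite -slice_derive1; apply/diffeo_derive1_neq0/dc.
  by apply/funext => -[s x]; rewrite -!slice_derive1.
split; first split.
- exact: sJ.
- apply: on_both => // ME s0 Us0.
  have [A1 n1] := on_line ME m1 _ Us0; have [A2 n2] := on_line ME m2 _ Us0.
  have [A3 n3] := on_line ME mc _ Us0.
  exists (`|A1| + `|A2| + `|A3|); apply: filterS3 n1 n2 n3 => s h1 h2 h3 x Ax.
  have := ler_norm A1; have := ler_norm A2; have := ler_norm A3.
  have := normr_ge0 A1; have := normr_ge0 A2; have := normr_ge0 A3.
  move=> ? ? ? ? ? ?; rewrite /christoffel; congr (_ / _).
    by apply: (near_gt_eq_derive1 _ Ax) => y Ay; rewrite h1 ?h2 //; lra.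
  by apply: (near_gt_eq_derive1 _ Ax) => y Ay; rewrite h3 //; lra.
- move=> s Us; split; first exact: (slice_smooth sJ Us).
  apply: on_both => ME.
    have [A hA] := vf_bound ME (v1 _ Us); exists A => x Ax.
    rewrite /christoffel (near_gt_eq_derive1 (k := fun=> 0) _ Ax) ?derive1_const ?mul0r //.
    by move=> y Ay; rewrite hA // mul0r.
  move=> x; rewrite /christoffel (diffeo_derive1_periodic x ME (dc _ Us)).
  by rewrite periodic_derive1 // => y; rewrite !(vf_periodic _ ME) //; [apply: v2|apply: v1].
Qed.

Lemma lc_connection_family c xi eta : smooth_field M xi -> smooth_field M eta ->
  diffeo_family M U c -> vf_family M U (fun s => lc_connection xi eta (c s)).
Proof.
move=> sx se dc; have vx := field_vf_family sx oU dc; have ve := field_vf_family se oU dc.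
apply: vf_family_add; first exact: (dfield_vf_family oU dc vx se).
exact: (christoffel_family dc vx ve).
Qed.

End ConnectionFamilies.

Lemma lc_connection_smooth xi eta : smooth_field M xi -> smooth_field M eta ->
  smooth_field M (lc_connection xi eta).
Proof.
move=> sx se; have [lx vx _] := sx; have [le ve _] := se; split.
- rewrite /lift_invariant; apply: on_both => // ME g k dg.
  have lxg := on_circle ME lx g k dg; have leg := on_circle ME le g k dg.
  apply/funext => x; rewrite /lc_connection /christoffel lxg leg; congr (_ + _ / _).
    rewrite /dfield /dfun !derive1E; apply: near_eq_derive.
    apply: filterS (near_line_diffeo dg (vx _ dg)) => t dt.
    rewrite -(on_circle ME le _ k dt); congr (eta _ x); apply/funext => y.
    by rewrite addrAC.
  have sg := @smooth_derivable R _ x (let: And3 s _ _ := dg in s).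
  by rewrite (derive1_add sg (@derivable_const R (P *~ k) x)) derive1_const addr0.
- move=> g dg; have [_ H] := lc_connection_family openT sx se (const_diffeo_family (n := 0) setT dg).
  exact: (H 0 I).
- by move=> n U c oU dc; have [] := lc_connection_family oU sx se dc.
Qed.

Lemma lc_connection_linearl (f : (R -> R) -> R) xi1 xi2 eta g x :
  smooth_field M xi1 -> smooth_field M xi2 -> smooth_field M eta -> is_diffeo M g ->
  lc_connection (fun g x => f g * xi1 g x + xi2 g x) eta g x =
  f g * lc_connection xi1 eta g x + lc_connection xi2 eta g x.
Proof.
move=> [_ v1 _] [_ v2 _] se dg; have [_ ve _] := se.
have w1 := v1 _ dg; have w2 := v2 _ dg; have we := ve _ dg.
rewrite /lc_connection /christoffel.
have -> : dfield eta g (fun x => f g * xi1 g x + xi2 g x) x =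
    f g * dfield eta g (xi1 g) x + dfield eta g (xi2 g) x.
  rewrite -[X in _ + X]mul1r -(dfield_linear dg w1 w2 _ _ _ se); congr (dfield _ _ _ _).
  by apply/funext => y; rewrite mul1r.
have d1 := @smooth_derivable R _ x (smoothM w1.1 we.1).
have d2 := @smooth_derivable R _ x (smoothM w2.1 we.1).
have -> : derive1 (fun y => (f g * xi1 g y + xi2 g y) * eta g y) x =
    f g * derive1 (fun y => xi1 g y * eta g y) x + derive1 (fun y => xi2 g y * eta g y) x.
  rewrite (_ : (fun y => _) = fun y => f g * (xi1 g y * eta g y) + xi2 g y * eta g y); last first.
    by apply/funext => y; rewrite mulrDl mulrA.
  have dc := @derivable_const R (f g) x.
  by rewrite (derive1_add (derivable_mul dc d1) d2) (derive1_mul dc d1) derive1_const mul0r add0r.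
by move: (derive1 _ _) (derive1 _ _) (dfield _ _ _ _) (dfield _ _ _ _) => p q r s; ring.
Qed.

Lemma lc_connection_additiver xi eta1 eta2 g x :
  smooth_field M xi -> smooth_field M eta1 -> smooth_field M eta2 -> is_diffeo M g ->
  lc_connection xi (fun g x => eta1 g x + eta2 g x) g x =
  lc_connection xi eta1 g x + lc_connection xi eta2 g x.
Proof.
move=> [_ vx _] s1 s2 dg; have wx := vx _ dg.
have [_ v1 _] := s1; have [_ v2 _] := s2; have w1 := v1 _ dg; have w2 := v2 _ dg.
rewrite /lc_connection /christoffel /dfield /dfun.
have e1 := @field_line_derivable R M eta1 g (xi g) x s1 dg wx.
have e2 := @field_line_derivable R M eta2 g (xi g) x s2 dg wx.
rewrite (derive1_add e1 e2).
have d1 := @smooth_derivable R _ x (smoothM wx.1 w1.1).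
have d2 := @smooth_derivable R _ x (smoothM wx.1 w2.1).
rewrite (_ : (fun y => xi g y * (eta1 g y + eta2 g y)) =
    fun y => xi g y * eta1 g y + xi g y * eta2 g y); last first.
  by apply/funext => y; rewrite mulrDr.
rewrite (derive1_add d1 d2).
by move: (derive1 _ _) (derive1 _ _) (derive1 _ _) (derive1 _ _) => p q r s; ring.
Qed.

Lemma fun_line_derivable f g a : smooth_fun M f -> is_diffeo M g -> is_vf M a ->
  derivable (fun t : R => f (fun x => g x + t * a x)) 0 1.
Proof.
move=> sf dg va; apply: (@near_extend_smooth_fun R M 0 setT (fun=> g) (fun=> a) openT _ _ f 0 sf I).
  exact: const_diffeo_family.
exact: const_vf_family.
Qed.

Lemma lc_connection_leibniz f xi eta g x :
  smooth_fun M f -> smooth_field M xi -> smooth_field M eta -> is_diffeo M g ->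
  lc_connection xi (fun g x => f g * eta g x) g x =
  dfun f g (xi g) * eta g x + f g * lc_connection xi eta g x.
Proof.
move=> sf [_ vx _] se dg; have wx := vx _ dg; have [_ ve _] := se; have we := ve _ dg.
rewrite /lc_connection /christoffel /dfield /dfun.
have e1 := fun_line_derivable sf dg wx.
have e2 := @field_line_derivable R M eta g (xi g) x se dg wx.
rewrite (derive1_mul e1 e2) !add0_line.
have d1 := @smooth_derivable R _ x (smoothM wx.1 we.1).
have dc := @derivable_const R (f g) x.
rewrite (_ : (fun y => xi g y * (f g * eta g y)) = fun y => f g * (xi g y * eta g y)); last first.
  by apply/funext => y; rewrite mulrCA.
rewrite (derive1_mul dc d1) derive1_const mul0r add0r.
by move: (derive1 _ _) (derive1 _ _) (derive1 _ _) (derive1 _ _) => p q r s; ring.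
Qed.

Lemma lc_connection_torsion_free xi eta g x :
  lc_connection xi eta g x - lc_connection eta xi g x = lie_bracket xi eta g x.
Proof.
rewrite /lc_connection /lie_bracket (_ : christoffel g (eta g) (xi g) = christoffel g (xi g) (eta g)).
  by rewrite opprD addrACA subrr addr0.
rewrite /christoffel (_ : (fun y => eta g y * xi g y) = fun y => xi g y * eta g y) //.
by apply/funext => z; rewrite mulrC.
Qed.

(** The fields along g + t a agree outside a common compact set, so that their
    inner products are integrals over the same segment for all small t. *)
Lemma near_within_bound eta g a : smooth_field M eta -> is_diffeo M g -> is_vf M a ->
  \forall C \near +oo, \forall t \near (0 : R),
  within_bound M C (eta (fun x => g x + t * a x)).
Proof.
move=> se dg va; have [_ ve sf] := se; have veg := ve _ dg.
have [B hB] := vf_within_bound veg; have [B0 _] := hB.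
pose U : set 'rV[R]_1 := setT; have oU : open U by apply: openT.
have dc := const_diffeo_family U dg; have vc := const_vf_family U va.
have oOm : open (extend_domain M U (fun=> g) (fun=> a)) by apply: open_extend_domain.
have dE : diffeo_family M (extend_domain M U (fun=> g) (fun=> a)) (extend (fun=> g) (fun=> a)).
  by apply: extend_diffeo => //; case: dc.
have Om0 : extend_domain M U (fun=> g) (fun=> a) (rcons0 0 0) by apply: extend_domain0.
have extE t : extend (fun=> g) (fun=> a) (t *: rcons0 1 0 + rcons0 0 (0 : 'rV[R]_1)) = fun x => g x + t * a x.
  by apply/funext => x; rewrite rcons0_line addr0 extend_cons.
have ext0 : extend (fun=> g) (fun=> a) (rcons0 0 (0 : 'rV[R]_1)) = g.
  by apply/funext => x; rewrite extend_cons mul0r addr0.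
have [ME|ME] : M = Line \/ M = Circle by case: (M); [left|right].
  have [_ /(on_line ME) /(_ _ Om0) [A nA]] := sf _ _ _ oOm dE.
  near=> C; have BC : B + `|A| + 1 <= C.
    by near: C; apply: nbhs_pinfty_ge; apply: num_real.
  have := near_line (rcons0 1 0) nA; apply: filterS => t; rewrite extE ext0 => H.
  have lA := ler_norm A; have nA0 := normr_ge0 A.
  split; first lra.
  apply: on_both => ME'; last by move: ME'; rewrite ME.
  move=> x Cx; rewrite H; last lra.
  by move: hB.2 => /(on_line ME); apply; lra.
near=> C; have C1 : 1 <= C by near: C; apply: nbhs_pinfty_ge; apply: num_real.
apply: filterS (near_line_diffeo dg va) => t dt; split; first lra.
apply: on_both => ME'; first by move: ME'; rewrite ME.
by move=> x; apply: (vf_periodic _ ME (ve _ dt)).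
Unshelve. all: by end_near. Qed.

Lemma near_line_oriented sigma g a : oriented M sigma g -> is_vf M a ->
  \forall t \near (0 : R), oriented M sigma (fun x => g x + t * a x).
Proof.
move=> og va; have dg := oriented_diffeo og.
pose U : set 'rV[R]_1 := setT; have oU : open U by apply: openT.
have dc := const_diffeo_family U dg; have vc := const_vf_family U va.
have oOm : open (extend_domain M U (fun=> g) (fun=> a)) by apply: open_extend_domain.
have dE : diffeo_family M (extend_domain M U (fun=> g) (fun=> a)) (extend (fun=> g) (fun=> a)).
  by apply: extend_diffeo => //; case: dc.
have Om0 : extend_domain M U (fun=> g) (fun=> a) (rcons0 0 0) by apply: extend_domain0.
have ext0 : extend (fun=> g) (fun=> a) (rcons0 0 (0 : 'rV[R]_1)) = g.
  by apply/funext => x; rewrite extend_cons mul0r addr0.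
have := @diffeo_family_oriented _ _ _ _ _ _ sigma oOm Om0 dE; rewrite ext0 => /(_ og).
move/(near_line (rcons0 1 0)); apply: filterS => t.
rewrite (_ : extend _ _ _ = fun x => g x + t * a x) //.
by apply/funext => x; rewrite rcons0_line addr0 extend_cons.
Qed.

(** The third term is the derivative of the density g', which is linear in g. *)
Lemma derive1_metric_integral eta zeta g a B : smooth_field M eta -> smooth_field M zeta ->
  is_diffeo M g -> is_vf M a -> 0 < B ->
  let J t := \int[mu]_(x in `[lo M B, hi M B])
    (eta (fun y => g y + t * a y) x * zeta (fun y => g y + t * a y) x *
     derive1 (fun y => g y + t * a y) x) in
  derivable J 0 1 /\ derive1 J 0 =
  \int[mu]_(x in `[lo M B, hi M B])
    (dfield eta g a x * zeta g x * derive1 g x + eta g x * dfield zeta g a x * derive1 g x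
     + eta g x * zeta g x * derive1 a x).
Proof.
move=> se sz dg va B0 J.
pose U : set 'rV[R]_1 := setT; have oU : open U by apply: openT.
have dc := const_diffeo_family U dg; have vc := const_vf_family U va.
pose c := extend (fun=> g) (fun=> a) : 'rV[R]_2 -> R -> R.
pose Om := extend_domain M U (fun=> g) (fun=> a).
have oOm : open Om by apply: open_extend_domain.
have dE : diffeo_family M Om c by apply: extend_diffeo => //; case: dc.
have Om0 : Om (rcons0 0 0) by apply: extend_domain0.
have oC := open_cylinder oOm.
have [_ _ /(_ _ _ _ oOm dE) [sE _]] := se; have [_ _ /(_ _ _ _ oOm dE) [sZ _]] := sz.
pose F (q : 'rV[R]_2 * R^o) : R^o :=
  joint (fun s => eta (c s)) q * joint (fun s => zeta (c s)) q * 'D_(0, 1) (joint c) q.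
have sF : smooth_on [set q : 'rV[R]_2 * R^o | Om q.1] F.
  apply: (smooth_onM oC); first exact: (smooth_onM oC).
  exact: smooth_on_derive dE.1.1.
have cE t : c (rcons0 t 0) = fun y => g y + t * a y.
  by apply/funext => y; rewrite /c extend_cons.
have FE t x : F (rcons0 t 0, x) = eta (fun y => g y + t * a y) x *
    zeta (fun y => g y + t * a y) x * derive1 (fun y => g y + t * a y) x.
  by rewrite /F -slice_derive1 /joint /= cE.
pose I (p : 'rV[R]_2) : R^o := \int[mu]_(x in `[lo M B, hi M B]) F (p, x).
have [dI /(_ (rcons0 1 0)) DI] := integral_differentiable (ltW (lo_lt_hi M B0)) oC sF
   (s := rcons0 0 0) (fun _ _ => Om0).
have JE : J = fun t : R => I (t *: rcons0 1 0 + rcons0 0 0).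
  apply/funext => t; apply: eq_Rintegral => x _; rewrite rcons0_line addr0.
  by rewrite FE.
split; first by rewrite JE (derivable_line I) scale0r add0r; apply: diff_derivable.
rewrite derive1E JE (derive_line I) scale0r add0r DI; apply: eq_Rintegral => x _.
have line : 'D_(rcons0 1 0, 0) F (rcons0 0 0, x) = derive1 (fun t => F (rcons0 t 0, x)) 0.
  have -> : (fun t => F (rcons0 t 0, x)) = fun t : R => F (t *: (rcons0 1 0, 0) + (rcons0 0 0, x)).
    apply/funext => t; congr F; congr pair => /=; last by rewrite scaler0 add0r.
    by rewrite rcons0_line addr0.
  by rewrite derive1E (derive_line F) scale0r add0r.
rewrite line; have -> : (fun t => F (rcons0 t 0, x)) = fun t => eta (fun y => g y + t * a y) x *
    zeta (fun y => g y + t * a y) x * (derive1 g x + t * derive1 a x).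
  apply/funext => t; rewrite FE; congr (_ * _).
  have [sg _ _] := dg; have ga := @smooth_derivable R _ x va.1.
  have gg := @smooth_derivable R _ x sg; have dt := @derivable_const R t x.
  by rewrite (derive1_add gg (derivable_mul dt ga)) (derive1_mul dt ga) derive1_const mul0r add0r.
have d1 := @field_line_derivable R M eta g a x se dg va.
have d2 := @field_line_derivable R M zeta g a x sz dg va.
have d3 := @derivable_line1 R (derive1 g x) (derive1 a x) 0.
rewrite (derive1_mul (derivable_mul d1 d2) d3) (derive1_mul d1 d2) derive1_line1 !add0_line.
by rewrite mul0r addr0 -[derive1 _ 0]/(dfield eta g a x) -[derive1 _ 0]/(dfield zeta g a x) mulrDl.
Qed.

(** By derive1_metric_integral, the two sides differ, up to sign, by the integral of
    the derivative of the product w of xi g, eta g and zeta g. *)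
Lemma lc_connection_metric xi eta zeta g : smooth_field M xi -> smooth_field M eta ->
  smooth_field M zeta -> is_diffeo M g ->
  dfun (fun g => metric M g (eta g) (zeta g)) g (xi g) =
  metric M g (lc_connection xi eta g) (zeta g) + metric M g (eta g) (lc_connection xi zeta g).
Proof.
move=> sx se sz dg; have [_ vx _] := sx; have [_ ve _] := se; have [_ vz _] := sz.
have [_ vxe _] := lc_connection_smooth sx se; have [_ vxz _] := lc_connection_smooth sx sz.
set a := xi g; set e := eta g; set z := zeta g.
set ne := lc_connection xi eta g; set nz := lc_connection xi zeta g.
have va : is_vf M a := vx _ dg; have wve : is_vf M e := ve _ dg; have wvz : is_vf M z := vz _ dg.
have wne : is_vf M ne := vxe _ dg; have wnz : is_vf M nz := vxz _ dg.
have [sigma og] := diffeo_oriented dg.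
near (pinfty_nbhs R) => B.
have h1 : \forall t \near (0 : R), within_bound M B (eta (fun x => g x + t * a x)).
  by near: B; apply: near_within_bound.
have h2 : \forall t \near (0 : R), within_bound M B (zeta (fun x => g x + t * a x)).
  by near: B; apply: near_within_bound.
have h3 : within_bound M B ne by near: B; apply: near_vf_bound.
have h4 : within_bound M B nz by near: B; apply: near_vf_bound.
have h5 : within_bound M B a by near: B; apply: near_vf_bound.
have h6 : within_bound M B e by near: B; apply: near_vf_bound.
have h7 : within_bound M B z by near: B; apply: near_vf_bound.
have B0 : 0 < B by case: h3.
have cont h : is_vf M h -> continuous h by move=> [sh _]; apply: smooth_continuous.
have [sg _ _] := dg.
rewrite (metric_eq og (cont _ wne) (cont _ wvz) h3 h7) (metric_eq og (cont _ wve) (cont _ wnz) h6 h4).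
have -> : dfun (fun g => metric M g (eta g) (zeta g)) g a =
    derive1 (fun t => sigma * \int[mu]_(x in `[lo M B, hi M B])
    (eta (fun y => g y + t * a y) x * zeta (fun y => g y + t * a y) x *
     derive1 (fun y => g y + t * a y) x)) 0.
  rewrite /dfun !derive1E; apply: near_eq_derive.
  apply: filterS3 h1 h2 (near_line_oriented og va) => t t1 t2 ot.
  have dt := oriented_diffeo ot.
  by rewrite (metric_eq ot (cont _ (ve _ dt)) (cont _ (vz _ dt)) t1 t2).
have [dJ DJ] := derive1_metric_integral se sz dg va B0.
have dsig := @derivable_const R sigma 0.
rewrite (derive1_mul dsig dJ) derive1_const mul0r add0r DJ -mulrDr; congr (sigma * _).
have s1 := (dfield_vf se dg va).1; have s2 := (dfield_vf sz dg va).1.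
have [sa se' sz'] := And3 va.1 wve.1 wvz.1; have sg' := smooth_derive1 sg.
pose w x := a x * e x * z x.
have sw : smooth w := smoothM (smoothM sa se') sz'.
have co h : smooth h -> cont_on (lo M B) (hi M B) h.
  by move=> sh; apply/cont_on_cont/smooth_continuous.
have sG1 := smoothD (smoothD (smoothM (smoothM s1 sz') sg') (smoothM (smoothM se' s2) sg'))
  (smoothM (smoothM se' sz') (smooth_derive1 sa)).
have sG2 := smoothM (smoothM wne.1 sz') sg'.
have sG3 := smoothM (smoothM se' wnz.1) sg'.
rewrite -(cont_on_intD (co _ sG2) (co _ sG3)) -[LHS]addr0.
rewrite -(int_derive1_eq0 sw (within_bound_mul (within_bound_mul h5 h6) h7)).
rewrite -(cont_on_intD (co _ sG1) (co _ (smooth_derive1 sw))).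
apply: eq_Rintegral => x _; rewrite /ne /nz /lc_connection /christoffel -/a -/e -/z.
have [da de dz] := And3 (@smooth_derivable R _ x sa)
  (@smooth_derivable R _ x se') (@smooth_derivable R _ x sz').
rewrite /w (derive1_mul (derivable_mul da de) dz) (derive1_mul da de) (derive1_mul da dz).
have := diffeo_derive1_neq0 x dg.
move: (dfield _ _ _ _) (dfield _ _ _ _) (derive1 g x) (derive1 a x) (derive1 e x) (derive1 z x) => ? ? ? ? ? ? ?.
by field.
Unshelve. all: by end_near. Qed.

Theorem lc_connection_levi_civita : levi_civita M lc_connection.
Proof.
split; first split.
- exact: lc_connection_smooth.
- by move=> f xi1 xi2 eta _ s1 s2 se g dg x; apply: lc_connection_linearl.
- by move=> xi eta1 eta2 sx s1 s2 g dg x; apply: lc_connection_additiver.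
- by move=> f xi eta sf sx se g dg x; apply: lc_connection_leibniz.
- by move=> xi eta _ _ g _ x; apply: lc_connection_torsion_free.
- by move=> xi eta zeta sx se sz g dg; apply: lc_connection_metric.
Qed.

End Connection.

(** * Uniqueness of the Levi-Civita connection *)

Section Uniqueness.
Context {R : realType} (M : manifold).
Notation P := (@period R).
Notation mu := (@lebesgue_measure R).
Implicit Types (xi eta zeta : (R -> R) -> R -> R) (g h k l X Y Z V : R -> R).

Lemma vf_family_opp n (U : set 'rV[R]_n.+1) f : open U -> vf_family M U f ->
  vf_family M U (fun s x => - f s x).
Proof.
move=> oU [[sf mf] vf]; split; first split.
- exact: (smooth_onN (open_cylinder oU) sf).
- apply: on_both => // ME s0 Us0; have [A nA] := on_line ME mf _ Us0.
  by exists A; apply: filterS nA => s H x Ax; rewrite H.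
- move=> s Us; have [ss ws] := vf _ Us; split.
    exact: (smooth_onN openT ss).
  apply: on_both => ME; last by move=> x; rewrite (on_circle ME ws).
  by have [A hA] := on_line ME ws; exists A => x Ax; rewrite hA // oppr0.
Qed.

Lemma vf_sub h k : is_vf M h -> is_vf M k -> is_vf M (fun x => h x - k x).
Proof.
move=> vh vk; have oT : open [set: 'rV[R]_1] by apply: openT.
have [_ H] := vf_family_add oT (const_vf_family setT vh)
  (vf_family_opp oT (const_vf_family setT vk)).
exact: (H 0 I).
Qed.

Lemma smooth_fieldB xi eta : smooth_field M xi -> smooth_field M eta ->
  smooth_field M (fun g x => xi g x - eta g x).
Proof.
move=> [lx vx sx] [le ve se]; split.
- rewrite /lift_invariant; apply: on_both => // ME g k dg.
  by rewrite (on_circle ME lx g k dg) (on_circle ME le g k dg).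
- by move=> g dg; apply: vf_sub; [apply: vx|apply: ve].
- move=> n U c oU dc.
  have fx : vf_family M U (fun s => xi (c s)) by apply: field_vf_family.
  have fe : vf_family M U (fun s => eta (c s)) by apply: field_vf_family.
  by have [] := vf_family_add oU fx (vf_family_opp oU fe).
Qed.

Lemma lie_bracket_smooth xi eta : smooth_field M xi -> smooth_field M eta ->
  smooth_field M (lie_bracket xi eta).
Proof.
move=> sx se; rewrite (_ : lie_bracket xi eta =
    fun g x => lc_connection xi eta g x - lc_connection eta xi g x).
  by apply: smooth_fieldB; apply: lc_connection_smooth.
by apply/funext => g; apply/funext => x; rewrite lc_connection_torsion_free.
Qed.

Lemma metricC g h k : metric M g h k = metric M g k h.
Proof.
by rewrite /metric /ip; case: M; apply: eq_Rintegral => x _; rewrite mulrC.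
Qed.

Lemma metricB g h k l : is_diffeo M g -> is_vf M h -> is_vf M k -> is_vf M l ->
  metric M g (fun x => h x - k x) l = metric M g h l - metric M g k l.
Proof.
move=> dg vh vk vl; have [sigma og] := diffeo_oriented dg.
have vhk := vf_sub vh vk.
near (pinfty_nbhs R) => B.
have b1 : within_bound M B h by near: B; apply: near_vf_bound.
have b2 : within_bound M B k by near: B; apply: near_vf_bound.
have b3 : within_bound M B l by near: B; apply: near_vf_bound.
have b4 : within_bound M B (fun x => h x - k x) by near: B; apply: near_vf_bound.
have [sg _ _] := dg.
have c (f : R -> R) : is_vf M f -> continuous f by move=> [sf _]; apply: smooth_continuous.
rewrite (metric_eq og (c _ vhk) (c _ vl) b4 b3) (metric_eq og (c _ vh) (c _ vl) b1 b3).
rewrite (metric_eq og (c _ vk) (c _ vl) b2 b3) -mulrBr -cont_on_intB.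
- by congr (sigma * _); apply: eq_Rintegral => x _; rewrite !mulrBl.
- exact/cont_on_cont/smooth_continuous/(smoothM (smoothM vh.1 vl.1) (smooth_derive1 sg)).
- exact/cont_on_cont/smooth_continuous/(smoothM (smoothM vk.1 vl.1) (smooth_derive1 sg)).
Unshelve. all: by end_near. Qed.

(** Let S x y z be the metric applied to the difference of the two connections
    at x, y and to z.  Torsion freeness makes S symmetric in x and y, and
    compatibility with the metric makes it skew in y and z; these symmetries
    imply S = - S.  With z the difference itself, definiteness concludes. *)
Lemma levi_civita_unique nabla1 nabla2 xi eta g :
  levi_civita M nabla1 -> levi_civita M nabla2 ->
  smooth_field M xi -> smooth_field M eta -> is_diffeo M g ->
  nabla1 xi eta g = nabla2 xi eta g.
Proof.
move=> [[sm1 _ _ _] t1 m1] [[sm2 _ _ _] t2 m2] sx se dg.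
pose A x y : (R -> R) -> R -> R := fun g z => nabla1 x y g z - nabla2 x y g z.
have sA x y : smooth_field M x -> smooth_field M y -> smooth_field M (A x y).
  by move=> ? ?; apply: smooth_fieldB; [apply: sm1|apply: sm2].
have vf x : smooth_field M x -> is_vf M (x g) by move=> [_ vx _]; apply: vx.
pose S x y z := metric M g (A x y g) (z g).
have Ssym x y z : smooth_field M x -> smooth_field M y -> S x y z = S y x z.
  move=> xs ys; rewrite /S (_ : A x y g = A y x g) //; apply/funext => u.
  have := t1 _ _ xs ys g dg u; rewrite -(t2 _ _ xs ys g dg u) /A => /eqP.
  by rewrite subr_eq => /eqP ->; ring.
have Sskew x y z : smooth_field M x -> smooth_field M y -> smooth_field M z ->
    S x y z = - S x z y.
  move=> xs ys zs; apply/eqP; rewrite -addr_eq0 /S /A.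
  rewrite !metricB //; do ?by apply: vf; auto.
  rewrite [metric M g (nabla1 x z g) _]metricC [metric M g (nabla2 x z g) _]metricC.
  by rewrite addrACA -opprD -(m1 _ _ _ xs ys zs g dg) -(m2 _ _ _ xs ys zs g dg) subrr.
have S0 x y z : smooth_field M x -> smooth_field M y -> smooth_field M z -> S x y z = 0.
  move=> xs ys zs; suff : S x y z = - S x y z by lra.
  rewrite {1}(Sskew _ _ _ xs ys zs) (Ssym _ _ _ xs zs) (Sskew _ _ _ zs xs ys) opprK.
  by rewrite (Ssym _ _ _ zs ys) (Sskew _ _ _ ys zs xs) (Ssym _ _ _ ys xs).
have := metric_definite dg (vf _ (sA _ _ sx se)) (S0 _ _ _ sx se (sA _ _ sx se)).
move=> E; apply/funext => x; apply/eqP; rewrite -subr_eq0.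
by have := congr1 (@^~ x) E; rewrite /A /= => ->.
Qed.

End Uniqueness.

(** * The curvature *)

Section Curvature.
Context {R : realType} (M : manifold).
Notation P := (@period R).
Notation mu := (@lebesgue_measure R).
Implicit Types (xi eta zeta : (R -> R) -> R -> R) (g h k l a X Y Z V : R -> R).

Lemma derive1_sub (f k : R -> R) (x : R) : derivable f x 1 -> derivable k x 1 ->
  derive1 (fun t => f t - k t) x = derive1 f x - derive1 k x.
Proof. by move=> df dk; rewrite !derive1E; apply: deriveB. Qed.

Lemma derivable_sub (f k : R -> R) (x : R) : derivable f x 1 -> derivable k x 1 ->
  derivable (fun t => f t - k t) x 1.
Proof. exact: derivableB. Qed.

(** Symmetry of the second derivatives, one in the parameter and one in space,
    of the value of eta along g + t a. *)
Lemma line_derive1 eta g a x : smooth_field M eta -> is_diffeo M g -> is_vf M a ->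
  derivable (fun t : R => derive1 (eta (fun y => g y + t * a y)) x) 0 1 /\
  derive1 (fun t => derive1 (eta (fun y => g y + t * a y)) x) 0 =
  derive1 (dfield eta g a) x.
Proof.
move=> se dg va.
pose U : set 'rV[R]_1 := setT; have oU : open U by apply: openT.
have dc := const_diffeo_family U dg; have vc := const_vf_family U va.
pose c := extend (fun=> g) (fun=> a) : 'rV[R]_2 -> R -> R.
pose Om := extend_domain M U (fun=> g) (fun=> a).
have oOm : open Om by apply: open_extend_domain.
have dE : diffeo_family M Om c by apply: extend_diffeo => //; case: dc.
have Om0 : Om (rcons0 0 0) by apply: extend_domain0.
have oC := open_cylinder oOm.
have [_ _ /(_ _ _ _ oOm dE) [sE _]] := se.
pose J := joint (fun s => eta (c s)); pose v : 'rV[R]_2 * R^o := (rcons0 1 0, 0).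
have lineE : (fun t : R => derive1 (eta (fun y => g y + t * a y)) x) =
    fun t => 'D_(0, 1) J (t *: v + (rcons0 0 0, x)).
  apply/funext => t; rewrite (_ : t *: v + _ = (rcons0 t 0, x)); last first.
    by congr pair => /=; [rewrite rcons0_line addr0|rewrite scaler0 add0r].
  rewrite /J -slice_derive1; congr (derive1 (eta _) x); apply/funext => y.
  by rewrite /c extend_cons.
have sJ : smooth_on [set p : 'rV[R]_2 * R^o | Om p.1] J by exact: sE.
pose w : 'rV[R]_2 * R^o := (0, 1).
have sD := smooth_on_derive w sJ.
have p0 : [set p : 'rV[R]_2 * R^o | Om p.1] (rcons0 0 0, x) by [].
rewrite lineE; split.
  rewrite (derivable_line ('D_(0, 1) J)) scale0r add0r; apply: diff_derivable.
  exact: smooth_on_diff sD p0.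
rewrite derive1E (derive_line ('D_(0, 1) J)) scale0r add0r.
rewrite (derive_comm v w oC sJ p0).
have -> : dfield eta g a = fun y => 'D_v J (rcons0 0 0, y).
  by apply/funext => y; rewrite /J /v -dfield_extend.
pose K (s : 'rV[R]_2) (y : R) := 'D_v J (s, y).
rewrite (_ : 'D_v J = joint K); last by apply/funext => -[s y].
by rewrite /w -slice_derive1.
Qed.

(** Fields are constrained on diffeomorphisms only; at g, the derivative of a
    field depends on its values at diffeomorphisms near g. *)
Lemma lc_connection_congr xi eta1 eta2 g : smooth_field M xi -> is_diffeo M g ->
  (forall g', is_diffeo M g' -> eta1 g' = eta2 g') ->
  lc_connection xi eta1 g = lc_connection xi eta2 g.
Proof.
move=> [_ vx _] dg E; apply/funext => x; rewrite /lc_connection E //; congr (_ + _).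
rewrite /dfield /dfun !derive1E; apply: near_eq_derive.
by apply: filterS (near_line_diffeo dg (vx _ dg)) => t dt; rewrite E.
Qed.

Section CurvatureFormula.
Variables (xi eta zeta : (R -> R) -> R -> R) (g : R -> R) (x : R).
Hypotheses (sx : smooth_field M xi) (se : smooth_field M eta) (sz : smooth_field M zeta).
Hypothesis dg : is_diffeo M g.

(** The Leibniz rule for christoffel; the last term comes from the denominator
    g', whose derivative is a'. *)
Lemma dfield_lc_connection a : is_vf M a ->
  dfield (lc_connection eta zeta) g a x =
  dfun (fun g' => dfield zeta g' (eta g') x) g a +
  (christoffel g (dfield eta g a) (zeta g) x + christoffel g (eta g) (dfield zeta g a) x
   - christoffel g (eta g) (zeta g) x * derive1 a x / derive1 g x).
Proof.
move=> va; pose gt t : R -> R := fun y => g y + t * a y.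
have [_ ve _] := se; have [_ vz _] := sz; have [sg _ _] := dg.
have wve := ve _ dg; have wvz := vz _ dg.
pose N t := derive1 (eta (gt t)) x * zeta (gt t) x + eta (gt t) x * derive1 (zeta (gt t)) x.
have g0 := diffeo_derive1_neq0 x dg.
pose Q t := N t * (derive1 g x + t * derive1 a x)^-1.
have [e1 E1] := line_derive1 x se dg va; have [e2 E2] := line_derive1 x sz dg va.
have f1 := @field_line_derivable R M eta g a x se dg va.
have f2 := @field_line_derivable R M zeta g a x sz dg va.
have dN : derivable N 0 1 := derivable_add (derivable_mul e1 f2) (derivable_mul f1 e2).
have dD := @derivable_line1 R (derive1 g x) (derive1 a x) 0.
have D0 : derive1 g x + 0 * derive1 a x != 0 by rewrite mul0r addr0.
have dV := @derivable_inv R (fun t => derive1 g x + t * derive1 a x) 0 D0 dD.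
have dQ : derivable Q 0 1 := derivable_mul dN dV.
have nE : \forall t \near (0 : R), lc_connection eta zeta (gt t) x =
    dfield zeta (gt t) (eta (gt t)) x + Q t.
  apply: filterS (near_line_diffeo dg va) => t dt.
  rewrite /lc_connection /christoffel /Q; congr (_ + _ / _).
    by rewrite (derive1_mul (@smooth_derivable R _ x (ve _ dt).1) (@smooth_derivable R _ x (vz _ dt).1)).
  have ga := @smooth_derivable R _ x va.1; have gg := @smooth_derivable R _ x sg.
  have dc := @derivable_const R t x.
  by rewrite (derive1_add gg (derivable_mul dc ga)) (derive1_mul dc ga) derive1_const mul0r add0r.
pose Dz t := dfield zeta (gt t) (eta (gt t)) x.
have dDz : derivable Dz 0 1.
  have dl := @field_line_derivable R M _ g a x (lc_connection_smooth se sz) dg va.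
  apply: near_eq_derivable (derivable_sub dl dQ); apply: filterS nE => t ->.
  by rewrite addrK.
rewrite /dfield {1}/dfun derive1E (near_eq_derive _ nE) -derive1E.
rewrite (derive1_add dDz dQ); congr (_ + _).
rewrite /Q (derive1_mul dN dV) (@derive1_inv R (fun t => derive1 g x + t * derive1 a x) 0 D0 dD) derive1_line1.
rewrite /N (derive1_add (derivable_mul e1 f2) (derivable_mul f1 e2)).
rewrite (derive1_mul e1 f2) (derive1_mul f1 e2) E1 E2.
have v1 := dfield_vf se dg va; have v2 := dfield_vf sz dg va.
have [s1 s2 s3 s4] := And4 (@smooth_derivable R _ x v1.1) (@smooth_derivable R _ x v2.1)
  (@smooth_derivable R _ x wve.1) (@smooth_derivable R _ x wvz.1).
rewrite /christoffel (derive1_mul s1 s4) (derive1_mul s3 s2) (derive1_mul s3 s4) /gt !add0_line.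
rewrite -[derive1 (fun t => eta _ x) 0]/(dfield eta g a x).
rewrite -[derive1 (fun t => zeta _ x) 0]/(dfield zeta g a x).
move: g0 (dfield eta g a x) (dfield zeta g a x) (derive1 (dfield eta g a) x) (derive1 (dfield zeta g a) x).
move: (derive1 g x) (derive1 a x) (derive1 (eta g) x) (derive1 (zeta g) x) => ? ? ? ? ? ? ? ? ?.
by field.
Qed.

End CurvatureFormula.

End Curvature.

Section CurvatureFormula.
Context {R : realType} (M : manifold).
Implicit Types (xi eta zeta : (R -> R) -> R -> R) (g h k l X Y Z V W : R -> R) (x : R).

Lemma christoffel_smooth g h k : is_diffeo M g -> smooth h -> smooth k ->
  smooth (christoffel g h k).
Proof.
move=> dg sh sk; have [sg _ _] := dg.
apply: smoothM; first exact: smooth_derive1 (smoothM sh sk).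
by apply: smoothV (smooth_derive1 sg) => x; apply: diffeo_derive1_neq0 dg.
Qed.

Lemma christoffelDr g h k l x : smooth h -> smooth k -> smooth l ->
  christoffel g h (fun y => k y + l y) x = christoffel g h k x + christoffel g h l x.
Proof.
move=> sh sk sl; rewrite /christoffel -mulrDl.
have dk := @smooth_derivable R _ x (smoothM sh sk).
have dl := @smooth_derivable R _ x (smoothM sh sl).
rewrite -(derive1_add dk dl).
rewrite (_ : (fun y => h y * (k y + l y)) = fun y => h y * k y + h y * l y) //.
by apply/funext => y; rewrite mulrDr.
Qed.

Lemma christoffelBl g h k l x : smooth h -> smooth k -> smooth l ->
  christoffel g (fun y => h y - k y) l x = christoffel g h l x - christoffel g k l x.
Proof.
move=> sh sk sl; rewrite /christoffel -mulrBl.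
have dh := @smooth_derivable R _ x (smoothM sh sl).
have dk := @smooth_derivable R _ x (smoothM sk sl).
rewrite -(derive1_sub dh dk).
rewrite (_ : (fun y => (h y - k y) * l y) = fun y => h y * l y - k y * l y) //.
by apply/funext => y; rewrite mulrBl.
Qed.

(** The terms with two derivatives along fields cancel against the derivative of
    zeta along the bracket by dfield_bracket.  The Christoffel forms that
    involve first derivatives of the fields cancel by bilinearity. *)
Lemma lc_curvature xi eta zeta g x :
  smooth_field M xi -> smooth_field M eta -> smooth_field M zeta -> is_diffeo M g ->
  curvature lc_connection xi eta zeta g x =
  christoffel g (xi g) (christoffel g (eta g) (zeta g)) x
  - christoffel g (eta g) (christoffel g (xi g) (zeta g)) x
  + (christoffel g (xi g) (zeta g) x * derive1 (eta g) x
     - christoffel g (eta g) (zeta g) x * derive1 (xi g) x) / derive1 g x.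
Proof.
move=> sx se sz dg; have [_ vx _] := sx; have [_ ve _] := se; have [_ vz _] := sz.
have wx := vx _ dg; have we := ve _ dg; have wz := vz _ dg.
have dB := dfield_bracket x sz sx se dg.
have lcE u v : lc_connection u v g x = dfield v g (u g) x + christoffel g (u g) (v g) x by [].
rewrite /curvature (lcE xi) (lcE eta) (lcE (lie_bracket xi eta)) -dB.
rewrite (dfield_lc_connection x se sz dg wx) (dfield_lc_connection x sx sz dg we).
have sp := (dfield_vf se dg wx).1; have sq := (dfield_vf sx dg we).1.
have sr := (dfield_vf sz dg wx).1; have ss := (dfield_vf sz dg we).1.
have sc1 := christoffel_smooth dg we.1 wz.1; have sc2 := christoffel_smooth dg wx.1 wz.1.
rewrite (christoffelDr g x wx.1 ss sc1) (christoffelDr g x we.1 sr sc2).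
rewrite (christoffelBl g x sp sq wz.1).
move: (dfun _ g (xi g)) (dfun _ g (eta g)) => ? ?.
move: (christoffel _ _ _ x) (christoffel _ _ _ x) (christoffel _ _ _ x) (christoffel _ _ _ x) => ? ? ? ?.
move: (christoffel _ _ _ x) (christoffel _ _ _ x) (christoffel _ _ _ x) (christoffel _ _ _ x) => ? ? ? ?.
move: (derive1 (xi g) x) (derive1 (eta g) x) (derive1 g x) => ? ? ?.
ring.
Qed.

(** The metric is right invariant and the Christoffel form at the identity is
    (Y Z)'. *)
Lemma christoffel_comp g Y Z x : is_diffeo M g -> smooth Y -> smooth Z ->
  christoffel g (Y \o g) (Z \o g) x = derive1 (fun y => Y y * Z y) (g x).
Proof.
move=> dg sY sZ; have [sg _ _] := dg; rewrite /christoffel.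
rewrite -[fun y => _]/((fun y => Y y * Z y) \o g).
rewrite derive1_comp; [|exact: smooth_derivable|exact: smooth_derivable (smoothM sY sZ)].
by rewrite mulfK // (diffeo_derive1_neq0 x dg).
Qed.

(** By christoffel_comp, no second derivative of g enters. *)
Lemma lc_curvature_rtriv xi eta zeta g X Y Z x :
  smooth_field M xi -> smooth_field M eta -> smooth_field M zeta -> is_diffeo M g ->
  is_vf M X -> is_vf M Y -> is_vf M Z ->
  rtriv g (xi g) = X -> rtriv g (eta g) = Y -> rtriv g (zeta g) = Z ->
  rtriv g (curvature lc_connection xi eta zeta g) x =
    - derive1n 2 X x * Y x * Z x + X x * derive1n 2 Y x * Z x
    - 2 * derive1 X x * Y x * derive1 Z x + 2 * X x * derive1 Y x * derive1 Z x.
Proof.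
move=> sx se sz dg [sX _] [sY _] [sZ _] EX EY EZ; have [sg _ _] := dg.
have unr F T : rtriv g F = T -> F = T \o g.
  by move=> <-; apply/funext => y; rewrite /rtriv /= (ginvK dg).
rewrite {1}/rtriv /= (lc_curvature _ sx se sz dg) (unr _ _ EX) (unr _ _ EY) (unr _ _ EZ).
set u := ginv g x; have gu : g u = x by apply: ginvKV dg x.
have CE T U : smooth T -> smooth U ->
    christoffel g (T \o g) (U \o g) = derive1 (fun y => T y * U y) \o g.
  by move=> sT sU; apply/funext => y; apply: christoffel_comp.
have dYZ := smooth_derive1 (smoothM sY sZ); have dXZ := smooth_derive1 (smoothM sX sZ).
rewrite (CE _ _ sY sZ) (CE _ _ sX sZ) (CE _ _ sX dYZ) (CE _ _ sY dXZ).
have dcomp T : smooth T -> derive1 (T \o g) u = derive1 T x * derive1 g u.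
  move=> sT; rewrite derive1_comp ?gu //; exact: smooth_derivable.
rewrite !dcomp //= gu.
have D f (y : R) : smooth f -> derivable f y 1 by move=> sf; apply: (@smooth_derivable R f y sf).
have DM (T U : R -> R) : smooth T -> smooth U ->
    derive1 (fun y => T y * U y) = fun y => derive1 T y * U y + T y * derive1 U y.
  by move=> sT sU; apply/funext => y; apply: derive1_mul; apply: D.
have [sX' sY' sZ'] := And3 (smooth_derive1 sX) (smooth_derive1 sY) (smooth_derive1 sZ).
rewrite (DM _ _ sX dYZ) (DM _ _ sY dXZ) (DM _ _ sY sZ) (DM _ _ sX sZ).
have DDM (T U : R -> R) : smooth T -> smooth U ->
    derive1 (fun y => derive1 T y * U y + T y * derive1 U y) x =
    derive1 (derive1 T) x * U x + derive1 T x * derive1 U x +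
    (derive1 T x * derive1 U x + T x * derive1 (derive1 U) x).
  move=> sT sU; have [sT' sU'] := conj (smooth_derive1 sT) (smooth_derive1 sU).
  have [d1 d2] := conj (D _ x (smoothM sT' sU)) (D _ x (smoothM sT sU')).
  by rewrite (derive1_add d1 d2) (DM _ _ sT' sU) (DM _ _ sT sU').
rewrite (DDM _ _ sY sZ) (DDM _ _ sX sZ).
have := diffeo_derive1_neq0 u dg.
move: (derive1 (derive1 X) x) (derive1 (derive1 Y) x) (derive1 (derive1 Z) x) => ? ? ?.
move: (derive1 X x) (derive1 Y x) (derive1 Z x) (derive1 g u) (X x) (Y x) (Z x) => ? ? ? ? ? ? ? ?.
by field.
Qed.

Lemma derive1_ad X Y x : smooth X -> smooth Y ->
  derive1 (ad X Y) x = derive1n 2 X x * Y x - X x * derive1n 2 Y x.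
Proof.
move=> sX sY; have [sX' sY'] := conj (smooth_derive1 sX) (smooth_derive1 sY).
have D f : smooth f -> derivable f x 1 by move=> sf; apply: (@smooth_derivable R f x sf).
rewrite /ad (derive1_sub (D _ (smoothM sX' sY)) (D _ (smoothM sX sY'))).
rewrite (derive1_mul (D _ sX') (D _ sY)) (derive1_mul (D _ sX) (D _ sY')).
rewrite -[derive1n 2 X x]/(derive1 (derive1 X) x) -[derive1n 2 Y x]/(derive1 (derive1 Y) x).
move: (derive1 (derive1 X) x) (derive1 (derive1 Y) x) (derive1 X x) (derive1 Y x) (X x) (Y x) => ? ? ? ? ? ?.
ring.
Qed.

End CurvatureFormula.

(** * The adjoint of ad *)

Section Adjoint.
Context {R : realType} (M : manifold).
Notation P := (@period R).
Notation mu := (@lebesgue_measure R).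
Implicit Types (X Y Z V W h k : R -> R) (x : R).

Lemma vf_derive1 h : is_vf M h -> is_vf M (derive1 h).
Proof.
move=> vh; split; first exact: smooth_derive1 vh.1.
apply: on_both => ME; last by move=> x; apply: periodic_derive1 => y; exact: (vf_periodic y ME vh).
have [A hA] := vf_bound ME vh; exists A => x Ax.
by rewrite (near_gt_eq_derive1 (k := fun=> 0) _ Ax) ?derive1_const.
Qed.

Lemma vf_mul h k : is_vf M h -> is_vf M k -> is_vf M (fun x => h x * k x).
Proof.
move=> vh vk; split; first exact: smoothM vh.1 vk.1.
apply: on_both => ME; last by move=> x; rewrite !(vf_periodic _ ME).
by have [A hA] := vf_bound ME vh; exists A => x Ax; rewrite hA // mul0r.
Qed.

Lemma vf_add h k : is_vf M h -> is_vf M k -> is_vf M (fun x => h x + k x).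
Proof.
move=> vh vk; have oT : open [set: 'rV[R]_1] by apply: openT.
have [_ H] := vf_family_add oT (const_vf_family setT vh) (const_vf_family setT vk).
exact: (H 0 I).
Qed.

Lemma vf_ad X Y : is_vf M X -> is_vf M Y -> is_vf M (ad X Y).
Proof.
by move=> vX vY; apply: vf_sub; apply: vf_mul => //; apply: vf_derive1.
Qed.

(** 2 Z' V + Z V', with the factor 2 written as a sum so that closure of vector
    fields under sums and products applies. *)
Definition ad_adjoint Z V : R -> R :=
  fun x => (derive1 Z x * V x + derive1 Z x * V x) + Z x * derive1 V x.

Lemma vf_ad_adjoint Z V : is_vf M Z -> is_vf M V -> is_vf M (ad_adjoint Z V).
Proof.
move=> vZ vV; have vZ' := vf_derive1 vZ; have vV' := vf_derive1 vV.
exact: vf_add (vf_add (vf_mul vZ' vV) (vf_mul vZ' vV)) (vf_mul vZ vV').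
Qed.

(** Integration by parts: the difference of the two integrands is the
    derivative of Z Y V. *)
Lemma ip_ad Z Y V : is_vf M Z -> is_vf M Y -> is_vf M V ->
  ip M (ad Z Y) V = ip M Y (ad_adjoint Z V).
Proof.
move=> vZ vY vV; have vA := vf_ad vZ vY; have vW := vf_ad_adjoint vZ vV.
near (pinfty_nbhs R) => B.
have bZ : within_bound M B Z by near: B; apply: near_vf_bound.
have bY : within_bound M B Y by near: B; apply: near_vf_bound.
have bV : within_bound M B V by near: B; apply: near_vf_bound.
have bA : within_bound M B (ad Z Y) by near: B; apply: near_vf_bound.
have bW : within_bound M B (ad_adjoint Z V) by near: B; apply: near_vf_bound.
have c h : is_vf M h -> continuous h by move=> [sh _]; apply: smooth_continuous.
rewrite (ip_eq (c _ vA) (c _ vV) bA bV) (ip_eq (c _ vY) (c _ vW) bY bW).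
have sF := smoothM (smoothM vZ.1 vY.1) vV.1.
rewrite -[LHS]addr0 -(int_derive1_eq0 sF (within_bound_mul (within_bound_mul bZ bY) bV)).
have co h : smooth h -> cont_on (lo M B) (hi M B) h.
  by move=> sh; apply/cont_on_cont/smooth_continuous.
rewrite -(cont_on_intD (co _ (smoothM vA.1 vV.1)) (co _ (smooth_derive1 sF))).
apply: eq_Rintegral => x _; rewrite /ad /ad_adjoint.
have D f : smooth f -> derivable f x 1 by move=> sf; apply: (@smooth_derivable R f x sf).
rewrite (derive1_mul (derivable_mul (D _ vZ.1) (D _ vY.1)) (D _ vV.1)).
rewrite (derive1_mul (D _ vZ.1) (D _ vY.1)).
move: (derive1 Z x) (derive1 Y x) (derive1 V x) (Z x) (Y x) (V x) => ? ? ? ? ? ?.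
ring.
Unshelve. all: by end_near. Qed.

Lemma id_diffeo : is_diffeo M (id : R -> R).
Proof.
split; first exact: smooth_id.
  by exists id; split=> //; exact: smooth_id.
by case: M => //; left.
Qed.

Lemma metric_id h k : metric M id h k = ip M h k.
Proof.
rewrite /metric /rtriv (_ : ginv id = id) //.
by apply/funext => x; apply: (ginvK id_diffeo x).
Qed.

(** The candidate exists by ip_ad; two adjoints have a difference D orthogonal to
    itself, which is 0 by definiteness of the metric at the identity. *)
Lemma ad_topE Z V : is_vf M Z -> is_vf M V -> ad_top M Z V = ad_adjoint Z V.
Proof.
move=> vZ vV; have vW := vf_ad_adjoint vZ vV.
have [vG HG] : is_vf M (ad_top M Z V) /\
    forall Y, is_vf M Y -> ip M (ad Z Y) V = ip M Y (ad_top M Z V).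
  apply: (@getPex _ (fun W => is_vf M W /\ forall Y, is_vf M Y -> ip M (ad Z Y) V = ip M Y W)).
  by exists (ad_adjoint Z V); split=> // Y vY; apply: ip_ad.
pose D x := ad_top M Z V x - ad_adjoint Z V x.
have vD : is_vf M D by apply: vf_sub.
have D0 : metric M id D D = 0.
  rewrite (metricB id_diffeo vG vW vD) (@metricC R M id (ad_top M Z V) D).
  rewrite (@metricC R M id (ad_adjoint Z V) D) !metric_id.
  by rewrite -(HG _ vD) -(ip_ad vZ vD vV) subrr.
apply/funext => x; apply/eqP; rewrite -subr_eq0.
by have := congr1 (@^~ x) (metric_definite id_diffeo vD D0); rewrite /D /= => ->.
Qed.

End Adjoint.

Theorem mainTheorem7 (R : realType) (M : manifold) :
  (exists nabla : ((R -> R) -> R -> R) -> ((R -> R) -> R -> R) ->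
                  ((R -> R) -> R -> R),
     levi_civita M nabla) /\
  (forall nabla : ((R -> R) -> R -> R) -> ((R -> R) -> R -> R) ->
                  ((R -> R) -> R -> R),
   levi_civita M nabla ->
   forall (xi eta zeta : (R -> R) -> R -> R),
   smooth_field M xi -> smooth_field M eta -> smooth_field M zeta ->
   forall g : R -> R, is_diffeo M g ->
   forall X Y Z : R -> R, is_vf M X -> is_vf M Y -> is_vf M Z ->
   rtriv g (xi g) = X -> rtriv g (eta g) = Y -> rtriv g (zeta g) = Z ->
   forall x : R,
   [/\ rtriv g (curvature nabla xi eta zeta g) x =
         - derive1n 2 X x * Y x * Z x + X x * derive1n 2 Y x * Z x
         - 2 * derive1 X x * Y x * derive1 Z x
         + 2 * X x * derive1 Y x * derive1 Z x,
       - derive1n 2 X x * Y x * Z x + X x * derive1n 2 Y x * Z x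
         - 2 * derive1 X x * Y x * derive1 Z x
         + 2 * X x * derive1 Y x * derive1 Z x =
         - 2 * ad X Y x * derive1 Z x - derive1 (ad X Y) x * Z x &
       - 2 * ad X Y x * derive1 Z x - derive1 (ad X Y) x * Z x =
         - alpha M (ad X Y) Z x]).
Proof.
split; first by exists lc_connection; apply: lc_connection_levi_civita.
move=> nabla lc xi eta zeta sx se sz g dg X Y Z vX vY vZ EX EY EZ x.
have lc0 := @lc_connection_levi_civita R M.
have [[sm _ _ _] _ _] := lc.
split.
- rewrite -(lc_curvature_rtriv x sx se sz dg vX vY vZ EX EY EZ); congr (rtriv g _ x).
  have two u v : smooth_field M u -> smooth_field M v ->
      nabla u (nabla v zeta) g = lc_connection u (lc_connection v zeta) g.
    move=> su sv; rewrite (levi_civita_unique lc lc0 su (sm _ _ sv sz) dg).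
    apply: (lc_connection_congr su dg) => g' dg'.
    exact: levi_civita_unique lc lc0 sv sz dg'.
  apply/funext => y; rewrite /curvature (two _ _ sx se) (two _ _ se sx).
  by rewrite (levi_civita_unique lc lc0 (lie_bracket_smooth sx se) sz dg).
- rewrite (derive1_ad x vX.1 vY.1) /ad.
  move: (derive1n 2 X x) (derive1n 2 Y x) (derive1 X x) (derive1 Y x) (derive1 Z x) => ? ? ? ? ?.
  move: (X x) (Y x) (Z x) => ? ? ?; ring.
- rewrite /alpha (ad_topE vZ (vf_ad vX vY)) /ad_adjoint.
  by move: (ad X Y x) (derive1 (ad X Y) x) (derive1 Z x) (Z x) => ? ? ? ?; ring.
Qed.
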